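(* Suppose Assumptions 1, 2, 3 of the context hold. Let $\bar x_*$ be the output of the two-phase ZS-BMD method (described in the context) applied to $\min_{x\in X}\{\Phi(x)=f(x)+\chi(x)\}$ with number of runs $S$, number $\tilde T$ of oracle calls per run, and post-optimization sample size $\mathcal T$. Let $\mathfrak g_f(\bar x_* )=\mathcal P(\bar x_*,\nabla f(\bar x_* ),1/\hat L)$ and $$\mathbf B_{\tilde T}=\frac{64\sqrt{(n+4)(2M^2+\sigma^2)}}{\sqrt{\tilde T}}\Big(\tilde D\gamma_1+\frac{D_\Phi^2}{\tilde D}\Big)+\frac{(64\gamma_2+33)\tilde LD_\Phi^2(n+4)}{\tilde T},$$ $$\gamma_1=\max\Big\{\frac{\sqrt{(n+4)(2M^2+\sigma^2)}}{\tilde L\tilde D\sqrt{\tilde T}},1\Big\},\qquad\gamma_2=\max\Big\{\frac{n+4}{\tilde T},1\Big\}.$$ Then for all $\lambda>0$, $$\mathrm{Prob}\Big\{\|\mathfrak g_f(\bar x_* )\|^2\ge16b\tilde L\mathbf B_{\tilde T}+\frac{3D_\Phi^2L_f^2b(n+4)}{\tilde T}+\frac{32(n+4)\lambda}{\mathcal T}\Big[2M^2+\sigma^2+\frac{D_\Phi^2L_f^2b}{\tilde T}\Big]\Big\}\le\frac{S+1}{\lambda}+2^{-S}.$$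
   Context: Notation: $n=n_1+\dots+n_b$, $\mathcal B=\{1,\dots,b\}$, $U_s\in\mathbb R^{n\times n_s}$ with $(U_1,\dots,U_b)=I_n$; $x^{(s)}=U_s^Tx$, $\nabla_sf=U_s^T\nabla f$; $\|\cdot\|$, $\|\cdot\|_s$ are Euclidean norms on $\mathbb R^n$, $\mathbb R^{n_s}$. $X=X_1\times\cdots\times X_b$, each $X_s\subseteq\mathbb R^{n_s}$ closed convex. Problem: $\Phi=f+\chi$ with $f(x)=\mathbb E_\xi[F(x,\xi)]$ (possibly nonconvex), $\xi$ a random variable, $F$ Borel measurable and defined for all $x\in\mathbb R^n$; $\chi(x)=\sum_{s=1}^b\chi_s(x^{(s)})$ with $\chi_s:\mathbb R^{n_s}\to\mathbb R$ closed convex. $\Phi^*=\min_{x\in X}\Phi(x)$. Assumption 1: $\mathbb E[F(x,\xi)]=f(x)$ and $\mathbb E[\nabla F(x,\xi)]=\nabla f(x)$ for all $x$, and $\mathbb E[\|\nabla F(x,\xi)-\nabla f(x)\|^2]\le\sigma^2$ for all $x\in X$. Assumption 2: almost surely in $\xi$, $\|\nabla F(x,\xi)-\nabla F(y,\xi)\|\le L_f\|x-y\|$ for all $x,y$, and for each $s\in\mathcal B$, $\|\nabla_sF(x+U_sh,\xi)-\nabla_sF(x,\xi)\|_s\le L_s\|h\|_s$ for all $x$ and all $h\in\mathbb R^{n_s}$ ($L_f,L_s>0$). Assumption 3: $\|\nabla f(x)\|\le M$ for all $x\in X$. Constants: $\hat L=\max_sL_s$, $\tilde L=\max\{L_f,\hat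 L\}$, $D_\Phi=[(\Phi(x_1)-\Phi^* )/\hat L]^{1/2}$, and $\tilde D>0$ is a fixed parameter. Generalized gradient: $\phi_s:\mathbb R^{n_s}\to\mathbb R$ is differentiable and 1-strongly convex, $D_{\phi_s}(x,y)=\phi_s(x)-\phi_s(y)-\langle\nabla\phi_s(y),x-y\rangle$. For $\alpha>0$, $P_s(x^{(s)},g^{(s)},\alpha)=\arg\min_{y\in X_s}\{\langle g^{(s)},y\rangle+\frac1\alpha D_{\phi_s}(y,x^{(s)})+\chi_s(y)\}$, $\mathcal P_s(x,g,\alpha)=\frac1\alpha[x^{(s)}-P_s(x^{(s)},g^{(s)},\alpha)]$, and $\mathcal P(x,g,\alpha)=(\mathcal P_1(x,g,\alpha),\dots,\mathcal P_b(x,g,\alpha))$. Zeroth-order gradient: $G_\mu(x,\xi,u)=\frac{F(x+\mu u,\xi)-F(x,\xi)}{\mu}u$; each evaluation counts as one call to the stochastic zeroth-order oracle (SZO). ZS-BMD method: given $x_1\in X$, $\mu>0$, iteration count $T$, stepsizes $\alpha_k>0$, batch sizes $T_k\ge1$, probabilities $p_s$ with $\sum_sp_s=1$. Draw i.i.d. block indices $i_k$ with $\mathrm{Prob}\{i_k=s\}=p_s$ and $R\in\{1,\dots,T\}$ with probability mass function $P_R$. At step $k$ draw $u_{k,t}\sim N(0,I_n)$ and oracle samples $\xi_{k,t}$ distributed as $\xi$, $t=1,\dots,T_k$, set $G_{\mu,k}^{(i_k)}=\frac1{T_k}\sum_{t=1}^{T_k}U_{i_k}^TG_\mu(x_k,\xi_{k,t},u_{k,t})$,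 and update $x_{k+1}^{(i_k)}=P_{i_k}(x_k^{(i_k)},G_{\mu,k}^{(i_k)},\alpha_k)$, $x_{k+1}^{(s)}=x_k^{(s)}$ for $s\neq i_k$. Output $x_R$. All random quantities are mutually independent. Two-phase ZS-BMD (2-ZS-BMD): Optimization phase: for $i=1,\dots,S$ independently run ZS-BMD from the same $x_1$ with $p_s=1/b$, $\alpha_k=1/\hat L$, batch sizes $T_k=T'=\lceil\min\{\max\{\frac{\sqrt{(n+4)(2M^2+\sigma^2)\tilde T}}{\tilde L\tilde D},n+4\},\tilde T\}\rceil$, iteration limit $T=\lfloor\tilde T/T'\rfloor$, smoothing parameter $0<\mu\le\frac{D_\Phi}{n+4}\sqrt{1/\tilde T}$, and $P_R(k)=\frac{\alpha_k\min_s\{p_s(1-\frac{L_s}2\alpha_k)\}}{\sum_{k=1}^T\alpha_k\min_s\{p_s(1-\frac{L_s}2\alpha_k)\}}$; let $\bar x_i$ be the output of run $i$. Post-optimization phase: with fresh independent samples $(\xi_k,u_k)$, $k=1,\dots,\mathcal T$, set $G_{\mu,\mathcal T}(x)=\frac1{\mathcal T}\sum_{k=1}^{\mathcal T}G_\mu(x,\xi_k,u_k)$ and output $\bar x_*\in\arg\min_{\bar x_1,\dots,\bar x_S}\|\mathcal P(\bar x_i,G_{\mu,\mathcal T}(\bar x_i),1/\hat L)\|$. *)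

(* Defs.v *)
From HB Require Import structures.
From mathcomp Require Import all_boot all_order all_algebra.
From mathcomp Require Import all_classical all_reals all_analysis.

Set Implicit Arguments.
Unset Strict Implicit.
Unset Printing Implicit Defensive.

Import Order.TTheory GRing.Theory Num.Theory.
Import numFieldNormedType.Exports.

Local Open Scope classical_set_scope.
Local Open Scope ring_scope.

(* The library norm on matrices is the sup norm (it is used here only through
   the topology and differentiability, which do not depend on the norm);
   [enorm] is the Euclidean norm. *)
Definition dot (R : realType) (m : nat) (x y : 'cV[R]_m) : R :=
  (x^T *m y) 0 0.

Definition enorm (R : realType) (m : nat) (x : 'cV[R]_m) : R :=
  Num.sqrt (dot x x).

Definition borel (R : realType) (m : nat) :=
  g_sigma_algebraType (@open 'cV[R]_m).

(* Meaningful where f is differentiable, which is always assumed separately. *)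
Definition grad (R : realType) (m : nat) (f : 'cV[R]_m -> R) (x : 'cV[R]_m)
  : 'cV[R]_m := \col_i 'D_(delta_mx i 0) f x.

Definition strongly_convex1 (R : realType) (m : nat) (f : 'cV[R]_m -> R) :=
  forall (x y : 'cV[R]_m) (t : R), 0 <= t <= 1 ->
    f (t *: x + (1 - t) *: y) <=
      t * f x + (1 - t) * f y - t * (1 - t) / 2 * enorm (x - y) ^+ 2.

Definition closed_convex_function (R : realType) (m : nat)
    (f : 'cV[R]_m -> R) :=
  convex_function setT (f : convex_lmodType 'cV[R]_m -> R^o) /\
  closed [set p : 'cV[R]_m * R | f p.1 <= p.2].

Definition is_argmin (R : realType) (T : Type) (A : set T) (h : T -> R)
    (y : T) := A y /\ forall z, A z -> h y <= h z.

(* Mutual independence of a family of sub-sigma-algebras: the product rule over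
   every finite subfamily, enumerated without repetition by j. *)
Definition mutually_independent (R : realType) (dO : measure_display)
    (Omega : measurableType dO) (P : probability Omega R)
    (I : Type) (G : I -> set (set Omega)) :=
  forall (m : nat) (j : 'I_m -> I) (A : 'I_m -> set Omega),
    injective j -> (forall k, G (j k) (A k)) ->
    P (\bigcap_(k in [set: 'I_m]) A k) = (\prod_(k < m) P (A k))%E.

Definition sigma_of (dO dT : measure_display) (Omega : measurableType dO)
    (T : measurableType dT) (X : Omega -> T) : set (set Omega) :=
  preimage_set_system setT X measurable.

Definition sigma_of_discrete (Omega T : Type) (X : Omega -> T)
  : set (set Omega) := preimage_set_system setT X discrete_measurable.

(* T is countable and carries the discrete sigma-algebra. *)
Definition has_pmf (R : realType) (dO : measure_display)
    (Omega : measurableType dO) (P : probability Omega R)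
    (T : Type) (X : Omega -> T) (p : T -> R) :=
  forall s, measurable (X @^-1` [set s]) /\ P (X @^-1` [set s]) = (p s)%:E.

Definition has_law (R : realType) (dO dT : measure_display)
    (Omega : measurableType dO) (P : probability Omega R)
    (T : measurableType dT) (X : {RV P >-> T}) (mu : probability T R) :=
  forall A, measurable A -> distribution P X A = mu A.

(* Law N(0, I_m): independent coordinates, each N(0, 1). *)
Definition standard_gaussian (R : realType) (dO : measure_display)
    (Omega : measurableType dO) (P : probability Omega R) (m : nat)
    (u : {RV P >-> borel R m}) :=
  let coord (i : 'I_m) (w : Omega) : R := (u w : 'cV[R]_m) i 0 in
  mutually_independent P (fun i => sigma_of (coord i)) /\
  forall i (A : set R), measurable A ->
    P (coord i @^-1` A) = normal_prob 0 1 A.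

Definition has_expectation (R : realType) (dT : measure_display)
    (T : measurableType dT) (P : probability T R) (X : T -> R) (m : R) :=
  P.-integrable setT (EFin \o X) /\ ('E_P[X] = m%:E)%E.

Section Blocks.
Context (R : realType) (b : nat) (d : 'I_b -> nat).

Local Notation n := (\sum_(s < b) d s)%N.

(* The s-th block of columns of the identity: (U_1, ..., U_b) = I_n. *)
Definition Ublock (s : 'I_b) : 'M[R]_(n, d s) := submxrow 1%:M s.

Definition block (s : 'I_b) (x : 'cV[R]_n) : 'cV[R]_(d s) :=
  (Ublock s)^T *m x.

Definition product_set (X : forall s, set 'cV[R]_(d s)) : set 'cV[R]_n :=
  [set x | forall s, X s (block s x)].

Definition block_sum (chi : forall s, 'cV[R]_(d s) -> R) (x : 'cV[R]_n) : R :=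
  \sum_(s < b) chi s (block s x).

Definition bregman (m : nat) (phi : 'cV[R]_m -> R) (x y : 'cV[R]_m) : R :=
  phi x - phi y - dot (grad phi y) (x - y).

(* The minimizer exists and is unique under the standing assumptions on X, chi
   and phi; the default value x of [xget] is then irrelevant. *)
Definition prox (m : nat) (X : set 'cV[R]_m) (chi phi : 'cV[R]_m -> R)
    (x g : 'cV[R]_m) (alpha : R) : 'cV[R]_m :=
  xget x (is_argmin X
    (fun y => dot g y + alpha^-1 * bregman phi y x + chi y)).

Section Method.
Context (X : forall s, set 'cV[R]_(d s)).
Context (chi phi : forall s, 'cV[R]_(d s) -> R).

Definition block_prox (s : 'I_b) (x g : 'cV[R]_n) (alpha : R) :
    'cV[R]_(d s) :=
  prox (@X s) (@chi s) (@phi s) (block s x) (block s g) alpha.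

Definition gradient_mapping (x g : 'cV[R]_n) (alpha : R) : 'cV[R]_n :=
  \mxcol_(s < b) (alpha^-1 *: (block s x - block_prox s x g alpha)).

Context (dXi : measure_display) (Xi : measurableType dXi).
Context (F : 'cV[R]_n -> Xi -> R).

Definition zo_gradient (mu : R) (x : 'cV[R]_n) (z : Xi) (u : 'cV[R]_n) :
    'cV[R]_n := ((F (x + mu *: u) z - F x z) / mu) *: u.

Definition zo_average (mu : R) (N : nat) (x : 'cV[R]_n) (z : nat -> Xi)
    (u : nat -> 'cV[R]_n) : 'cV[R]_n :=
  N%:R^-1 *: \sum_(t < N) zo_gradient mu x (z t) (u t).

Definition bmd_step (s : 'I_b) (x g : 'cV[R]_n) (alpha : R) : 'cV[R]_n :=
  \mxcol_(r < b) (if r == s then block_prox r x g alpha else block r x).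

(* Steps are numbered from 0: [zs_bmd_iterate ... k] is x_{k+1}, and i k, z k t,
   u k t are the block index and the samples of the (k+1)-st step. *)
Fixpoint zs_bmd_iterate (mu : R) (alpha : nat -> R) (batch : nat -> nat)
    (x1 : 'cV[R]_n) (i : nat -> 'I_b) (z : nat -> nat -> Xi)
    (u : nat -> nat -> 'cV[R]_n) (k : nat) : 'cV[R]_n :=
  if k is k'.+1 then
    let x := zs_bmd_iterate mu alpha batch x1 i z u k' in
    bmd_step (i k') x (zo_average mu (batch k') x (z k') (u k')) (alpha k')
  else x1.

(* Pxi is the law of the oracle's random variable. *)
Context (Pxi : probability Xi R) (f : 'cV[R]_n -> R).

Definition assumption1 (sigma : R) :=
  [/\ forall x, has_expectation Pxi (F x) (f x),
      forall x, differentiable f x,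
      forall x i,
        has_expectation Pxi (fun z => grad (F^~ z) x i 0) (grad f x i 0)
    & forall x, product_set X x ->
        ('E_Pxi[fun z => (enorm (grad (F^~ z) x - grad f x) ^+ 2)%R]
           <= (sigma ^+ 2)%:E)%E].

Definition assumption2 (Lf : R) (L : 'I_b -> R) :=
  {ae Pxi, forall z,
    [/\ forall x, differentiable (F^~ z) x,
        forall x y,
          enorm (grad (F^~ z) x - grad (F^~ z) y) <= Lf * enorm (x - y)
      & forall s x (h : 'cV[R]_(d s)),
          enorm (block s (grad (F^~ z) (x + Ublock s *m h))
                 - block s (grad (F^~ z) x)) <= L s * enorm h]}.

Definition assumption3 (M : R) :=
  forall x, product_set X x -> enorm (grad f x) <= M.

End Method.

(* The weights are indexed from 0, like the steps. *)
Definition output_pmf (L : 'I_b -> R) (p : 'I_b -> R) (alpha : nat -> R)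
    (T : nat) (k : nat) : R :=
  let weight j :=
    alpha j * inf (range (fun s => p s * (1 - L s / 2 * alpha j))) in
  if (k < T)%N then weight k / \sum_(j < T) weight j else 0.

End Blocks.

Section TwoPhase.
Context (R : realType) (n : nat).

Definition batch_size (M sigma Lt Dt : R) (Tt : nat) : nat :=
  `|Num.ceil (Num.min
      (Num.max (Num.sqrt (n.+4%:R * (2 * M ^+ 2 + sigma ^+ 2) * Tt%:R)
                  / (Lt * Dt))
               n.+4%:R)
      Tt%:R : R)|%N.

Definition iteration_limit (M sigma Lt Dt : R) (Tt : nat) : nat :=
  (Tt %/ batch_size M sigma Lt Dt Tt)%N.

Definition gamma1 (M sigma Lt Dt : R) (Tt : nat) : R :=
  Num.max (Num.sqrt (n.+4%:R * (2 * M ^+ 2 + sigma ^+ 2))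
             / (Lt * Dt * Num.sqrt Tt%:R)) 1.

Definition gamma2 (Tt : nat) : R := Num.max (n.+4%:R / Tt%:R) 1.

Definition Bbound (M sigma Lt Dt Dphi : R) (Tt : nat) : R :=
  64 * Num.sqrt (n.+4%:R * (2 * M ^+ 2 + sigma ^+ 2)) / Num.sqrt Tt%:R
    * (Dt * gamma1 M sigma Lt Dt Tt + Dphi ^+ 2 / Dt)
  + (64 * gamma2 Tt + 33) * Lt * Dphi ^+ 2 * n.+4%:R / Tt%:R.

End TwoPhase.

(* S runs of T steps with batches of size T', then N fresh samples. *)
Inductive draw (S T T' N : nat) : Type :=
| BlockIndex of 'I_S & 'I_T
| OutputIndex of 'I_S
| Direction of 'I_S & 'I_T & 'I_T'
| Sample of 'I_S & 'I_T & 'I_T'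
| PostDirection of 'I_N
| PostSample of 'I_N.

(* Only the finitely many draws that the method makes (k < T, t < T' in each
   run, k < N afterwards) are constrained, although the sequences are indexed by
   nat. *)
Record two_phase_draws (R : realType) (b n : nat)
    (dXi : measure_display) (Xi : measurableType dXi)
    (Pxi : probability Xi R) (p : 'I_b -> R) (pR : nat -> R)
    (dO : measure_display) (Omega : measurableType dO)
    (P : probability Omega R) (S T T' N : nat)
    (i : 'I_S -> nat -> Omega -> 'I_b)
    (r : 'I_S -> Omega -> nat)
    (u : 'I_S -> nat -> nat -> {RV P >-> borel R n})
    (xi : 'I_S -> nat -> nat -> {RV P >-> Xi})
    (v : nat -> {RV P >-> borel R n})
    (zeta : nat -> {RV P >-> Xi}) : Prop := {
  draw_block : forall j k, (k < T)%N -> has_pmf P (i j k) p;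
  draw_output : forall j, has_pmf P (r j) pR;
  draw_direction : forall j k t, (k < T)%N -> (t < T')%N ->
    standard_gaussian (u j k t);
  draw_sample : forall j k t, (k < T)%N -> (t < T')%N ->
    has_law (xi j k t) Pxi;
  draw_post_direction : forall k, (k < N)%N -> standard_gaussian (v k);
  draw_post_sample : forall k, (k < N)%N -> has_law (zeta k) Pxi;
  draw_independent : mutually_independent P (fun e : draw S T T' N =>
    match e with
    | BlockIndex j k => sigma_of_discrete (i j k)
    | OutputIndex j => sigma_of_discrete (r j)
    | Direction j k t => sigma_of (u j k t)
    | Sample j k t => sigma_of (xi j k t)
    | PostDirection k => sigma_of (v k)
    | PostSample k => sigma_of (zeta k)
    end)
}.

(* Main.v *)
Require Import Defs.
From HB Require Import structures.
From mathcomp Require Import all_boot all_order all_algebra.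
From mathcomp Require Import finmap.
From mathcomp Require Import all_classical all_reals all_analysis.
From mathcomp Require Import measurable_realfun ring lra.

Set Implicit Arguments.
Unset Strict Implicit.
Unset Printing Implicit Defensive.

Import Order.TTheory GRing.Theory Num.Theory.
Import numFieldNormedType.Exports.

Local Open Scope classical_set_scope.
Local Open Scope ring_scope.

(** Write G for a batch average of zeroth-order gradients at x, g^ for the exact
    generalized gradient at x and alpha = 1 / Lhat.  Since the proximal point is
    alpha-Lipschitz in the gradient argument, a step on block s satisfies, on
    every path,
      alpha / 8 * |g^_s|^2 <= Phi(x) - Phi(x+) + 5 / 4 * alpha * |G - grad f|^2,
    without any unbiasedness.  Telescoping and averaging over the block index,
    which is independent of the past, bounds the mean of |g^|^2 at the output of
    a run; the error |G - grad f|^2 is controlled by Gaussian moments of order at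
    most 6.  By Markov's inequality each run exceeds 4 b Lt B with probability at
    most 1/2, so all S independent runs do with probability at most 2^-S.  The
    post-optimization sample is independent of the runs, so conditionally on the
    runs each of its S errors exceeds the threshold with probability at most
    1 / lambda; outside these events the selected point satisfies the bound
    because the generalized gradient is 1-Lipschitz in the gradient argument. *)

(** * Independence and decoupling *)

(** The oracle is called at a random point, whereas its moment bounds hold at a fixed one. Instead
    of conditional expectations, the sample space is doubled: past and fresh draws generate
    independent sigma-algebras, so they may be sampled from a product and the past frozen by
    Tonelli. This is why measurability is tracked with respect to the sigma-algebra generated by a
    chosen set of draws. The error of a batch of size N splits into a fluctuation around its mean,
    of size V0 / N, and a bias B0. In the post-optimization phase only the fluctuation passes
    through Markov's inequality, so only it carries lambda. Origin of the constants: the mean square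
    at the output of a run is at most 2 b Lt B, and Markov at twice this level, c = 4 b Lt B, gives
    1/2. Comparing the selected point with a run below c costs a factor 4, whence 16 b Lt B; the
    rest of the threshold absorbs the errors of the two runs compared. The selected run depends on
    the post-optimization sample, so the errors of all S runs must be controlled at once, which
    costs S / lambda. *)

Section Independence.
Context (R : realType) (dO : measure_display) (Omega : measurableType dO).
Context (P : probability Omega R).
Implicit Types (A B : set (set Omega)).

Definition independent_systems A B :=
  forall a c, A a -> B c -> (P (a `&` c) = P a * P c)%E.

(** Both sides are finite measures in [E]: the restriction of [P] to [D], and [P] scaled by the
    constant [P D]. They agree on the generating pi-system [H], hence on the generated
    sigma-algebra. *)
Lemma g_sigma_algebra_indep (H : set (set Omega)) (D : set Omega) :
  setI_closed H -> H `<=` measurable -> H setT -> measurable D ->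
  (forall E, H E -> P (E `&` D) = (P E * P D)%E) ->
  forall E, <<s H >> E -> P (E `&` D) = (P E * P D)%E.
Proof.
move=> HI Hm HT mD HD E HE.
have PDfin : P D \is a fin_num by exact: fin_num_measure.
have r0 : 0 <= fine (P D) by exact: fine_ge0.
pose m2 := mscale (NngNum r0) P.
have -> : (P E * P D = m2 E)%E.
  by rewrite /m2 /mscale /= fineK// muleC.
have -> : (P (E `&` D) = mrestr P mD E)%E by [].
apply: (g_sigma_algebra_measure_unique H Hm (fun=> setT) _ _ (mrestr P mD) m2) => //.
- by rewrite bigcup_const//; exists 0%N.
- by move=> A HA; rewrite /= /mrestr HD// /m2 /mscale /= fineK// muleC.
- by move=> _; rewrite /= /mrestr setTI ltey_eq PDfin.
Qed.

End Independence.

Section FullIndependence.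
Context (R : realType) (dO : measure_display) (Omega : measurableType dO).
Context (P : probability Omega R).

(** The product rule is asked only over the whole of [K]: once every [H k] contains [setT], smaller
    subfamilies are the case [A k = setT] elsewhere. *)
Definition independent_family (K : finType) (H : K -> set (set Omega)) :=
  forall A : K -> set Omega, (forall k, H k (A k)) ->
    P (\bigcap_k A k) = (\prod_k P (A k))%E.

Lemma mutually_independent_family (I : Type) (K : finType) (G : I -> set (set Omega))
    (g : K -> I) : injective g ->
  mutually_independent P G -> independent_family (fun k => G (g k)).
Proof.
move=> ginj indG A GA.
rewrite (reindex (@enum_val K predT))/=; last exact/onW_bij/enum_val_bij.
rewrite -(indG #|K| (fun i => g (enum_val i)) (fun i => A (enum_val i)))//;
  last by move=> i j /ginj /enum_val_inj.
congr (P _); apply/seteqP; split => [w Aw j _|w Aw k _]; first exact: Aw.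
by have := Aw (enum_rank k) Logic.I; rewrite enum_rankK.
Qed.

(** One index is treated at a time: the list [s] in the induction records the indices whose system
    has already been replaced by its generated sigma-algebra, and each replacement applies
    uniqueness of measures against the intersection [D] of the other events. *)
Lemma independent_family_sigma (K : finType) (H : K -> set (set Omega)) :
  (forall k, setI_closed (H k)) -> (forall k, H k `<=` measurable) ->
  (forall k, H k setT) -> independent_family H ->
  independent_family (fun k => <<s H k >>).
Proof.
move=> HI Hm HT indH.
have sHm k : <<s H k >> `<=` measurable.
  by apply: smallest_sub => //; exact: sigma_algebra_measurable.
suff step (s : seq K) : independent_family
    (fun k => if k \in s then <<s H k >> else H k).
  move=> A sA; apply: (step (enum K)) => k; rewrite mem_enum; exact: sA.
elim: s => [//|k0 s IH] A sA.
pose D := \bigcap_(k in [set k | k != k0]) A k.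
have mA k : measurable (A k).
  by have := sA k; case: ifP => _; [exact: sHm|exact: Hm].
have mD : measurable D.
  by apply: fin_bigcap_measurable; [exact: finite_finset|move=> k _; exact: mA].
have split_D (E : set Omega) :
    \bigcap_k (if k == k0 then E else A k) = E `&` D.
  apply/seteqP; split => [w Hw|w [Ew Dw] k _].
    split; first by have := Hw k0 I; rewrite eqxx.
    by move=> k /= kk0; have := Hw k I; rewrite (negbTE kk0).
  by case: ifP => [//|/negbT kk0]; exact: Dw.
have IHE (E : set Omega) : (if k0 \in s then <<s H k0 >> else H k0) E ->
    P (E `&` D) = (P E * \prod_(k | k != k0) P (A k))%E.
  move=> HE; rewrite -split_D IH.
    rewrite (bigD1 k0)//= eqxx; congr (_ * _)%E.
    by apply: eq_bigr => k /negbTE ->.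
  move=> k; case: (eqVneq k k0) => [->//|kk0].
  by have := sA k; rewrite inE (negbTE kk0).
have PD : P D = (\prod_(k | k != k0) P (A k))%E.
  have := IHE setT; rewrite setTI probability_setT mul1e; apply.
  by case: ifP => // _; exact: sub_gen_smallest.
have -> : \bigcap_k A k = A k0 `&` D.
  rewrite -split_D; apply: eq_bigcapr => k _.
  by case: (eqVneq k k0) => [->|].
rewrite (bigD1 k0)//= -PD.
apply: (@g_sigma_algebra_indep R _ _ P (H k0)) => //.
- move=> E HE; rewrite PD IHE//; case: ifP => // _; exact: sub_gen_smallest.
- by have := sA k0; rewrite mem_head.
Qed.

Definition group_sigma (I : Type) (G : I -> set (set Omega)) (J : set I) :=
  <<s \bigcup_(e in J) G e >>.

Lemma group_sigma_measurable (I : Type) (G : I -> set (set Omega)) (J : set I) :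
  (forall e, G e `<=` measurable) -> group_sigma G J `<=` measurable.
Proof.
move=> Gm; apply: smallest_sub; first exact: sigma_algebra_measurable.
by move=> A [e _ /Gm].
Qed.

(** The intersections of one event of [G e] for each [e] of a class form a pi-system that generates
    the sigma-algebra of the class; on such events the product rule is the one for [G] with its
    factors regrouped. *)
Lemma independent_family_group (I K : finType) (G : I -> set (set Omega))
    (lab : I -> K) :
  (forall e, sigma_algebra setT (G e)) -> (forall e, G e `<=` measurable) ->
  independent_family G ->
  independent_family (fun k => group_sigma G [set e | lab e = k]).
Proof.
move=> Gs Gm indG.
have GI e : setI_closed (G e).
  move=> A B; rewrite -(sigma_algebra_id (Gs e)) => sA sB.
  exact: (@measurableI _ (g_sigma_algebraType (G e))).
have GT e : G e setT.
  rewrite -(sigma_algebra_id (Gs e)).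
  exact: (@measurableT _ (g_sigma_algebraType (G e))).
pose H k := [set \bigcap_(e in [set e | lab e = k]) A e |
  A in [set A : I -> set Omega | forall e, G e (A e)]].
have Hm k : H k `<=` measurable.
  move=> _ [A GA <-]; apply: fin_bigcap_measurable; first exact: finite_finset.
  by move=> i _; exact/Gm/GA.
suff indH : independent_family (fun k => <<s H k >>).
  move=> A sA; apply: indH => k; move: (A k) (sA k).
  apply: sub_sigma_algebra2 => B [e /= ek GB].
  exists (fun e' => if e' == e then B else setT).
    by move=> e' /=; case: eqP => [->|].
  apply/seteqP; split => [w /(_ e ek)|w Bw e' _]; first by rewrite eqxx.
  by case: ifP.
apply: independent_family_sigma => //.
- move=> k _ _ [A GA <-] [B GB <-]; exists (fun e => A e `&` B e).
    by move=> e /=; apply: GI.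
  exact: bigcapI.
- move=> k; exists (fun=> setT) => //; exact: bigcapT.
- move=> A HA.
  have {HA} /choice[B HB] k : exists B : I -> set Omega,
      (forall e, G e (B e)) /\ \bigcap_(e in [set e | lab e = k]) B e = A k.
    by have [B GB <-] := HA k; exists B.
  have prodA k : P (A k) = (\prod_(e | lab e == k) P (B k e))%E.
    have [GB <-] := HB k.
    pose C e := if lab e == k then B k e else setT.
    have -> : \bigcap_(e in [set e | lab e = k]) B k e = \bigcap_e C e.
      apply/seteqP; split => [w Bw e _|w Cw e /= ek].
        by rewrite /C; case: eqP => // ek; exact: Bw.
      by have := Cw e Logic.I; rewrite /C ek eqxx.
    rewrite indG; last by move=> e; rewrite /C; case: ifP.
    rewrite [RHS]big_mkcond/=; apply: eq_bigr => e _; rewrite /C.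
    by case: ifP => // _; rewrite probability_setT.
  have -> : \bigcap_k A k = \bigcap_e B (lab e) e.
    apply/seteqP; split => [w Aw e _|w Bw k _].
      by have := Aw (lab e) Logic.I; have [_ <-] := HB (lab e); apply.
    by have [_ <-] := HB k; move=> e /= <-; exact: Bw.
  rewrite indG; last by move=> e; have [] := HB (lab e).
  rewrite (partition_big lab predT)//=; apply: eq_bigr => k _.
  by rewrite prodA; apply: eq_bigr => e /eqP ->.
Qed.

Lemma independent_groups (I : finType) (G : I -> set (set Omega))
    (J1 J2 : set I) :
  (forall e, sigma_algebra setT (G e)) -> (forall e, G e `<=` measurable) ->
  independent_family G -> J1 `&` J2 = set0 ->
  independent_systems P (group_sigma G J1) (group_sigma G J2).
Proof.
move=> Gs Gm indG J12 a c Ja Jc.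
(* Two classes suffice: disjointness puts all of [J2] into the class labelled [false]. *)
pose lab e : bool := e \in J1.
have := independent_family_group (lab := lab) Gs Gm indG (A := fun k => if k then a else c).
have -> : \bigcap_k (if k then a else c) = a `&` c.
  apply/seteqP; split => [w H|w [aw cw] []//].
  by split; [exact: (H true Logic.I)|exact: (H false Logic.I)].
rewrite big_bool; apply; case.
- move: a Ja; apply: sub_sigma_algebra2; apply: bigcup_subset => e Je.
  exact/mem_set.
- move: c Jc; apply: sub_sigma_algebra2; apply: bigcup_subset => e Je /=.
  apply/negbTE/negP => /set_mem Je1.
  by have : (J1 `&` J2) e by []; rewrite J12.
Qed.

End FullIndependence.

(** * Replacing independent arguments by a product law *)

Section Decoupling.
Context (R : realType) (dO : measure_display) (Omega : measurableType dO).
Context (P : probability Omega R) (S1 S2 : set (set Omega)).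
Hypotheses (mS1 : <<s S1 >> `<=` measurable) (mS2 : <<s S2 >> `<=` measurable).
Hypothesis indS : independent_systems P <<s S1 >> <<s S2 >>.

Local Notation T1 := (g_sigma_algebraType S1).
Local Notation T2 := (g_sigma_algebraType S2).

Let mid1 : @measurable_fun _ _ Omega T1 setT idfun.
Proof. by move=> _ A mA; rewrite setTI; exact: mS1. Qed.

Let mid2 : @measurable_fun _ _ Omega T2 setT idfun.
Proof. by move=> _ A mA; rewrite setTI; exact: mS2. Qed.

Let id1 : {mfun Omega >-> T1} := mfun_Sub (mem_set mid1).
Let id2 : {mfun Omega >-> T2} := mfun_Sub (mem_set mid2).

Let mdiag : @measurable_fun _ _ Omega (T1 * T2)%type setT (fun w => (w, w)).
Proof. by apply/measurable_fun_pair. Qed.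

Let diag : {mfun Omega >-> (T1 * T2)%type} := mfun_Sub (mem_set mdiag).

Let diag_law (A : set (T1 * T2)) : measurable A ->
  distribution P diag A = (distribution P id1 \x distribution P id2)%E A.
Proof.
by move=> mA; symmetry; apply: product_measure_unique => // B C mB mC; exact: indS.
Qed.

(* The law of w |-> (w, w) on S1 (x) S2 is the product of the two restrictions
   of P, so the two occurrences of w may be drawn independently. *)
Lemma decoupling (h : T1 * T2 -> \bar R) :
  measurable_fun [set: T1 * T2] h -> (forall z, (0 <= h z)%E) ->
  (\int[P]_w h (w, w) = \int[P]_w \int[P]_w' h (w, w'))%E.
Proof.
move=> mh h0.
transitivity (\int[distribution P diag]_z h z)%E.
  by rewrite ge0_integral_distribution.
transitivity (\int[distribution P id1 \x distribution P id2]_z h z)%E.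
  by apply: eq_measure_integral => A mA _; exact: diag_law.
rewrite fubini_tonelli1// ge0_integral_distribution//.
- apply: eq_integral => w _; rewrite /= /fubini_F ge0_integral_distribution//.
  exact: measurableT_comp.
- exact: measurable_fun_fubini_tonelli_F.
- by move=> w; exact: integral_ge0.
Qed.

(** Decoupling covers nonnegative functions only. Applied to the absolute value of the product it
    yields integrability, after which Fubini evaluates the signed integral. *)
Lemma has_expectationM (X Y : Omega -> R) (x y : R) :
  @measurable_fun _ _ T1 R setT X -> @measurable_fun _ _ T2 R setT Y ->
  has_expectation P X x -> has_expectation P Y y ->
  has_expectation P (fun w => X w * Y w) (x * y).
Proof.
move=> mX mY [iX EX] [iY EY].
pose h (z : T1 * T2) : \bar R := (X z.1 * Y z.2)%:E.
have mh : measurable_fun [set: T1 * T2] h.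
  apply/measurable_EFinP; apply: measurable_funM.
    exact: (measurableT_comp mX).
  exact: (measurableT_comp mY).
have mXO : measurable_fun [set: Omega] X by exact: (measurableT_comp mX mid1).
have mYO : measurable_fun [set: Omega] Y by exact: (measurableT_comp mY mid2).
have mabsY : measurable_fun [set: Omega] (fun w => `|(Y w)%:E|%E).
  by apply: measurableT_comp => //; exact/measurable_EFinP.
have mabsX : measurable_fun [set: Omega] (fun w => `|(X w)%:E|%E).
  by apply: measurableT_comp => //; exact/measurable_EFinP.
have abs_h : (\int[P]_w \int[P]_w' `|h (w, w')| =
    (\int[P]_w `|(X w)%:E|) * \int[P]_w `|(Y w)%:E|)%E.
  rewrite -ge0_integralZr//; last exact: integral_ge0.
  apply: eq_integral => w _.
  under eq_integral do rewrite /h /= normrM EFinM.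
  by rewrite ge0_integralZl.
have ioo : (\int[P]_w \int[P]_w' `|h (w, w')| < +oo)%E.
  rewrite abs_h; move/integrableP: iX => [_ ?]; move/integrableP: iY => [_ ?].
  have X0 : (0 <= \int[P]_w `|(X w)%:E|)%E by exact: integral_ge0.
  by rewrite lte_mul_pinfty// ge0_fin_numE.
have ih : P.-integrable setT (fun w => h (w, w)).
  apply/integrableP; split; first exact: (measurableT_comp mh mdiag).
  rewrite (decoupling (h := fun z => `|h z|%E))//.
  exact: measurableT_comp.
split; first exact: ih.
have ih12 : (distribution P id1 \x distribution P id2)%E.-integrable setT h.
  apply/integrable12ltyP => //.
  have mabsh : measurable_fun [set: T1 * T2] (fun z => `|h z|%E).
    exact: measurableT_comp.
  rewrite ge0_integral_distribution//.
  - rewrite (_ : (fun _ => _) = (fun w => \int[P]_w' `|h (w, w')|)%E)//.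
    apply/funext => w /=; rewrite ge0_integral_distribution//.
    apply/measurable_EFinP; apply: measurableT_comp => //; exact: measurable_funM.
  - apply: (@measurable_fun_fubini_tonelli_F _ _ _ _ _ _ (fun z => `|h z|%E)) => //.
  - by move=> w; exact: integral_ge0.
rewrite unlock.
transitivity (\int[distribution P diag]_z h z)%E.
  by rewrite integral_distribution.
transitivity (\int[distribution P id1 \x distribution P id2]_z h z)%E.
  by apply: eq_measure_integral => A mA _; exact: diag_law.
rewrite -integral12_prod_meas1//.
rewrite unlock in EX EY.
have iYd : (distribution P id2).-integrable setT (EFin \o Y).
  by apply: (integrable_pushforward mid2) => //; exact/measurable_EFinP.
have iXd : (distribution P id1).-integrable setT (EFin \o X).
  by apply: (integrable_pushforward mid1) => //; exact/measurable_EFinP.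
transitivity (\int[distribution P id1]_w ((X w)%:E * y%:E))%E.
  apply: eq_integral => w _; rewrite /fubini_F.
  under eq_integral do rewrite /h /= EFinM.
  rewrite integralZl//.
  by congr (_ * _)%E; rewrite -EY integral_distribution//; exact/measurable_EFinP.
rewrite integralZr//.
by rewrite EFinM -EX integral_distribution//; exact/measurable_EFinP.
Qed.
End Decoupling.

(** * Borel vectors *)

Section BorelVectors.
Context (R : realType).

(** Balls of the sup norm are boxes, that is, finite intersections of conditions on single
    coordinates, and only countably many rational ones are needed. This reduces measurability of
    vector maps to that of their coordinates. *)
Lemma open_rational_boxes (m : nat) (U : set 'cV[R]_m) : open U ->
  U = \bigcup_(q in [set q : 'cV[rat]_m * nat |
         ball (map_mx ratr q.1 : 'cV[R]_m) (q.2.+1%:R^-1 : R) `<=` U])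
        ball (map_mx ratr q.1 : 'cV[R]_m) (q.2.+1%:R^-1 : R).
Proof.
move=> oU; apply/seteqP; split => [x Ux|x [q /= + ]]; last by move=> /[apply].
have /nbhs_ballP[e /= e0 eU] : nbhs x U by rewrite openE in oU; exact: oU.
(* With half the radius, a box that contains [x] stays inside the [e]-ball around [x] although it is
   centred at a nearby rational point. *)
have [k ke] : exists k : nat, k.+1%:R^-1 < e / 2.
  have e20 : 0 < e / 2 by rewrite divr_gt0.
  have := near_infty_natSinv_lt (PosNum e20).
  by move=> [k _ kP]; exists k; exact: (kP k (leqnn k)).
have [q qP] : exists q : 'cV[rat]_m, forall i, `|x i 0 - ratr (q i 0)| < k.+1%:R^-1.
  have /choice[q qP] (i : 'I_m) : exists q : rat, `|x i 0 - ratr q| < k.+1%:R^-1.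
    have : x i 0 - k.+1%:R^-1 < x i 0 + k.+1%:R^-1.
      by rewrite ltrD2l gtrN// invr_gt0.
    move=> /rat_in_itvoo[q]; rewrite in_itv /= => /andP[q1 q2].
    exists q; move: q1 q2; set c := k.+1%:R^-1; set a := x i 0.
    set y : R := ratr q => q1 q2; rewrite ltr_norml; apply/andP; split; lra.
  by exists (\col_i q i) => i; rewrite mxE.
exists (q, k) => /=; last first.
  split; first by rewrite invr_gt0.
  by move=> i j; rewrite ord1 mxE /ball /= distrC; exact: qP.
move=> y [_ By]; apply: eU; split => // i j; rewrite ord1 /ball /=.
have := By i 0; rewrite mxE /ball /= => Bi; have := qP i => qi.
rewrite (_ : x i 0 - y i 0 = (x i 0 - ratr (q i 0)) + (ratr (q i 0) - y i 0));
  last by ring.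
apply: le_lt_trans (ler_normD _ _) _; apply: lt_le_trans (ltrD qi Bi) _.
by move: ke; set c := k.+1%:R^-1 => ke; lra.
Qed.

Lemma measurable_to_borel (d : measure_display) (T : measurableType d) (m : nat)
    (X : T -> borel R m) :
  (forall i, measurable_fun setT (fun t => (X t : 'cV[R]_m) i 0)) ->
  measurable_fun setT X.
Proof.
move=> mX; apply: (measurability (rT := borel R m) (@open 'cV[R]_m) erefl).
move=> _ [U oU <-]; rewrite setTI (open_rational_boxes oU).
rewrite preimage_bigcup bigcup_mkcond.
apply: countable_bigcupT_measurable => // q; case: ifP => // _.
have -> : X @^-1` ball (map_mx ratr q.1 : 'cV[R]_m) (q.2.+1%:R^-1 : R) =
   \bigcap_i ((fun t => (X t : 'cV[R]_m) i 0) @^-1` ball (ratr (q.1 i 0) : R) (q.2.+1%:R^-1 : R)).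
  apply/seteqP; split => [t [_ Bt] i _|t Bt].
    by have := Bt i 0; rewrite mxE.
  by split => [|i j]; [rewrite invr_gt0|rewrite ord1 mxE; exact: Bt].
apply: fin_bigcap_measurable => [|i _]; first exact: finite_finset.
rewrite -[X in measurable X]setTI; apply: mX => //.
by apply: open_measurable; exact: ball_open.
Qed.

Lemma borel_open_measurable (m : nat) (U : set 'cV[R]_m) :
  open U -> (measurable : set (set (borel R m))) U.
Proof. exact: sub_sigma_algebra. Qed.

Lemma continuous_borel_measurable (m : nat) (f : 'cV[R]_m -> R) :
  continuous f -> @measurable_fun _ _ (borel R m) R setT f.
Proof.
move=> /continuousP cf; apply: (measurability _ (RGenOpens.measurableE R)).
move=> _ [_ [a [b ->] <-]]; rewrite setTI.
by apply: borel_open_measurable; apply: cf; exact: interval_open.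
Qed.

Lemma measurable_borel_coord (m : nat) (i : 'I_m) (j : 'I_1) :
  @measurable_fun _ _ (borel R m) R setT (fun x : 'cV[R]_m => x i j).
Proof. by apply: continuous_borel_measurable; exact: coord_continuous. Qed.

Lemma measurable_borelP (d : measure_display) (T : measurableType d) (m : nat)
    (X : T -> borel R m) :
  measurable_fun setT X <->
  (forall i, measurable_fun setT (fun t => (X t : 'cV[R]_m) i 0)).
Proof.
split => [mX i|]; last exact: measurable_to_borel.
exact: (measurableT_comp (measurable_borel_coord i 0) mX).
Qed.

Section Operations.
Context (d : measure_display) (T : measurableType d) (m : nat).
Implicit Types X Y : T -> borel R m.

Lemma measurable_vecD X Y : measurable_fun setT X -> measurable_fun setT Y ->
  @measurable_fun _ _ T (borel R m) setT
    (fun t => (X t : 'cV[R]_m) + (Y t : 'cV[R]_m)).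
Proof.
move=> /measurable_borelP mX /measurable_borelP mY; apply: measurable_to_borel => i.
under eq_fun do rewrite mxE; exact: measurable_funD.
Qed.

Lemma measurable_vecB X Y : measurable_fun setT X -> measurable_fun setT Y ->
  @measurable_fun _ _ T (borel R m) setT
    (fun t => (X t : 'cV[R]_m) - (Y t : 'cV[R]_m)).
Proof.
move=> /measurable_borelP mX /measurable_borelP mY; apply: measurable_to_borel => i.
under eq_fun do rewrite !mxE; exact: measurable_funB.
Qed.

Lemma measurable_vecZ (a : T -> R) X :
  measurable_fun setT a -> measurable_fun setT X ->
  @measurable_fun _ _ T (borel R m) setT (fun t => a t *: (X t : 'cV[R]_m)).
Proof.
move=> ma /measurable_borelP mX; apply: measurable_to_borel => i.
under eq_fun do rewrite !mxE; exact: measurable_funM.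
Qed.

Lemma measurable_vec_sum (I : Type) (s : seq I) (X : I -> T -> borel R m) :
  (forall i, measurable_fun setT (X i)) ->
  @measurable_fun _ _ T (borel R m) setT
    (fun t => \sum_(i <- s) (X i t : 'cV[R]_m)).
Proof.
move=> mX; apply: measurable_to_borel => i.
under eq_fun do rewrite summxE.
by apply: measurable_sum => j; have /measurable_borelP := mX j.
Qed.

Lemma measurable_vec_mulmx (k : nat) (A : 'M[R]_(k, m)) X :
  measurable_fun setT X ->
  @measurable_fun _ _ T (borel R k) setT (fun t => A *m (X t : 'cV[R]_m)).
Proof.
move=> /measurable_borelP mX; apply: measurable_to_borel => i.
under eq_fun do rewrite mxE.
by apply: measurable_sum => j; exact: measurable_funM.
Qed.

Lemma measurable_dot X Y : measurable_fun setT X -> measurable_fun setT Y ->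
  measurable_fun setT (fun t => dot (X t : 'cV[R]_m) (Y t : 'cV[R]_m)).
Proof.
move=> /measurable_borelP mX /measurable_borelP mY.
under eq_fun do rewrite /dot mxE.
apply: measurable_sum => j; under eq_fun do rewrite mxE.
exact: measurable_funM.
Qed.

Lemma measurable_enorm X : measurable_fun setT X ->
  measurable_fun setT (fun t => enorm (X t : 'cV[R]_m)).
Proof.
move=> mX; rewrite /enorm.
apply: (measurableT_comp (continuous_measurable_fun (@sqrt_continuous R))).
exact: measurable_dot.
Qed.

End Operations.
End BorelVectors.

(** * Gaussian moments *)

Section NormalMoments.
Context (R : realType).
Local Notation mu := (@lebesgue_measure R).
Local Notation pdf := (normal_pdf (0 : R) 1).
Local Notation normal01 := (normal_prob (0 : R) 1).

(** The density agrees almost everywhere with the Radon-Nikodym derivative, since both have the same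
    integral over every measurable set. *)
Lemma integral_normal01 (g : R -> \bar R) :
  measurable_fun setT g -> (forall x, (0 <= g x)%E) ->
  (\int[normal01]_x g x = \int[mu]_x (g x * (pdf x)%:E))%E.
Proof.
move=> mg g0.
pose dom := @normal_prob_dominates R 0 1.
rewrite -(Radon_Nikodym_SigmaFinite.change_of_variables dom)//.
have int_f := Radon_Nikodym_SigmaFinite.f_integrable dom.
have mpdf : measurable_fun setT (fun x => (pdf x)%:E).
  by apply/measurable_EFinP; exact: measurable_normal_pdf.
apply: ae_eq_integral => //.
- apply: emeasurable_funM => //; exact: measurable_int int_f.
- exact: emeasurable_funM.
- apply: ae_eqe_mul2l; apply: integral_ae_eq => // E _ mE.
  by rewrite -Radon_Nikodym_SigmaFinite.f_integral.
Qed.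

Lemma normal_pdf01E x : pdf x = normal_peak 1 * expR (- x ^+ 2 / 2).
Proof. by rewrite normal_pdfE ?oner_neq0// /normal_fun subr0 expr1n. Qed.

Lemma is_derive_normal_pdf01 (x : R) : is_derive x (1 : R) (pdf : R -> R) (- x * pdf x).
Proof.
have -> : pdf = (fun x => normal_peak 1 * expR (- x ^+ 2 / 2)).
  by apply/funext => y; rewrite normal_pdf01E.
apply: is_derive_eq.
by rewrite /GRing.scale /=; field; rewrite ?pnatr_eq0.
Qed.

Lemma cvg_pow_normal_pdf01 k : x ^+ k * pdf x @[x --> +oo] --> (0 : R).
Proof.
(* For x >= 1, exp (x^2 / 2) >= exp (x / 2) >= (x / 2)^(k+1) / (k+1)!, which bounds the function by
   C / x. *)
pose C : R := normal_peak 1 * (k.+1)`!%:R * 2 ^+ k.+1.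
have peak0 : 0 < normal_peak (1 : R) by apply: normal_peak_gt0; exact: oner_neq0.
have C0 : 0 < C by rewrite !mulr_gt0// ?exprn_gt0// ltr0n fact_gt0.
apply: (@squeeze_cvgr _ _ _ _ (fun=> 0) (fun x => C * x^-1)).
- near=> x.
  have x1 : 1 <= x by near: x; exact: nbhs_pinfty_ge.
  have x0 : 0 < x by rewrite (lt_le_trans ltr01).
  rewrite mulr_ge0 ?normal_pdf_ge0 ?exprn_ge0 ?(ltW x0)//=.
  rewrite normal_pdf01E mulNr expRN.
  have E1 : (x / 2) ^+ k.+1 / (k.+1)`!%:R <= expR (x ^+ 2 / 2).
    apply: (@le_trans _ _ (expR (x / 2))).
      have x20 : 0 <= x / 2 by rewrite divr_ge0 ?(ltW x0).
      by have := expR_ge1Dxn k x20; lra.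
    by rewrite ler_expR ler_pM2r// expr2 ler_peMl// ltW.
  have F0 : 0 < (k.+1)`!%:R :> R by rewrite ltr0n fact_gt0.
  have D0 : 0 < (x / 2) ^+ k.+1 / (k.+1)`!%:R.
    by rewrite divr_gt0// exprn_gt0// divr_gt0.
  apply: (@le_trans _ _ (x ^+ k * (normal_peak 1 * ((x / 2) ^+ k.+1 / (k.+1)`!%:R)^-1))).
    rewrite ler_wpM2l ?exprn_ge0 ?(ltW x0)// ler_wpM2l ?(ltW peak0)//.
    by rewrite lef_pV2 ?posrE ?expR_gt0.
  rewrite le_eqVlt; apply/orP; left; apply/eqP.
  rewrite /C expr_div_n exprS; field.
  by rewrite !gt_eqF// ?exprn_gt0// ?ltr0n.
- exact: cvg_cst.
- rewrite -[X in _ --> X](mulr0 C); apply: cvgMl_tmp => //.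
  apply/gtr0_cvgV0; last exact: cvg_id.
  by near=> x; near: x; exact: nbhs_pinfty_gt.
Unshelve. all: by end_near. Qed.

Lemma continuous_normal_pdf01 : continuous (pdf : R -> R).
Proof. by apply: continuous_normal_pdf; exact: oner_neq0. Qed.

Lemma continuous_pow_normal_pdf01 k : continuous (fun x : R => x ^+ k * pdf x).
Proof.
move=> x; apply: cvgM; first exact: exprn_continuous.
exact: continuous_normal_pdf01.
Qed.

(** Says that [l] is the integral of x^k times the density over the positive half-line, in the form
    of an antiderivative with its limits at 0 and at infinity: integration by parts can then act on
    the antiderivative itself. *)
Definition half_antiderivative (k : nat) (l : R) :=
  exists F : R -> R, [/\ F x @[x --> 0^'+] --> F 0,
    F x @[x --> +oo] --> F 0 + l
  & forall x : R, 0 < x -> is_derive x (1 : R) F (x ^+ k * pdf x)].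

Lemma half_moment k l : half_antiderivative k l ->
  (\int[mu]_(x in `[0%R, +oo[) (x ^+ k * pdf x)%:E = l%:E)%E.
Proof.
move=> [F [F0 Fy dF]].
rewrite (ge0_continuous_FTC2y (F := F) (l := F 0 + l))//.
- by rewrite -EFinB addrAC subrr add0r.
- by move=> x x0; rewrite mulr_ge0 ?exprn_ge0 ?normal_pdf_ge0.
- apply: continuous_subspaceT; exact: continuous_pow_normal_pdf01.
- by move=> x x0; have [] := dF x x0.
- move=> x; rewrite in_itv/= andbT => x0; rewrite derive1E.
  by have /@derive_val := dF x x0.
Qed.

(* By parts, with boundary term - x^(k+1) * pdf x. *)
Lemma half_antiderivative_step k l : half_antiderivative k l ->
  half_antiderivative k.+2 (k.+1%:R * l).
Proof.
move=> [F [F0 Fy dF]].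
exists (fun x => - (x ^+ k.+1 * pdf x) + k.+1%:R * F x); split.
- rewrite expr0n/= mul0r oppr0 add0r.
  rewrite -[X in _ --> X]add0r; apply: cvgD; last first.
    by apply: cvgMl_tmp.
  rewrite -[X in _ --> X]oppr0; apply: cvgN.
  have := @continuous_pow_normal_pdf01 k.+1 0.
  rewrite /continuous_at expr0n/= mul0r => /cvg_at_right_filter; exact.
- rewrite expr0n/= mul0r oppr0 add0r -mulrDr -[X in _ --> X]add0r.
  apply: cvgD; last by apply: cvgMl_tmp.
  rewrite -[X in _ --> X]oppr0; apply: cvgN; exact: cvg_pow_normal_pdf01.
- move=> x x0; have dFx := dF x x0; have dpdf := is_derive_normal_pdf01 x.
  have dX : is_derive x (1 : R) (fun y : R => y ^+ k.+1) (k.+1%:R * x ^+ k).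
    have := is_deriveX k.+1 (is_derive_id x (1 : R)).
    by rewrite fctE /GRing.scale /= mulr1.
  have dH := is_deriveD (is_deriveN (is_deriveM dX dpdf))
    (is_deriveZ (k.+1%:R : R) dFx).
  apply: (is_derive_eq dH).
  rewrite /GRing.scale /= !exprS; ring.
Qed.

(** The Gaussian has no elementary antiderivative, so [F] is the integral from 0. Being monotone and
    at most 1 it has a limit at infinity, whose value 1/2 follows from symmetry and total mass 1. *)
Lemma half_antiderivative0 : half_antiderivative 0 (1 / 2).
Proof.
pose F x := (\int[mu]_(t in `[0%R, x]) pdf t)%R.
have ipdf A : measurable A -> mu.-integrable A (fun x => (pdf x)%:E).
  by move=> mA; apply: integrableS (integrable_normal_pdf 0 1).
have F00 : F 0 = 0 by rewrite /F set_itv1 Rintegral_set1.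
have ndF : nondecreasing_fun F.
  move=> x y xy; rewrite /F /Rintegral fine_le//.
  - exact: integrable_fin_num (ipdf _ _).
  - exact: integrable_fin_num (ipdf _ _).
  - apply: ge0_subset_integral => //.
    + by apply/measurable_EFinP; apply: measurable_funTS; exact: measurable_normal_pdf.
    + by move=> t _; rewrite lee_fin normal_pdf_ge0.
    + by move=> t /=; rewrite !in_itv/= => /andP[-> /le_trans]; exact.
have F1 x : F x <= 1.
  rewrite -[1]/(fine 1%E) /F /Rintegral fine_le//.
    exact: integrable_fin_num (ipdf _ _).
  rewrite -(@integral_normal_pdf R 0 1); apply: ge0_subset_integral => //.
  + by apply/measurable_EFinP; exact: measurable_normal_pdf.
  + by move=> t _; rewrite lee_fin normal_pdf_ge0.
have Fy : F x @[x --> +oo] --> sup (range F).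
  by apply: nondecreasing_cvgr => //; exists 1 => _ [x _ <-].
have hF : half_antiderivative 0 (sup (range F)).
  exists F; split; rewrite ?F00 ?add0r//.
  - have := @parameterized_integral_cvg_left R 0 1 pdf ltr01 (ipdf _ (measurable_itv _)).
    by move=> /cvg_at_right_filter; exact.
  - move=> x x0; rewrite expr0 mul1r.
    have xx1 : x < x + 1 by rewrite ltrDl.
    have [dFx F'x] := @continuous_FTC1_closed R pdf 0 x (x + 1) xx1
      (ipdf _ (measurable_itv _)) x0 (@continuous_normal_pdf01 x).
    by apply: DeriveDef => //; rewrite -derive1E.
suff <- : sup (range F) = 1 / 2 by [].
have := half_moment hF.
under eq_integral do rewrite expr0 mul1r.
move=> hl; have := @integral_normal_pdf R 0 1.
rewrite ge0_symfun_integralT; last 3 first.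
- exact: normal_pdf_ge0.
- exact: continuous_normal_pdf01.
- by move=> x /=; rewrite !normal_pdf01E sqrrN.
rewrite -set_itvcy hl -EFinM => -[] h; lra.
Qed.

Lemma normal01_even_moment k l : half_antiderivative k.*2 l ->
  (\int[normal01]_x (x ^+ k.*2)%:E = (2 * l)%:E)%E.
Proof.
move=> hl; rewrite integral_normal01; last 2 first.
- by apply/measurable_EFinP; exact: measurable_funX.
- by move=> x; rewrite lee_fin exprn_even_ge0// odd_double.
under eq_integral do rewrite -EFinM.
rewrite ge0_symfun_integralT.
- by rewrite -set_itvcy (half_moment hl).
- by move=> x; rewrite mulr_ge0 ?normal_pdf_ge0// exprn_even_ge0// odd_double.
- exact: continuous_pow_normal_pdf01.
- by move=> x /=; rewrite !normal_pdf01E sqrrN exprNn -signr_odd odd_double expr0 mul1r.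
Qed.

Lemma normal01_moment2 : (\int[normal01]_x (x ^+ 2)%:E = 1%:E)%E.
Proof.
have /(normal01_even_moment (k := 1)) -> :=
  half_antiderivative_step half_antiderivative0.
by congr EFin; field.
Qed.

Lemma normal01_moment4 : (\int[normal01]_x (x ^+ 4)%:E = 3%:E)%E.
Proof.
have /(normal01_even_moment (k := 2)) -> :=
  half_antiderivative_step (half_antiderivative_step half_antiderivative0).
by congr EFin; field.
Qed.

Lemma normal01_moment6 : (\int[normal01]_x (x ^+ 6)%:E = 15%:E)%E.
Proof.
have /(normal01_even_moment (k := 3)) -> := half_antiderivative_step
  (half_antiderivative_step (half_antiderivative_step half_antiderivative0)).
by congr EFin; field.
Qed.

Lemma normal01_reflect (g : R -> \bar R) :
  measurable_fun setT g -> (forall x, (0 <= g x)%E) ->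
  (\int[normal01]_x g (- x)%R = \int[normal01]_x g x)%E.
Proof.
move=> mg g0.
have mgN : measurable_fun [set: R] (fun x => g (- x)%R).
  by apply: measurableT_comp => //; exact: oppr_measurable.
rewrite !integral_normal01//.
have mN : measurable_fun [set: measurableTypeR R] (-%R : R -> measurableTypeR R).
  exact: oppr_measurable.
pose h x := (g x * (pdf x)%:E)%E.
have mh : measurable_fun [set: R] h.
  by apply: emeasurable_funM => //; apply/measurable_EFinP; exact: measurable_normal_pdf.
transitivity (\int[mu]_x (h \o -%R) x)%E.
  by apply: eq_integral => x _; rewrite /h /= !normal_pdf01E sqrrN.
rewrite -[LHS](@ge0_integral_pushforward _ _ (measurableTypeR R) (measurableTypeR R) R _ mN mu setT h)//.
- by apply: eq_measure_integral => A mA _; exact: lebesgue_measureN.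
- by move=> x _; rewrite /h mule_ge0// lee_fin normal_pdf_ge0.
Qed.

End NormalMoments.

(** * Integrable variables with a prescribed mean *)

Section HasExpectation.
Context (R : realType) (dO : measure_display) (Omega : measurableType dO).
Context (P : probability Omega R).
Implicit Types (X Y : Omega -> R) (x y : R).

Lemma expectationE X : ('E_P[X] = \int[P]_w (X w)%:E)%E.
Proof. by rewrite unlock. Qed.

Lemma has_expectation_ext X Y x y : (forall w, X w = Y w) -> x = y ->
  has_expectation P X x -> has_expectation P Y y.
Proof. by move=> /funext -> ->. Qed.

Lemma has_expectation_cst x : has_expectation P (fun=> x) x.
Proof.
split; last by rewrite expectationE integral_cst//= probability_setT mule1.
by apply/finite_measure_integrable_cst.
Qed.

Lemma has_expectationD X Y x y : has_expectation P X x ->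
  has_expectation P Y y -> has_expectation P (fun w => X w + Y w) (x + y).
Proof.
rewrite /has_expectation !expectationE => -[iX EX] [iY EY]; split.
  exact: (integrableD measurableT iX iY).
by rewrite EFinD -EX -EY -(integralD measurableT iX iY).
Qed.

Lemma has_expectationZ c X x :
  has_expectation P X x -> has_expectation P (fun w => c * X w) (c * x).
Proof.
rewrite /has_expectation !expectationE => -[iX EX]; split.
  exact: (integrableZl measurableT c iX).
by rewrite EFinM -EX -(integralZl measurableT iX).
Qed.

Lemma has_expectationB X Y x y : has_expectation P X x ->
  has_expectation P Y y -> has_expectation P (fun w => X w - Y w) (x - y).
Proof.
move=> hX /(has_expectationZ (-1)) hY; have := has_expectationD hX hY.
by apply: has_expectation_ext => [w|]; rewrite mulN1r.
Qed.

Lemma has_expectation_sum (I : Type) (s : seq I) (X : I -> Omega -> R)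
    (x : I -> R) : (forall i, has_expectation P (X i) (x i)) ->
  has_expectation P (fun w => \sum_(i <- s) X i w) (\sum_(i <- s) x i).
Proof.
move=> hX; elim: s => [|i s IH].
  have := has_expectation_cst 0.
  by apply: has_expectation_ext => [w|]; rewrite big_nil.
have := has_expectationD (hX i) IH.
by apply: has_expectation_ext => [w|]; rewrite big_cons.
Qed.

Lemma has_expectation_le X Y x y : has_expectation P X x ->
  has_expectation P Y y -> (forall w, X w <= Y w) -> x <= y.
Proof.
rewrite /has_expectation !expectationE => -[iX EX] [iY EY] XY.
by rewrite -lee_fin -EX -EY; apply: le_integral => // w _; rewrite lee_fin.
Qed.

Lemma has_expectation_dominated X Y y : measurable_fun setT X ->
  has_expectation P Y y -> (forall w, `|X w| <= Y w) ->
  exists x, has_expectation P X x.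
Proof.
rewrite /has_expectation !expectationE => mX [iY EY] XY.
have iX : P.-integrable setT (EFin \o X).
  apply: le_integrable iY => //; first exact/measurable_EFinP.
  by move=> w _ /=; rewrite lee_fin (le_trans (XY w))// ler_norm.
exists (fine (\int[P]_w (X w)%:E)%E); split => //.
by rewrite fineK//; exact: integrable_fin_num.
Qed.

Lemma has_expectation_measurable X x :
  has_expectation P X x -> measurable_fun setT X.
Proof. by move=> [/measurable_int/measurable_EFinP]. Qed.

Lemma has_expectation_ge0 X x : measurable_fun setT X ->
  (forall w, 0 <= X w) -> (\int[P]_w (X w)%:E = x%:E)%E ->
  has_expectation P X x.
Proof.
move=> mX X0 EX; split; last by rewrite expectationE.
apply/integrableP; split; first exact/measurable_EFinP.
under eq_integral => w _ do rewrite /= ger0_norm//.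
by rewrite EX ltry.
Qed.

Lemma has_expectation_ge0_le X x : measurable_fun setT X ->
  (forall w, 0 <= X w) -> (\int[P]_w (X w)%:E <= x%:E)%E ->
  exists2 x', has_expectation P X x' & x' <= x.
Proof.
move=> mX X0 EX; exists (fine (\int[P]_w (X w)%:E)%E).
  apply: has_expectation_ge0 => //; rewrite fineK//.
  rewrite ge0_fin_numE; first exact: le_lt_trans EX (ltry _).
  by apply: integral_ge0 => w _; rewrite lee_fin.
rewrite -lee_fin fineK// ge0_fin_numE; first exact: le_lt_trans EX (ltry _).
by apply: integral_ge0 => w _; rewrite lee_fin.
Qed.

Lemma has_expectation_integral X x :
  has_expectation P X x -> (\int[P]_w (X w)%:E = x%:E)%E.
Proof. by rewrite /has_expectation !expectationE => -[]. Qed.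

End HasExpectation.

Section SubSigma.
Context (R : realType) (dO : measure_display) (Omega : measurableType dO).

Lemma sigma_of_measurable (d : measure_display) (T : measurableType d)
    (X : Omega -> T) (S : set (set Omega)) :
  sigma_of X `<=` <<s S >> ->
  @measurable_fun _ _ (g_sigma_algebraType S) T setT X.
Proof.
by move=> XS _ B mB; rewrite setTI; apply: XS; exists B => //; rewrite setTI.
Qed.

Lemma sigma_of_sigma_algebra (d : measure_display) (T : measurableType d)
  (X : Omega -> T) : sigma_algebra setT (sigma_of X).
Proof. by apply: sigma_algebra_preimage; exact: sigma_algebra_measurable. Qed.

Lemma sigma_of_sub (d : measure_display) (T : measurableType d)
  (X : Omega -> T) : measurable_fun setT X -> sigma_of X `<=` measurable.
Proof. by move=> mX _ [B mB <-]; exact: mX. Qed.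

End SubSigma.

Section GaussianVector.
Context (R : realType) (dO : measure_display) (Omega : measurableType dO).
Context (P : probability Omega R) (m : nat) (u : {RV P >-> borel R m}).
Hypothesis gu : standard_gaussian u.
Local Notation U i w := ((u w : 'cV[R]_m) i 0).

Lemma measurable_gaussian_coord (i : 'I_m) :
  measurable_fun setT (fun w => U i w).
Proof. by have /measurable_borelP := @measurable_funPT _ _ _ _ u. Qed.

Lemma integral_gaussian_coord (i : 'I_m) (g : R -> \bar R) :
  measurable_fun setT g -> (forall x, (0 <= g x)%E) ->
  (\int[P]_w g (U i w) = \int[normal_prob (0 : R) 1]_x g x)%E.
Proof.
move=> mg g0.
have mX : @measurable_fun _ _ Omega (measurableTypeR R) setT (fun w => U i w).
  exact: measurable_gaussian_coord.
pose X := @mfun_Sub _ _ Omega (measurableTypeR R) (fun w => U i w) (mem_set mX).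
transitivity (\int[distribution P X]_x g x)%E.
  by rewrite ge0_integral_distribution.
exact: (@eq_measure_integral _ _ R setT (normal_prob 0 1) (distribution P X) g
  (fun A mA _ => gu.2 i A mA)).
Qed.

Lemma gaussian_coord_even_moment (i : 'I_m) k c :
  (\int[normal_prob (0 : R) 1]_x (x ^+ k.*2)%:E = c%:E)%E ->
  has_expectation P (fun w => U i w ^+ k.*2) c.
Proof.
move=> hc; apply: has_expectation_ge0.
- by apply: measurable_funX; exact: measurable_gaussian_coord.
- by move=> w; rewrite exprn_even_ge0// odd_double.
rewrite -hc (integral_gaussian_coord i (g := fun x => (x ^+ k.*2)%:E))//.
- by apply/measurable_EFinP; exact: measurable_funX.
- by move=> x; rewrite lee_fin exprn_even_ge0// odd_double.
Qed.

Lemma gaussian_coord_moment2 (i : 'I_m) :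
  has_expectation P (fun w => U i w ^+ 2) 1.
Proof. exact: (gaussian_coord_even_moment i (k := 1) (normal01_moment2 R)). Qed.

Lemma gaussian_coord_moment4 (i : 'I_m) :
  has_expectation P (fun w => U i w ^+ 4) 3.
Proof. exact: (gaussian_coord_even_moment i (k := 2) (normal01_moment4 R)). Qed.

Lemma gaussian_coord_moment6 (i : 'I_m) :
  has_expectation P (fun w => U i w ^+ 6) 15.
Proof. exact: (gaussian_coord_even_moment i (k := 3) (normal01_moment6 R)). Qed.

(** The value is irrelevant: this moment is later multiplied by a zero mean or absorbed into a mixed
    moment of unspecified value. *)
Lemma gaussian_coord_moment3 (i : 'I_m) :
  exists c, has_expectation P (fun w => U i w ^+ 3) c.
Proof.
have h := has_expectationD (has_expectation_cst P 1) (gaussian_coord_moment4 i).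
apply: has_expectation_dominated h _.
  by apply: measurable_funX; exact: measurable_gaussian_coord.
move=> w; set x := U i w.
have h1 : 0 <= (x * (x + 1)) ^+ 2 by exact: sqr_ge0.
have h2 : 0 <= (x * (x - 1)) ^+ 2 by exact: sqr_ge0.
have h3 : 0 <= (x ^+ 2 - 1) ^+ 2 by exact: sqr_ge0.
have h4 : 0 <= (x ^+ 2) ^+ 2 by exact: sqr_ge0.
by rewrite ler_norml; apply/andP; split; nra.
Qed.

(** By the reflection x -> -x the positive and negative parts have the same integral, finite by
    comparison with 1 + x^2, so they cancel. *)
Lemma gaussian_coord_moment1 (i : 'I_m) :
  has_expectation P (fun w => U i w) 0.
Proof.
have h := has_expectationD (has_expectation_cst P 1) (gaussian_coord_moment2 i).
have [c hc] : exists c, has_expectation P (fun w => U i w) c.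
  apply: has_expectation_dominated h _; first exact: measurable_gaussian_coord.
  by move=> w; set x := U i w; rewrite ler_norml; apply/andP; split; nra.
suff E0 : 'E_P[fun w => U i w]%E = 0%:E by split; [case: hc|].
rewrite expectationE integralE.
have pos : (\int[P]_w (fun w => (U i w)%:E)^\+%E w =
    \int[normal_prob (0 : R) 1]_x (Num.max x 0)%:E)%E.
  rewrite -(integral_gaussian_coord i (g := fun x => (Num.max x 0)%:E)).
  - by apply: eq_integral => w _; rewrite funeposE EFin_max.
  - by apply/measurable_EFinP; exact: measurable_maxr.
  - by move=> x; rewrite lee_fin le_max lexx orbT.
have neg : (\int[P]_w (fun w => (U i w)%:E)^\-%E w =
    \int[normal_prob (0 : R) 1]_x (Num.max x 0)%:E)%E.
  rewrite -(normal01_reflect (g := fun x => (Num.max x 0)%:E)); last 2 first.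
  - by apply/measurable_EFinP; exact: measurable_maxr.
  - by move=> x; rewrite lee_fin le_max lexx orbT.
  rewrite -(integral_gaussian_coord i (g := fun x => (Num.max (- x) 0)%:E)).
  - by apply: eq_integral => w _; rewrite funenegE EFin_max.
  - by apply/measurable_EFinP; apply: measurable_maxr => //; exact: measurableT_comp.
  - by move=> x; rewrite lee_fin le_max lexx orbT.
rewrite pos neg -neg subee//; case: hc => ic _.
exact: (integrable_neg_fin_num measurableT ic).
Qed.

End GaussianVector.

(** * Joint moments of a linear form and the squared norm *)

Section GaussianQuadratic.
Context (R : realType) (dO : measure_display) (Omega : measurableType dO).
Context (P : probability Omega R) (m : nat) (u : {RV P >-> borel R m}).
Hypothesis gu : standard_gaussian u.
Variable a : 'I_m -> R.
Local Notation U i w := ((u w : 'cV[R]_m) i 0).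

Let G (i : 'I_m) := sigma_of (fun w => U i w).
Let past k : set (set Omega) := \bigcup_(i in [set i : 'I_m | (i < k)%N]) G i.
(** The test [i < k] inside the sum keeps the index type fixed while [k] grows, so the partial sums
    can be compared without casts. *)
Let sq k w := \sum_(i < m) (if (i < k)%N then U i w ^+ 2 else 0).
Let lin k w := \sum_(i < m) (if (i < k)%N then a i * U i w else 0).
Let asq k := \sum_(i < m) (if (i < k)%N then a i ^+ 2 else 0).

Let measurable_past_coord k (i : 'I_m) : (i < k)%N ->
  @measurable_fun _ _ (g_sigma_algebraType (past k)) R setT (fun w => U i w).
Proof.
move=> ik; apply: sigma_of_measurable => A GA.
by apply: sub_sigma_algebra; exists i.
Qed.

Let measurable_sq k :
  @measurable_fun _ _ (g_sigma_algebraType (past k)) R setT (sq k).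
Proof.
apply: measurable_sum => i; case ik: (i < k)%N; last exact: measurable_cst.
by apply: measurable_funX; exact: measurable_past_coord.
Qed.

Let measurable_lin k :
  @measurable_fun _ _ (g_sigma_algebraType (past k)) R setT (lin k).
Proof.
apply: measurable_sum => i; case ik: (i < k)%N; last exact: measurable_cst.
exact: (measurable_funM (@measurable_cst _ _ _ _ setT (a i)) (measurable_past_coord ik)).
Qed.

Let has_expectation_past_next (k : 'I_m) (X Y : Omega -> R) (x y : R) :
  @measurable_fun _ _ (g_sigma_algebraType (past k)) R setT X ->
  @measurable_fun _ _ (g_sigma_algebraType (G k)) R setT Y ->
  has_expectation P X x -> has_expectation P Y y ->
  has_expectation P (fun w => X w * Y w) (x * y).
Proof.
have Gs i : sigma_algebra setT (G i) by exact: sigma_of_sigma_algebra.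
have Gm i : G i `<=` measurable.
  by apply: sigma_of_sub; exact: measurable_gaussian_coord.
apply: has_expectationM.
- exact: (group_sigma_measurable (J := [set i : 'I_m | (i < k)%N]) Gm).
- by rewrite (sigma_algebra_id (Gs k)).
have := independent_groups (J1 := [set i : 'I_m | (i < k)%N]) (J2 := [set k])
  Gs Gm (mutually_independent_family (g := id) _ gu.1).
rewrite /group_sigma bigcup_set1; apply => //.
by apply/seteqP; split => // i /= [ik iek]; move: ik; rewrite iek ltnn.
Qed.

Let sum_step (V : nmodType) (F : 'I_m -> V) (k : 'I_m) :
  \sum_(i < m) (if (i < k.+1)%N then F i else 0) =
  \sum_(i < m) (if (i < k)%N then F i else 0) + F k.
Proof.
rewrite (bigD1 k)//= [in RHS](bigD1 k)//= ltnSn ltnn add0r addrC; congr (_ + _).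
apply: eq_bigr => i ik; rewrite ltnS leq_eqVlt.
by rewrite -val_eqE in ik; rewrite (negbTE ik).
Qed.

(* The induction adds one coordinate at a time, independent of the partial sums;
   the mixed moment of lin and sq only needs to exist, since it is multiplied by
   odd moments. *)
Lemma gaussian_partial_moments k : (k <= m)%N ->
  [/\ has_expectation P (sq k) k%:R,
      has_expectation P (fun w => sq k w ^+ 2) (k%:R ^+ 2 + 2 * k%:R),
      has_expectation P (fun w => sq k w ^+ 3)
        (k%:R ^+ 3 + 6 * k%:R ^+ 2 + 8 * k%:R) &
      [/\ has_expectation P (lin k) 0,
        has_expectation P (fun w => lin k w ^+ 2) (asq k),
        exists c, has_expectation P (fun w => lin k w * sq k w) c &
        has_expectation P (fun w => lin k w ^+ 2 * sq k w)
          ((k%:R + 2) * asq k)]].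
Proof.
elim: k => [_|k IH km].
  have sq0 w : sq 0 w = 0 by rewrite /sq big1.
  have lin0 w : lin 0 w = 0 by rewrite /lin big1.
  have asq0 : asq 0 = 0 by rewrite /asq big1.
  have h0 := has_expectation_cst P 0.
  by split; [| | |split; [| |exists 0|]]; apply: has_expectation_ext h0 => [w|];
    rewrite ?sq0 ?lin0 ?asq0; ring.
have [E1 E2 E3 [L1 L2 [c LS] LLS]] := IH (ltnW km).
pose ko := Ordinal km.
have sqS w : sq k.+1 w = sq k w + U ko w ^+ 2.
  exact: (sum_step (fun i => U i w ^+ 2) ko).
have linS w : lin k.+1 w = lin k w + a ko * U ko w.
  exact: (sum_step (fun i => a i * U i w) ko).
have asqS : asq k.+1 = asq k + a ko ^+ 2.
  exact: (sum_step (fun i => a i ^+ 2) ko).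
have mU : @measurable_fun _ _ (g_sigma_algebraType (G ko)) R setT (fun w => U ko w).
  by apply: sigma_of_measurable => A; exact: sub_sigma_algebra.
have U1 := gaussian_coord_moment1 gu ko.
have U2 := gaussian_coord_moment2 gu ko.
have [t U3] := gaussian_coord_moment3 gu ko.
have U4 := gaussian_coord_moment4 gu ko.
have U6 := gaussian_coord_moment6 gu ko.
have mpow j : @measurable_fun _ _ (g_sigma_algebraType (G ko)) R setT
    (fun w => U ko w ^+ j) by exact: measurable_funX.
have msq := @measurable_sq k.
have mlin := @measurable_lin k.
have msq2 : @measurable_fun _ _ (g_sigma_algebraType (past k)) R setT
    (fun w => sq k w ^+ 2) by exact: measurable_funX.
have mlin2 : @measurable_fun _ _ (g_sigma_algebraType (past k)) R setT
    (fun w => lin k w ^+ 2) by exact: measurable_funX.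
have ind X Y x y := @has_expectation_past_next ko X Y x y.
have kS : k.+1%:R = k%:R + 1 :> R by rewrite -addn1 natrD.
split; [| | |split; [| |eexists|]].
- have := has_expectationD E1 U2.
  by apply: has_expectation_ext => [w|]; rewrite ?sqS ?kS.
- have := has_expectationD (has_expectationD E2
    (has_expectationZ 2 (ind _ _ _ _ msq (mpow 2) E1 U2))) U4.
  by apply: has_expectation_ext => [w|]; rewrite ?sqS ?kS; ring.
- have := has_expectationD (has_expectationD (has_expectationD E3
    (has_expectationZ 3 (ind _ _ _ _ msq2 (mpow 2) E2 U2)))
    (has_expectationZ 3 (ind _ _ _ _ msq (mpow 4) E1 U4))) U6.
  by apply: has_expectation_ext => [w|]; rewrite ?sqS ?kS; ring.
- have := has_expectationD L1 (has_expectationZ (a ko) U1).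
  by apply: has_expectation_ext => [w|]; rewrite ?linS; ring.
- have := has_expectationD (has_expectationD L2
    (has_expectationZ (2 * a ko) (ind _ _ _ _ mlin (mpow 1) L1 U1)))
    (has_expectationZ (a ko ^+ 2) U2).
  by apply: has_expectation_ext => [w|]; rewrite ?linS ?asqS; ring.
- have := has_expectationD (has_expectationD (has_expectationD LS
    (has_expectationZ (a ko) (ind _ _ _ _ msq (mpow 1) E1 U1)))
    (ind _ _ _ _ mlin (mpow 2) L1 U2))
    (has_expectationZ (a ko) U3).
  by apply: has_expectation_ext => [w|//]; rewrite ?linS ?sqS; ring.
- have := has_expectationD (has_expectationD (has_expectationD (has_expectationD
    (has_expectationD LLS (ind _ _ _ _ mlin2 (mpow 2) L2 U2))
    (has_expectationZ (2 * a ko)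
      (ind _ _ _ _ (measurable_funM mlin msq) (mpow 1) LS U1)))
    (has_expectationZ (2 * a ko) (ind _ _ _ _ mlin (mpow 3) L1 U3)))
    (has_expectationZ (a ko ^+ 2) (ind _ _ _ _ msq (mpow 2) E1 U2)))
    (has_expectationZ (a ko ^+ 2) U4).
  by apply: has_expectation_ext => [w|]; rewrite /= ?linS ?sqS ?asqS ?kS; ring.
Qed.

End GaussianQuadratic.

(** * Euclidean inner product and norm *)

Section EuclideanNorm.
Context (R : realType) (m : nat).
Implicit Types x y z : 'cV[R]_m.

Lemma dotE x y : dot x y = \sum_(i < m) x i 0 * y i 0.
Proof. by rewrite /dot mxE; apply: eq_bigr => i _; rewrite mxE. Qed.

Lemma dotC x y : dot x y = dot y x.
Proof. by rewrite !dotE; apply: eq_bigr => i _; rewrite mulrC. Qed.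

Lemma dotDl x y z : dot (x + y) z = dot x z + dot y z.
Proof.
by rewrite !dotE -big_split; apply: eq_bigr => i _; rewrite mxE mulrDl.
Qed.

Lemma dotZl c x y : dot (c *: x) y = c * dot x y.
Proof.
by rewrite !dotE mulr_sumr; apply: eq_bigr => i _; rewrite mxE mulrA.
Qed.

Lemma dotDr x y z : dot x (y + z) = dot x y + dot x z.
Proof. by rewrite dotC dotDl !(dotC x). Qed.

Lemma dotZr c x y : dot x (c *: y) = c * dot x y.
Proof. by rewrite dotC dotZl dotC. Qed.

Lemma dotNl x y : dot (- x) y = - dot x y.
Proof. by rewrite -scaleN1r dotZl mulN1r. Qed.

Lemma dotNr x y : dot x (- y) = - dot x y.
Proof. by rewrite -scaleN1r dotZr mulN1r. Qed.

Lemma dot0l x : dot 0 x = 0.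
Proof. by rewrite dotE big1// => i _; rewrite mxE mul0r. Qed.

Lemma dot_ge0 x : 0 <= dot x x.
Proof. by rewrite dotE sumr_ge0// => i _; rewrite -expr2 sqr_ge0. Qed.

Lemma enorm_sqr x : enorm x ^+ 2 = dot x x.
Proof. by rewrite sqr_sqrtr// dot_ge0. Qed.

Lemma enorm_ge0 x : 0 <= enorm x.
Proof. exact: sqrtr_ge0. Qed.

Lemma enorm_sqrE x : enorm x ^+ 2 = \sum_(i < m) x i 0 ^+ 2.
Proof. by rewrite enorm_sqr dotE; apply: eq_bigr. Qed.

Lemma enorm_sqrD x y :
  enorm (x + y) ^+ 2 = enorm x ^+ 2 + 2 * dot x y + enorm y ^+ 2.
Proof. by rewrite !enorm_sqr dotDl !dotDr (dotC y x); ring. Qed.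

Lemma enormZ c x : enorm (c *: x) = `|c| * enorm x.
Proof.
by rewrite /enorm dotZl dotZr mulrA -expr2 sqrtrM ?sqr_ge0// sqrtr_sqr.
Qed.

Lemma enormN x : enorm (- x) = enorm x.
Proof. by rewrite /enorm dotNl dotNr opprK. Qed.

Lemma enorm0 : enorm (0 : 'cV[R]_m) = 0.
Proof. by rewrite /enorm dot0l sqrtr0. Qed.

Lemma enorm_eq0 x : enorm x = 0 -> x = 0.
Proof.
move=> x0; apply/matrixP => i j; rewrite ord1 mxE.
have : \sum_(i < m) x i 0 ^+ 2 = 0 by rewrite -enorm_sqrE x0 expr0n.
move=> /eqP; rewrite psumr_eq0 => [/allP/(_ i)|k _]; last exact: sqr_ge0.
by rewrite mem_index_enum sqrf_eq0 => /(_ isT)/eqP.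
Qed.

Lemma cauchy_schwarz x y : dot x y <= enorm x * enorm y.
Proof.
have [y0|y0] := eqVneq (enorm y) 0.
  by rewrite (enorm_eq0 y0) dotC dot0l enorm0 mulr0.
have ny0 : 0 < enorm y by rewrite lt_neqAle eq_sym y0 enorm_ge0.
have [x0|x0] := eqVneq (enorm x) 0.
  by rewrite (enorm_eq0 x0) dot0l enorm0 mul0r.
have nx0 : 0 < enorm x by rewrite lt_neqAle eq_sym x0 enorm_ge0.
have := dot_ge0 (enorm y *: x - enorm x *: y).
rewrite -enorm_sqr enorm_sqrD enormN !enormZ !gtr0_norm// dotNr dotZl dotZr.
move=> H.
have {}H : 0 <= 2 * (enorm x * enorm y) * (enorm x * enorm y - dot x y).
  by apply: le_trans H _; rewrite le_eqVlt; apply/orP; left; apply/eqP; ring.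
by rewrite -subr_ge0; rewrite pmulr_rge0// in H; rewrite !mulr_gt0.
Qed.

Lemma enorm_triangle x y : enorm (x + y) <= enorm x + enorm y.
Proof.
rewrite -(@ler_pXn2r _ 2)// ?nnegrE ?addr_ge0 ?enorm_ge0//.
rewrite enorm_sqrD; have := cauchy_schwarz x y; nra.
Qed.

Lemma dot_le_sqr x y c : 0 < c ->
  dot x y <= c * enorm x ^+ 2 + (4 * c)^-1 * enorm y ^+ 2.
Proof.
move=> c0; have := dot_ge0 (x - (2 * c)^-1 *: y).
rewrite -enorm_sqr enorm_sqrD enormN enormZ dotNr dotZr exprMn real_normK ?num_real// => H.
have {}H := mulr_ge0 (ltW c0) H; rewrite -subr_ge0; apply: le_trans H _.
by rewrite le_eqVlt; apply/orP; left; apply/eqP; field; rewrite gt_eqF.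
Qed.

End EuclideanNorm.

Section GaussianMoments.
Context (R : realType) (dO : measure_display) (Omega : measurableType dO).
Context (P : probability Omega R) (m : nat) (u : {RV P >-> borel R m}).
Hypothesis gu : standard_gaussian u.
Local Notation vec w := (u w : 'cV[R]_m).

Let full (V : nmodType) (F : 'I_m -> V) :
  \sum_(i < m) (if (i < m)%N then F i else 0) = \sum_(i < m) F i.
Proof. by apply: eq_bigr => i _; rewrite ltn_ord. Qed.

Lemma gaussian_enorm6 : has_expectation P (fun w => enorm (vec w) ^+ 6)
  (m%:R ^+ 3 + 6 * m%:R ^+ 2 + 8 * m%:R).
Proof.
have [_ _ + _] := gaussian_partial_moments gu (fun=> 0) (leqnn m).
apply: has_expectation_ext => // w.
by rewrite full -enorm_sqrE -exprM.
Qed.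

Lemma gaussian_dot_sqr (a : 'cV[R]_m) :
  has_expectation P (fun w => dot a (vec w) ^+ 2) (enorm a ^+ 2).
Proof.
have [_ _ _ [_ + _ _]] := gaussian_partial_moments gu (fun i => a i 0) (leqnn m).
by apply: has_expectation_ext => [w|]; rewrite full ?dotE ?enorm_sqrE.
Qed.

Lemma gaussian_dot_sqr_enorm (a : 'cV[R]_m) :
  has_expectation P (fun w => dot a (vec w) ^+ 2 * enorm (vec w) ^+ 2)
    ((m%:R + 2) * enorm a ^+ 2).
Proof.
have [_ _ _ [_ _ _ +]] := gaussian_partial_moments gu (fun i => a i 0) (leqnn m).
by apply: has_expectation_ext => [w|]; rewrite !full ?dotE enorm_sqrE.
Qed.

(** Polarization: the product of two coordinates is a difference of squares of linear forms at the
    sum and the difference of two basis vectors. *)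
Lemma gaussian_coordM (i j : 'I_m) :
  has_expectation P (fun w => vec w i 0 * vec w j 0) (i == j)%:R.
Proof.
pose e (k : 'I_m) : 'cV[R]_m := delta_mx k 0.
have eE k w : dot (e k) (vec w) = vec w k 0.
  rewrite dotE (bigD1 k)//= big1 ?addr0 ?mxE ?eqxx ?mul1r// => l lk.
  by rewrite mxE (negbTE lk) mul0r.
have ee k l : dot (e k) (e l) = (k == l)%:R.
  rewrite dotE (bigD1 k)//= big1 ?addr0 => [|q qk]; last first.
    by rewrite mxE (negbTE qk) mul0r.
  by rewrite !mxE !eqxx mul1r andbT.
have hp := gaussian_dot_sqr (e i + e j).
have hm := gaussian_dot_sqr (e i - e j).
have := has_expectationZ (4^-1) (has_expectationB hp hm).
apply: has_expectation_ext => [w|].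
  by rewrite !dotDl dotNl !eE; field.
by rewrite !enorm_sqrD enormN dotNr ee; field.
Qed.

End GaussianMoments.

(** * Proximal mapping *)

Section DirectionalDerivatives.
Context (R : realType) (m : nat).
Implicit Types (f : 'cV[R]_m -> R) (x y v : 'cV[R]_m).

(** The sequential form serves twice: it exhibits partial derivatives as limits of measurable
    functions, and it lets inequalities between difference quotients pass to the limit. *)
Lemma derive_seq_cvg f x v : derivable f x v ->
  n.+1%:R * (f (x + n.+1%:R^-1 *: v) - f x) @[n --> \oo] --> 'D_v f x.
Proof.
move=> df.
have inv0 : (n.+1%:R^-1 : R) @[n --> \oo] --> 0^'.
  move=> A [e /= e0 Ae]; have [k _ kP] := near_infty_natSinv_lt (PosNum e0).
  exists k => // n kn; apply: Ae; last by rewrite invr_eq0.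
  by rewrite /= sub0r normrN ger0_norm ?invr_ge0//; exact: kP.
have := cvg_comp _ _ inv0 df; apply: cvg_trans.
rewrite (_ : (fun n => _) = (fun h => h^-1 *: (f (h *: v + x) - f x)) \o
  (fun n => n.+1%:R^-1 : R))//.
by apply/funext => n /=; rewrite invrK (addrC x).
Qed.

Lemma col_sum_delta v : v = \sum_(i < m) v i 0 *: delta_mx i 0.
Proof.
rewrite [LHS]matrix_sum_delta; apply: eq_bigr => i _.
by rewrite big_ord1.
Qed.

Lemma derive_dot_grad f x v : differentiable f x -> 'D_v f x = dot (grad f x) v.
Proof.
move=> df; rewrite deriveE// {1}[v]col_sum_delta linear_sum dotE.
apply: eq_bigr => i _; rewrite linearZ /= -deriveE// mxE.
by rewrite /GRing.scale /= mulrC.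
Qed.

Lemma continuous_dot v : continuous (fun x => dot v x).
Proof.
have -> : (fun x => dot v x) = (fun x => \sum_(i < m) v i 0 * x i 0).
  by apply/funext => x; rewrite dotE.
elim: (index_enum _) => [|i s IH].
  under eq_fun do rewrite big_nil; exact: cst_continuous.
under eq_fun do rewrite big_cons.
move=> x; apply: (@continuousD _ _ _ (fun x : 'cV[R]_m => v i 0 * x i 0)); last exact: IH.
apply: (@continuousM _ _ (cst (v i 0)) (fun x : 'cV[R]_m => x i 0)).
  exact: cst_continuous.
exact: coord_continuous.
Qed.

Lemma measurable_grad f : (forall x, differentiable f x) ->
  @measurable_fun _ _ (borel R m) (borel R m) setT (grad f).
Proof.
move=> df; apply: measurable_to_borel => i.
apply: (measurable_fun_cvg (h := fun n (x : borel R m) =>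
  n.+1%:R * (f ((x : 'cV[R]_m) + n.+1%:R^-1 *: delta_mx i 0) - f x))).
- move=> n; apply: measurable_funM; first exact: measurable_cst.
  have mf : @measurable_fun _ _ (borel R m) R setT f.
    by apply: continuous_borel_measurable => x; exact: differentiable_continuous.
  apply: measurable_funB => //.
  apply: (@measurableT_comp _ _ _ (borel R m) (borel R m) R f) => //.
  apply: measurable_vecD; first exact: measurable_id.
  exact: measurable_cst.
- move=> x _; rewrite mxE; apply: derive_seq_cvg; exact: diff_derivable.
Qed.

End DirectionalDerivatives.

Section CompactVectors.
Context (R : realType) (m : nat).

Lemma mx_norm_coord (x : 'cV[R]_m) i : `|x i 0| <= `|x|.
Proof.
rewrite [leRHS]/Num.norm /= mx_normrE; apply/bigmax_geP; right => /=.
by exists (i, 0).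
Qed.

Lemma mx_norm_le_enorm (x : 'cV[R]_m) : `|x| <= enorm x.
Proof.
rewrite [leLHS]/Num.norm /= mx_normrE; apply/bigmax_leP; split.
  exact: enorm_ge0.
move=> [i j] _; rewrite ord1 /= -(@ler_pXn2r _ 2) ?nnegrE ?enorm_ge0//.
rewrite real_normK ?num_real// enorm_sqrE (bigD1 i)//= lerDl.
by rewrite sumr_ge0// => k _; exact: sqr_ge0.
Qed.

Lemma continuous_trmx p q : continuous (@trmx R p q).
Proof.
move=> M A [B MB BA]; exists (fun i j => B j i).
  by move=> i j; have := MB j i; rewrite mxE.
by move=> N BN; apply: BA => i j; rewrite mxE; exact: BN.
Qed.

(** Heine-Borel is carried over from rows to columns by transposition, which is continuous and
    preserves the sup norm. *)
Lemma cV_bounded_closed_compact (A : set 'cV[R]_m) (c : R) :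
  closed A -> (forall x, A x -> `|x| <= c) -> compact A.
Proof.
move=> clA bA.
have -> : A = trmx @` (trmx @^-1` A : set 'rV[R]_m).
  apply/seteqP; split => [x Ax|_ [x Ax <-]//].
  by exists x^T; rewrite /= trmxK.
apply: continuous_compact.
  by apply: continuous_subspaceT; exact: continuous_trmx.
apply: bounded_closed_compact.
  exists c; split; first exact: num_real.
  move=> M cM x /= /bA; rewrite /Num.norm /= !mx_normrE => H.
  apply/bigmax_leP; split => [|[i j] _].
    by apply: le_trans (ltW cM); apply: le_trans H; exact: bigmax_ge_id.
  apply: le_trans (ltW cM); apply: le_trans H.
  by apply/bigmax_geP; right; exists (j, i) => //=; rewrite mxE.
apply: preimage_closed clA => x _; exact: continuous_trmx.
Qed.

(** Lower semicontinuity is expressed by closed sublevel sets. The traces on [A] of the sets of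
    points with value at most [h a], for [a] in [A], have the finite intersection property; a point
    common to all of them is a minimizer. *)
Lemma lsc_attains_min (A : set 'cV[R]_m) (h : 'cV[R]_m -> R) :
  compact A -> A !=set0 -> (forall c, closed [set y | h y <= c]) ->
  exists y, is_argmin A h y.
Proof.
move=> cA A0 hc; rewrite compact_In0 in cA.
have [] := cA _ A (fun a => A `&` [set y | h y <= h a]).
- by exists (fun a => [set y | h y <= h a]).
- move=> D DA.
  have {DA} : forall a, a \in enum_fset D -> A a by move=> a /DA /set_mem.
  rewrite (_ : [set i | i \in D] = [set i | i \in enum_fset D])//.
  (* The sublevel sets are nested, so the point of least value in the finite list belongs to all of
     them. *)
  elim: (enum_fset D) => [_|a s IH sA].
    by have [a Aa] := A0; exists a => i.
  have [|y ys] := IH; first by move=> b bs; apply: sA; rewrite inE bs orbT.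
  have Aa : A a by apply: sA; rewrite mem_head.
  have [/allP s0|] := boolP (all (fun b => h a <= h b) s).
    exists a => i /=; rewrite inE => /orP[/eqP ->|is_]; split => //=.
    exact: s0.
  move=> /allPn[b bs]; rewrite -ltNge => hba.
  exists y => i /=; rewrite inE => /orP[/eqP ->|is_]; last exact: ys.
  by have [Ay hy] := ys b bs; split => //=; exact: le_trans hy (ltW hba).
- move=> y Ay; have [a Aa] := A0; exists y; split; first by have [] := Ay a Aa.
  by move=> z Az; have [] := Ay z Az.
Qed.

End CompactVectors.

Lemma enorm_le_mx_norm (R : realType) (m : nat) (x : 'cV[R]_m) :
  enorm x <= m%:R * `|x|.
Proof.
rewrite -(@ler_pXn2r _ 2) ?nnegrE ?enorm_ge0 ?mulr_ge0//.
apply: (@le_trans _ _ (m%:R * `|x| ^+ 2)).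
  rewrite enorm_sqrE mulr_natl -[X in _ *+ X]card_ord -sumr_const.
  apply: ler_sum => i _; rewrite -[leLHS]real_normK ?num_real//.
  by rewrite ler_pXn2r ?nnegrE// mx_norm_coord.
rewrite exprMn ler_wpM2r ?sqr_ge0// -natrX ler_nat.
by case: (m) => // q; rewrite expnS expn1 leq_pmulr.
Qed.

(** * Minimizers of uniformly convex functions *)

Section UniformlyConvex.
Context (R : realType) (m : nat) (X : set 'cV[R]_m) (h : 'cV[R]_m -> R) (k : R).
Hypothesis clX : closed X.
Hypothesis cvX : forall x y t, X x -> X y -> 0 <= t <= 1 ->
  X (t *: x + (1 - t) *: y).
Hypothesis k0 : 0 < k.
Hypothesis huc : forall x y t, 0 <= t <= 1 ->
  h (t *: x + (1 - t) *: y) <=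
    t * h x + (1 - t) * h y - t * (1 - t) * k * enorm (x - y) ^+ 2.
Hypothesis hlsc : forall c, closed [set y | h y <= c].

(** Minimality is compared with uniform convexity on the segment from [y] to [z]: dividing by [t]
    leaves (1 - t) D <= h z - h y, and [t] is taken small. *)
Lemma strong_minimality y z : is_argmin X h y -> X z ->
  h y + k * enorm (z - y) ^+ 2 <= h z.
Proof.
move=> [Xy ymin] Xz; set D := k * _.
have hyz : h y <= h z by exact: ymin.
have step t : 0 < t -> t <= 1 -> (1 - t) * D <= h z - h y.
  move=> t0 t1; have t01 : 0 <= t <= 1 by rewrite (ltW t0) t1.
  have h1 := le_trans (ymin _ (cvX Xz Xy t01)) (huc z y t01).
  rewrite -mulrA -/D in h1; rewrite -(ler_pM2l t0); lra.
rewrite leNgt; apply/negP => hlt.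
have D0 : 0 < D by lra.
(* An explicit small [t]: it makes (1 - t) D the midpoint of [D] and h z - h y, which exceeds h z -
   h y. *)
pose t := (D - (h z - h y)) / (2 * D).
have tD : t * D = (D - (h z - h y)) / 2.
  by rewrite /t; field; rewrite gt_eqF.
have D2 : 0 < 2 * D by rewrite mulr_gt0.
have num0 : 0 < D - (h z - h y) by lra.
have t0 : 0 < t by rewrite divr_gt0.
have t1 : t <= 1 by rewrite ler_pdivrMr// mul1r; lra.
have := step t t0 t1; lra.
Qed.

Lemma argmin_unique y z : is_argmin X h y -> is_argmin X h z -> y = z.
Proof.
move=> hy hz; have := strong_minimality hy hz.1; have := hz.2 _ hy.1 => h1 h2.
have : k * enorm (z - y) ^+ 2 <= 0 by lra.
rewrite pmulr_rle0// => {}h1.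
have : enorm (z - y) ^+ 2 == 0 by rewrite eq_le h1 sqr_ge0.
by rewrite sqrf_eq0 => /eqP/enorm_eq0/eqP; rewrite subr_eq0 => /eqP.
Qed.

(** Uniform convexity gives coercivity: points with value at most [h x0] stay within distance [r] of
    [x0], so a minimizer over the compact set [K r] is global. *)
Lemma argmin_exists x0 : X x0 -> exists y, is_argmin X h y.
Proof.
move=> Xx0.
pose K r := X `&` closed_ball_ (fun x : 'cV[R]_m => `|x|) x0 r.
have cK r : compact (K r).
  apply: (@cV_bounded_closed_compact R m _ (`|x0| + r)).
    by apply: closedI => //; exact: closed_closed_ball_.
  move=> x [_ /= Hx]; rewrite -[x](subKr x0) (le_trans (ler_normB _ _))//.
  by rewrite lerD2l.
have K0 r : 0 <= r -> K r x0 by move=> r0; split => //; rewrite /closed_ball_ /= subrr normr0.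
have [y1 [_ y1min]] := lsc_attains_min (cK 1) (ex_intro _ x0 (K0 1 ler01)) hlsc.
(* [y1] minimizes [h] over the unit ball around [x0]; the inequality behind this radius is (e - 1) k
   <= h x0 - h y1 for a point at distance e > 1 with value at most [h x0]. *)
pose r := 1 + (h x0 - h y1) / k.
have h01 : h y1 <= h x0 by apply: y1min; exact: K0.
have r1 : 1 <= r by rewrite lerDl divr_ge0 ?(ltW k0)// subr_ge0.
have far y : X y -> h y <= h x0 -> `|x0 - y| <= r.
  move=> Xy hy; set e := `|x0 - y|.
  rewrite leNgt; apply/negP => re.
  have e1 : 1 < e by exact: le_lt_trans r1 re.
  have e0 : 0 < e by exact: lt_trans ltr01 e1.
  (* With this [t] the point of the segment lies at sup distance exactly 1 from [x0], so its value
     is at least [h y1]. *)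
  pose t := e^-1.
  have t0 : 0 < t by rewrite invr_gt0.
  have te : t * e = 1 by rewrite mulVf// gt_eqF.
  have t1 : t < 1 by rewrite invf_lt1.
  have t01 : 0 <= t <= 1 by rewrite (ltW t0) (ltW t1).
  have hz : h y1 <= h (t *: y + (1 - t) *: x0).
    apply: y1min; split; first exact: cvX.
    rewrite /closed_ball_ /= (_ : x0 - _ = t *: (x0 - y)).
      by rewrite normrZ gtr0_norm// te.
    by apply/matrixP => a c; rewrite !mxE; ring.
  have enorm_ge : e ^+ 2 <= enorm (y - x0) ^+ 2.
    rewrite ler_pXn2r ?nnegrE ?enorm_ge0 ?(ltW e0)//.
    by rewrite /e distrC mx_norm_le_enorm.
  have h1 := huc y x0 t01.
  have h2 : t * (1 - t) * k * e ^+ 2 <= t * (1 - t) * k * enorm (y - x0) ^+ 2.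
    by rewrite ler_wpM2l// !mulr_ge0 ?(ltW t0) ?(ltW k0)// subr_ge0 ltW.
  have h3 : t * (1 - t) * k * e ^+ 2 = (e - 1) * k.
    have -> : t * (1 - t) * k * e ^+ 2 = (t * e) * (e - t * e) * k by ring.
    by rewrite te mul1r.
  have h4 : t * h y <= t * h x0 by rewrite ler_pM2l.
  have h5 : (e - 1) * k <= h x0 - h y1 by lra.
  have : e <= r by rewrite /r -lerBlDl ler_pdivlMr.
  by rewrite leNgt re.
have [y [[Xy _] ymin]] := lsc_attains_min (cK r)
  (ex_intro _ x0 (K0 r (le_trans ler01 r1))) hlsc.
exists y; split => // z Xz.
have [hz|/ltW hz] := leP (h z) (h x0).
  by apply: ymin; split => //; exact: far.
apply: le_trans hz; apply: ymin; apply: K0; exact: le_trans ler01 r1.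
Qed.

End UniformlyConvex.

Section Prox.
Context (R : realType) (m : nat) (X : set 'cV[R]_m) (chi phi : 'cV[R]_m -> R).
Hypothesis clX : closed X.
Hypothesis cvX : convex_set X.
Hypothesis hchi : closed_convex_function chi.
Hypothesis dphi : forall y, differentiable phi y.
Hypothesis scphi : strongly_convex1 phi.
Variable alpha : R.
Hypothesis alpha0 : 0 < alpha.

(** With c = g - alpha^-1 grad phi x this is the proximal objective up to a constant in [y], so [x]
    and [g] act only through one linear term. *)
Let obj (c y : 'cV[R]_m) := dot c y + alpha^-1 * phi y + chi y.

Let k := alpha^-1 / 2.
Let k0 : 0 < k. Proof. by rewrite divr_gt0 ?invr_gt0. Qed.

Let cvX' x y t : X x -> X y -> 0 <= t <= 1 -> X (t *: x + (1 - t) *: y).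
Proof.
move=> Xx Xy /andP[t0 t1].
have := cvX (Itv01 t0 t1) (mem_set Xx) (mem_set Xy).
by move=> /set_mem.
Qed.

Let chi_convex x y t : 0 <= t <= 1 ->
  chi (t *: x + (1 - t) *: y) <= t * chi x + (1 - t) * chi y.
Proof.
move=> /andP[t0 t1].
exact: (hchi.1 (Itv01 t0 t1) x y (mem_set Logic.I) (mem_set Logic.I)).
Qed.

Let obj_uc c x y t : 0 <= t <= 1 ->
  obj c (t *: x + (1 - t) *: y) <=
    t * obj c x + (1 - t) * obj c y - t * (1 - t) * k * enorm (x - y) ^+ 2.
Proof.
move=> t01; have h1 := chi_convex x y t01; have h2 := scphi x y t01.
rewrite /obj dotDr !dotZr.
have h3 : alpha^-1 * phi (t *: x + (1 - t) *: y) <= alpha^-1 *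
  (t * phi x + (1 - t) * phi y - t * (1 - t) / 2 * enorm (x - y) ^+ 2).
  by rewrite ler_wpM2l// invr_ge0 ltW.
by rewrite /k; lra.
Qed.

(** A sublevel set of the objective is the preimage of the closed epigraph of [chi] under a
    continuous map. *)
Let obj_lsc c e : closed [set y | obj c y <= e].
Proof.
pose g (y : 'cV[R]_m) := (y, e - (dot c y + alpha^-1 * phi y)).
have -> : [set y | obj c y <= e] = g @^-1` [set p | chi p.1 <= p.2].
  by apply/seteqP; split => y /=; rewrite /obj /g /=; lra.
apply: preimage_closed hchi.2 => y _.
have cphi : {for y, continuous phi} by exact: differentiable_continuous.
have cl : {for y, continuous (fun y : 'cV[R]_m => e - (dot c y + alpha^-1 * phi y))}.
  apply: (@continuousB _ _ _ (cst e) (fun y : 'cV[R]_m => dot c y + alpha^-1 * phi y)).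
    exact: cst_continuous.
  apply: (@continuousD _ _ _ (fun y : 'cV[R]_m => dot c y)
    (fun y : 'cV[R]_m => alpha^-1 * phi y)).
    exact: continuous_dot.
  apply: (@continuousM _ _ (cst alpha^-1) phi) => //.
  exact: cst_continuous.
exact: (cvg_pair cvg_id cl).
Qed.

(** Strong convexity is applied on the segment at parameter t = 1 / (n + 1), multiplied by n + 1,
    and n tends to infinity. *)
Lemma bregman_ge (x y : 'cV[R]_m) :
  2^-1 * enorm (x - y) ^+ 2 <= bregman phi x y.
Proof.
rewrite /bregman -derive_dot_grad//.
have dd : derivable phi y (x - y) by exact: diff_derivable.
have hcvg := derive_seq_cvg dd.
set D := enorm _ ^+ 2.
suff H : 'D_(x - y) phi y <= phi x - phi y - 2^-1 * D by lra.
have cst_cvg : (phi x - phi y - (1 - n.+1%:R^-1) / 2 * D : R) @[n --> \oo]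
    --> phi x - phi y - 2^-1 * D.
  apply: cvgB; first exact: cvg_cst.
  apply: cvgMr_tmp; rewrite -[X in _ --> X]mul1r; apply: cvgMr_tmp.
  rewrite -[X in _ --> X]subr0; apply: cvgB; first exact: cvg_cst.
  by apply/cvgrPdist_lt => e e0; near=> n; rewrite sub0r normrN ger0_norm ?invr_ge0//;
    near: n; exact: (near_infty_natSinv_lt (PosNum e0)).
apply: (ler_cvg_to hcvg cst_cvg); apply: nearW => n.
set t : R := n.+1%:R^-1; set N : R := n.+1%:R.
have tN : N * t = 1 by rewrite mulfV// pnatr_eq0.
have N0 : 0 < N by rewrite ltr0n.
have t01 : 0 <= t <= 1 by rewrite invr_ge0 ltW//= invf_le1// ler1n.
have := scphi x y t01; rewrite -/D.
have -> : t *: x + (1 - t) *: y = y + t *: (x - y).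
  by apply/matrixP => a c; rewrite !mxE; ring.
move=> H.
have {}H := ler_wpM2l (ltW N0) H.
have E : N * (t * phi x + (1 - t) * phi y - t * (1 - t) / 2 * D) =
    (N * t) * phi x + (N - N * t) * phi y - (N * t) * (1 - t) / 2 * D by ring.
by rewrite E tN in H; lra.
Unshelve. all: by end_near. Qed.

Lemma bregman_objE x g y :
  dot g y + alpha^-1 * bregman phi y x + chi y =
  obj (g - alpha^-1 *: grad phi x) y
    - alpha^-1 * (phi x - dot (grad phi x) x).
Proof. by rewrite /bregman /obj dotDl dotDr !dotNl dotNr dotZl; ring. Qed.

Lemma is_argmin_bregman x g y :
  is_argmin X (fun y => dot g y + alpha^-1 * bregman phi y x + chi y) y <->
  is_argmin X (obj (g - alpha^-1 *: grad phi x)) y.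
Proof.
by split => -[Xy ymin]; split => // z Xz; have := ymin z Xz;
  rewrite !bregman_objE lerD2r.
Qed.

Hypothesis X0 : X !=set0.

Let prox_argmin_obj x g :
  is_argmin X (obj (g - alpha^-1 *: grad phi x)) (prox X chi phi x g alpha).
Proof.
have [x0 Xx0] := X0.
have [y hy] := argmin_exists clX cvX' k0 (@obj_uc _) (@obj_lsc (g - alpha^-1 *: grad phi x)) Xx0.
apply/is_argmin_bregman; rewrite /prox; case: xgetP => [z -> //|/(_ y) []].
exact/is_argmin_bregman.
Qed.

Lemma prox_in x g : X (prox X chi phi x g alpha).
Proof. by have [] := prox_argmin_obj x g. Qed.

(** Each minimizer is tested against the other in [strong_minimality]. In the sum everything cancels
    except the difference of the linear terms, to which Cauchy-Schwarz applies. *)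
Let argmin_lipschitz c c' y y' :
  is_argmin X (obj c) y -> is_argmin X (obj c') y' ->
  enorm (y - y') <= alpha * enorm (c - c').
Proof.
move=> hy hy'.
have h1 := strong_minimality (h := obj c) (k := k) cvX' (@obj_uc c) hy hy'.1.
have h2 := strong_minimality (h := obj c') (k := k) cvX' (@obj_uc c') hy' hy.1.
have [->|yy'] := eqVneq (enorm (y - y')) 0.
  by rewrite mulr_ge0 ?enorm_ge0 ?ltW.
have n0 : 0 < enorm (y - y') by rewrite lt_neqAle eq_sym yy' enorm_ge0.
rewrite -opprB enormN in h1.
have h3 : alpha^-1 * enorm (y - y') ^+ 2 <= dot (c - c') (y' - y).
  move: h1 h2; rewrite /obj /k !dotDl !dotDr !dotNl !dotNr; lra.
have h4 := le_trans h3 (cauchy_schwarz _ _).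
rewrite -[y' - y]opprB enormN expr2 mulrA ler_pM2r// in h4.
by rewrite -ler_pdivrMl.
Qed.

Lemma prox_lipschitz x g g' :
  enorm (prox X chi phi x g alpha - prox X chi phi x g' alpha) <=
    alpha * enorm (g - g').
Proof.
have := argmin_lipschitz (prox_argmin_obj x g) (prox_argmin_obj x g').
by rewrite opprB addrA subrK.
Qed.

(** Testing the minimizer against [x] gives half of alpha^-1 times the squared distance; the other
    half is the lower bound on the Bregman term at [y], while the term at [x] vanishes. *)
Lemma prox_descent x g y : X x -> y = prox X chi phi x g alpha ->
  alpha^-1 * enorm (x - y) ^+ 2 + chi y - chi x <= dot g (x - y).
Proof.
move=> Xx yE.
have := strong_minimality (h := obj (g - alpha^-1 *: grad phi x)) (k := k) cvX'
  (@obj_uc _) (prox_argmin_obj x g) Xx.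
rewrite -yE; set c := g - _.
have E z := bregman_objE x g z; rewrite -/c in E.
have bx : bregman phi x x = 0.
  by rewrite /bregman !subrr sub0r dotC dot0l oppr0.
have := E x; have := E y; rewrite bx mulr0 addr0 => Ey Ex H.
have by_ : alpha^-1 * (2^-1 * enorm (x - y) ^+ 2) <= alpha^-1 * bregman phi y x.
  rewrite ler_wpM2l ?invr_ge0 ?(ltW alpha0)//.
  by rewrite -[x - y]opprB enormN; exact: bregman_ge.
move: H by_ Ex Ey; rewrite dotDr dotNr /k; lra.
Qed.

Lemma measurable_prox (d : measure_display) (T : measurableType d)
    (x g : T -> borel R m) : measurable_fun setT x -> measurable_fun setT g ->
  @measurable_fun _ _ T (borel R m) setT
    (fun t => prox X chi phi (x t) (g t) alpha).
Proof.
move=> mx mg.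
pose Q (c : 'cV[R]_m) := xget 0 (is_argmin X (obj c)).
have QP c : is_argmin X (obj c) (Q c).
  have [x0 Xx0] := X0.
  have [y hy] := argmin_exists clX cvX' k0 (@obj_uc _) (@obj_lsc c) Xx0.
  by rewrite /Q; case: xgetP => [z -> //|/(_ y)].
(* prox depends on (x, g) only through g - grad phi x / alpha, on which it is
   Lipschitz. *)
have -> : (fun t => prox X chi phi (x t) (g t) alpha) = (fun t => Q
    ((g t : 'cV[R]_m) - alpha^-1 *: (grad phi (x t) : 'cV[R]_m))).
  apply/funext => t.
  exact: (argmin_unique (h := obj (g t - alpha^-1 *: grad phi (x t))) (k := k) cvX' k0
    (@obj_uc _) (prox_argmin_obj _ _) (QP _)).
have mQ : @measurable_fun _ _ (borel R m) (borel R m) setT Q.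
  apply: measurable_to_borel => i; apply: continuous_borel_measurable => c.
  have am0 : 0 < alpha * (m%:R + 1) by rewrite mulr_gt0// ltr_wpDl// ler0n.
  apply/(@cvgrPdist_lt _ _ _ (nbhs (c : 'cV[R]_m)) _
    (fun c : 'cV[R]_m => Q c i 0)) => e e0; near=> c'.
  have h1 := mx_norm_le_enorm (Q c - Q c').
  have h2 := mx_norm_coord (Q c - Q c') i; rewrite !mxE in h2.
  apply: le_lt_trans h2 _; apply: le_lt_trans h1 _.
  apply: le_lt_trans (argmin_lipschitz (QP c) (QP c')) _.
  apply: (@le_lt_trans _ _ (alpha * (m%:R * `|c - c'|))).
    by rewrite ler_pM2l// enorm_le_mx_norm.
  apply: (@le_lt_trans _ _ (alpha * (m%:R + 1) * `|c - c'|)).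
    by rewrite mulrA ler_wpM2r// ler_pM2l// lerDl.
  rewrite mulrC -ltr_pdivlMr//; near: c'.
  have r0 : 0 < e / (alpha * (m%:R + 1)) by rewrite divr_gt0.
  have := nbhsx_ballx (c : 'cV[R]_m) _ r0.
  by rewrite -ball_normE.
apply: (measurableT_comp mQ).
apply: measurable_vecB => //.
apply: measurable_vecZ; first exact: measurable_cst.
by apply: measurableT_comp mx; exact: measurable_grad.
Unshelve. all: by end_near. Qed.

End Prox.

(** * Blocks and descent *)

Section BlockAlgebra.
Context (R : realType) (b : nat) (d : 'I_b -> nat).
Local Notation n := (\sum_(s < b) d s)%N.
Implicit Types (x y : 'cV[R]_n).

Lemma block_submxcol s x : block s x = submxcol x s.
Proof.
rewrite /block /Ublock -[LHS]trmxK trmx_mul trmxK mul_submxrow mulmx1.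
by rewrite tr_submxrow trmxK.
Qed.

Lemma block_mxcol s (B : forall s, 'cV[R]_(d s)) : block s (\mxcol_s B s) = B s.
Proof. by rewrite block_submxcol mxcolK. Qed.

Lemma mxcol_block x : \mxcol_s block s x = x.
Proof.
by rewrite -[RHS]submxcolK; apply: eq_mxcol => s; rewrite block_submxcol.
Qed.

Lemma dot_block x y : dot x y = \sum_s dot (block s x) (block s y).
Proof.
rewrite -{1}(mxcol_block x) -{1}(mxcol_block y) /dot tr_mxcol mul_mxrow_mxcol.
by rewrite summxE.
Qed.

Lemma enorm_block x : enorm x ^+ 2 = \sum_s enorm (block s x) ^+ 2.
Proof.
by rewrite enorm_sqr dot_block; apply: eq_bigr => s _; rewrite enorm_sqr.
Qed.

Lemma blockB s x y : block s (x - y) = block s x - block s y.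
Proof. by rewrite /block mulmxBr. Qed.

Lemma dot_Ublock s x (h : 'cV[R]_(d s)) :
  dot x (Ublock R d s *m h) = dot (block s x) h.
Proof. by rewrite /dot /block trmx_mul trmxK mulmxA. Qed.

Lemma Ublock_block s x :
  (forall r, r != s -> block r x = 0) -> Ublock R d s *m block s x = x.
Proof.
move=> x0; apply/eqP; rewrite -subr_eq0; apply/eqP/enorm_eq0/eqP.
rewrite -sqrf_eq0 enorm_sqr; apply/eqP.
set v := _ - x.
rewrite dotDr dotNr dot_Ublock (dot_block v x) (bigD1 s)//= big1 ?addr0 ?subrr//.
by move=> r rs; rewrite x0// dotC dot0l.
Qed.

End BlockAlgebra.

(** * Descent inequalities *)

Section Descent.
Context (R : realType).

(** The mean value theorem is applied to [f] minus its quadratic majorant, so a one-sided bound on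
    the derivative is enough and nothing has to be integrated. *)
Lemma descent_1d (f df : R -> R) (c : R) :
  (forall t, is_derive t (1 : R) f (df t)) ->
  (forall t, 0 <= t <= 1 -> df t - df 0 <= c * t) ->
  f 1 - f 0 - df 0 <= c / 2.
Proof.
move=> hdf hc.
pose g t := f t - df 0 * t - c / 2 * t ^+ 2.
have dg (t : R) : is_derive t (1 : R) g (df t - df 0 - c * t).
  have d1 := hdf t.
  have d2 : is_derive t (1 : R) (fun t : R => df 0 * t) (df 0).
    by have := is_deriveZ (df 0) (is_derive_id t (1 : R)); rewrite /GRing.scale /= mulr1.
  have d3 : is_derive t (1 : R) (fun t : R => c / 2 * t ^+ 2) (c * t).
    have := is_deriveZ (c / 2) (is_deriveX 2 (is_derive_id t (1 : R))).
    by rewrite /GRing.scale /= => h; apply: (is_derive_eq h); field.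
  by have := is_deriveB (is_deriveB d1 d2) d3.
have cg : {within `[0 : R, 1], continuous g}.
  by apply: derivable_within_continuous => x _; have [] := dg x.
have [t /[!in_itv]/= /andP[t0 t1] E] := MVT ltr01 (fun x _ => dg x) cg.
have h1 := hc t; rewrite (ltW t0) (ltW t1) in h1; have {}h1 := h1 isT.
by move: E; rewrite /g expr1n expr0n /= !mulr0 !mulr1 !subr0; lra.
Qed.

Lemma is_derive_line (m : nat) (F : 'cV[R]_m -> R) (x h : 'cV[R]_m) (t : R) :
  differentiable F (x + t *: h) ->
  is_derive t (1 : R) (fun t : R => F (x + t *: h)) (dot (grad F (x + t *: h)) h).
Proof.
move=> dF; rewrite -derive_dot_grad//.
have E : (fun s : R => s^-1 *: (((fun t : R => F (x + t *: h)) \o shift t) (s *: (1 : R))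
      - F (x + t *: h))) =
    (fun s : R => s^-1 *: ((F \o shift (x + t *: h)) (s *: h) - F (x + t *: h))).
  apply/funext => s; congr (_ *: (F _ - _)).
  by apply/matrixP => i j; rewrite !mxE /GRing.scale /=; ring.
have dFh : derivable F (x + t *: h) h by exact: diff_derivable.
by apply: DeriveDef; rewrite /derivable /derive E.
Qed.

(** The gradient is controlled only along the segment and only against [h], so that the same
    statement serves block-wise and global Lipschitz bounds. *)
Lemma descent (m : nat) (F : 'cV[R]_m -> R) (x h : 'cV[R]_m) (c : R) :
  (forall y, differentiable F y) ->
  (forall t, 0 <= t <= 1 ->
    dot (grad F (x + t *: h) - grad F x) h <= c * t) ->
  F (x + h) - F x - dot (grad F x) h <= c / 2.
Proof.
move=> dF hc.
have := descent_1d (c := c) (fun t => is_derive_line (dF (x + t *: h))).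
rewrite /= scale1r scale0r addr0; apply=> t t01.
by have := hc t t01; rewrite dotDl dotNl.
Qed.

Lemma descent_abs (m : nat) (F : 'cV[R]_m -> R) (x h : 'cV[R]_m) (c : R) :
  (forall y, differentiable F y) ->
  (forall t, 0 <= t <= 1 ->
    `|dot (grad F (x + t *: h) - grad F x) h| <= c * t) ->
  `|F (x + h) - F x - dot (grad F x) h| <= c / 2.
Proof.
move=> dF hc; rewrite ler_norml; apply/andP; split; last first.
  by apply: descent => // t t01; apply: le_trans (hc t t01); exact: ler_norm.
have dN (t : R) : is_derive t (1 : R) (fun t : R => - F (x + t *: h))
  (- dot (grad F (x + t *: h)) h) by exact: (is_deriveN (is_derive_line (dF _))).
have := descent_1d (c := c) dN.
rewrite /= scale1r scale0r addr0 => H.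
rewrite lerNl; apply: le_trans (H _); first by rewrite le_eqVlt; apply/orP; left; apply/eqP => /=; ring.
move=> t t01; have := hc t t01; rewrite dotDl dotNl ler_norml => /andP[h1 _].
lra.
Qed.

Lemma lipschitz_gradient_remainder (m : nat) (F : 'cV[R]_m -> R) (L : R)
    (x h : 'cV[R]_m) :
  0 <= L -> (forall y, differentiable F y) ->
  (forall x y, enorm (grad F x - grad F y) <= L * enorm (x - y)) ->
  `|F (x + h) - F x - dot (grad F x) h| <= L / 2 * enorm h ^+ 2.
Proof.
move=> L0 dF lF.
rewrite [leRHS](_ : _ = (L * enorm h ^+ 2) / 2); last by ring.
apply: descent_abs => // t /andP[t0 t1].
have hle : enorm (grad F (x + t *: h) - grad F x) <= L * (t * enorm h).
  apply: le_trans (lF _ _) _; rewrite addrC addKr enormZ ger0_norm//.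
have csN (v w : 'cV[R]_m) : `|dot v w| <= enorm v * enorm w.
  rewrite ler_norml cauchy_schwarz andbT lerNl -dotNl.
  by rewrite -[enorm v]enormN cauchy_schwarz.
apply: le_trans (csN _ _) _.
rewrite [leRHS](_ : _ = L * (t * enorm h) * enorm h); last by ring.
by rewrite ler_wpM2r// enorm_ge0.
Qed.

End Descent.

Section AlmostEverywhere.
Context (R : realType) (dO : measure_display) (Omega : measurableType dO).
Context (P : probability Omega R).
Implicit Types (X Y : Omega -> R) (x y : R).

(** Truncating [X] at [c] changes it on a null set only and turns the almost sure bound into one
    valid everywhere. *)
Lemma has_expectation_ae_le X x c : has_expectation P X x ->
  {ae P, forall w, X w <= c} -> x <= c.
Proof.
move=> hX Xc.
have mX := has_expectation_measurable hX.
pose Y w := Num.min (X w) c.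
have mY : measurable_fun setT Y by exact: measurable_minr.
have XY : (\int[P]_w (X w)%:E = \int[P]_w (Y w)%:E)%E.
  apply: ae_eq_integral => //; [exact/measurable_EFinP|exact/measurable_EFinP|].
  by apply: filterS Xc => w Xw _; rewrite /Y min_l.
have hY : has_expectation P Y x.
  split; last by rewrite expectationE -XY (has_expectation_integral hX).
  apply: (@le_integrable _ _ _ P setT measurableT (EFin \o Y)
    (EFin \o (fun w => Num.norm (X w) + `|c|))) => //.
  - exact/measurable_EFinP.
  - move=> w _ /=; rewrite lee_fin [leRHS]ger0_norm ?addr_ge0// /Y.
    case: (leP (X w) c) => _; first by rewrite lerDl.
    by rewrite lerDr.
  - have iN : P.-integrable setT (EFin \o (fun w => `|X w|)).
      by have [/integrable_abse] := hX.
    have [iC _] := has_expectation_cst P `|c|.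
    exact: (integrableD measurableT iN iC).
by apply: (has_expectation_le hY (has_expectation_cst P c)) => w; rewrite /Y ge_min lexx orbT.
Qed.

End AlmostEverywhere.

(** Cauchy-Schwarz with weights 1/4 + 1/2 + 1/4 = 1; the difference of the two sides is, coordinate
    by coordinate, (a + e - c)^2 + 2 (a - e)^2. *)
Lemma enorm_sqr_weighted3 (R : realType) (m : nat) (x y z : 'cV[R]_m) :
  enorm (x + y + z) ^+ 2 <=
    4 * enorm x ^+ 2 + 2 * enorm y ^+ 2 + 4 * enorm z ^+ 2.
Proof.
rewrite !enorm_sqrE !mulr_sumr -!big_split; apply: ler_sum => i _ /=.
rewrite !mxE; set a := x i 0; set c := y i 0; set e := z i 0.
have h1 : 0 <= (a + e - c) ^+ 2 by exact: sqr_ge0.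
have h2 : 0 <= (a - e) ^+ 2 by exact: sqr_ge0.
nra.
Qed.

(** * Zeroth-order gradients *)

Section SecondMoments.
Context (R : realType) (dO : measure_display) (Omega : measurableType dO).
Context (P : probability Omega R).
Implicit Types (X Y : Omega -> R) (x y : R).

Lemma has_expectation_unique X x y :
  has_expectation P X x -> has_expectation P X y -> x = y.
Proof. by move=> [_ Ex] [_]; rewrite Ex => -[]. Qed.

Lemma sqr_expectation_le X x y : has_expectation P X x ->
  has_expectation P (fun w => X w ^+ 2) y -> x ^+ 2 <= y.
Proof.
move=> hx hy.
have h := has_expectationD (has_expectationD hy (has_expectationZ (- 2 * x) hx))
  (has_expectation_cst P (x ^+ 2)).
have := has_expectation_le (has_expectation_cst P 0) h.
have E w : X w ^+ 2 + - 2 * x * X w + x ^+ 2 = (X w - x) ^+ 2 by ring.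
move=> H; have {H} : 0 <= y + - 2 * x * x + x ^+ 2.
  by apply: H => w; rewrite E sqr_ge0.
nra.
Qed.

Lemma has_expectation_sqr_first X y : measurable_fun setT X ->
  has_expectation P (fun w => X w ^+ 2) y -> exists x, has_expectation P X x.
Proof.
move=> mX hy.
apply: has_expectation_dominated mX (has_expectationD (has_expectation_cst P 1) hy) _.
move=> w; set a := X w; rewrite ler_norml; apply/andP; split; nra.
Qed.

(** Variances of uncorrelated variables add: after expansion of the square the off-diagonal terms
    have mean zero. *)
Lemma expectation_sqr_sum (N : nat) (X : 'I_N -> Omega -> R) (m q : 'I_N -> R) :
  (forall t, has_expectation P (X t) (m t)) ->
  (forall t, has_expectation P (fun w => X t w ^+ 2) (q t)) ->
  (forall s t, s != t ->
    has_expectation P (fun w => X s w * X t w) (m s * m t)) ->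
  has_expectation P (fun w => (\sum_t (X t w - m t)) ^+ 2)
    (\sum_t (q t - m t ^+ 2)).
Proof.
move=> hm hq hst.
have hY s t : has_expectation P (fun w => (X s w - m s) * (X t w - m t))
    (if s == t then q s - m s ^+ 2 else 0).
  have hc : has_expectation P (fun w => X s w * X t w)
      (if s == t then q s else m s * m t).
    case: eqP => [<-|/eqP/hst//].
    by apply: has_expectation_ext (hq s) => // w; rewrite expr2.
  have := has_expectationD (has_expectationD (has_expectationD hc
    (has_expectationZ (- m s) (hm t))) (has_expectationZ (- m t) (hm s)))
    (has_expectation_cst P (m s * m t)).
  by apply: has_expectation_ext => [w|]; [ring|case: eqP => [->|_]; ring].
have := has_expectation_sum (index_enum _)
  (fun s => has_expectation_sum (index_enum _) (fun t => hY s t)).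
apply: has_expectation_ext => [w|].
  rewrite expr2 mulr_suml; apply: eq_bigr => s _.
  by rewrite mulr_sumr.
apply: eq_bigr => s _.
by rewrite (bigD1 s)//= eqxx big1 ?addr0// => t /negbTE; rewrite eq_sym => ->.
Qed.

Lemma markov_ge (X : Omega -> R) x c : measurable_fun setT X ->
  (forall w, 0 <= X w) -> 0 < c -> (\int[P]_w (X w)%:E <= x%:E)%E ->
  (P [set w | (c <= X w)%R] <= (x / c)%:E)%E.
Proof.
move=> mX X0 c0 EX.
have mX' : measurable_fun setT (EFin \o X) by exact/measurable_EFinP.
have := le_integral_abse P measurableT mX' c0.
have -> : [set: Omega] `&` [set w | (c%:E <= `|(EFin \o X) w|)%E] =
    [set w | (c <= X w)%R].
  by apply/seteqP; split => w /=; rewrite ?lee_fin ger0_norm// => -[].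
under eq_integral => w _ do rewrite /= ger0_norm//.
move=> /le_trans /(_ EX) H.
have mE : measurable [set w | (c <= X w)%R].
  rewrite (_ : [set w | _] = X @^-1` `[c, +oo[).
    by rewrite -[X in measurable X]setTI; exact: mX.
  by apply/seteqP; split => w /=; rewrite in_itv/= andbT.
have Pfin := fin_num_measure P _ mE.
rewrite -(fineK Pfin) lee_fin ler_pdivlMr// mulrC -lee_fin EFinM fineK//.
Qed.

End SecondMoments.

Section ZeroOrderMeasurability.
Context (R : realType) (b : nat) (ds : 'I_b -> nat).
Local Notation n := (\sum_(s < b) ds s)%N.
Context (dXi : measure_display) (Xi : measurableType dXi).
Context (F : 'cV[R]_n -> Xi -> R) (mu : R).
Hypothesis mF : measurable_fun setT (fun q : borel R n * Xi => F q.1 q.2).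
Context (d : measure_display) (T : measurableType d).

Lemma measurable_oracle (x : T -> borel R n) (z : T -> Xi) :
  measurable_fun setT x -> measurable_fun setT z ->
  measurable_fun setT (fun t => F (x t) (z t)).
Proof.
move=> mx mz; apply: (measurableT_comp mF (g := fun t => (x t, z t))).
exact/measurable_fun_pair.
Qed.

Lemma measurable_zo_gradient (x u : T -> borel R n) (z : T -> Xi) :
  measurable_fun setT x -> measurable_fun setT z -> measurable_fun setT u ->
  @measurable_fun _ _ T (borel R n) setT
    (fun t => zo_gradient F mu (x t) (z t) (u t)).
Proof.
move=> mx mz mu_; rewrite /zo_gradient; apply: measurable_vecZ => //.
apply: measurable_funM; last exact: measurable_cst.
apply: measurable_funB; last exact: measurable_oracle.
apply: (measurable_oracle (x := fun t => (x t : 'cV[R]_n) + mu *: (u t : 'cV[R]_n))) => //.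
apply: measurable_vecD => //; apply: measurable_vecZ => //; exact: measurable_cst.
Qed.

Lemma measurable_zo_average (N : nat) (x : T -> borel R n)
    (u : nat -> T -> borel R n) (z : nat -> T -> Xi) :
  measurable_fun setT x -> (forall t, (t < N)%N -> measurable_fun setT (z t)) ->
  (forall t, (t < N)%N -> measurable_fun setT (u t)) ->
  @measurable_fun _ _ T (borel R n) setT
    (fun w => zo_average F mu N (x w) (z^~ w) (u^~ w)).
Proof.
move=> mx mz mu_; rewrite /zo_average.
apply: (measurable_vecZ (a := cst N%:R^-1)); first exact: measurable_cst.
apply: measurable_vec_sum => t.
by apply: measurable_zo_gradient => //; [exact: mz|exact: mu_].
Qed.

End ZeroOrderMeasurability.

(** * One oracle call at a fixed point *)

Section FixedPoint.
Context (R : realType) (b : nat) (ds : 'I_b -> nat).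
Local Notation n := (\sum_(s < b) ds s)%N.
Context (dXi : measure_display) (Xi : measurableType dXi).
Context (Pxi : probability Xi R) (F : 'cV[R]_n -> Xi -> R) (f : 'cV[R]_n -> R).
Context (mu Lf sigma M : R) (x : 'cV[R]_n).
Hypothesis mF : measurable_fun setT (fun q : borel R n * Xi => F q.1 q.2).
Hypothesis mu0 : 0 < mu.
Hypothesis Lf0 : 0 < Lf.
Hypothesis hgrad : forall i,
  has_expectation Pxi (fun z => grad (F^~ z) x i 0) (grad f x i 0).
Hypothesis hvar : ('E_Pxi[fun z => (enorm (grad (F^~ z) x - grad f x) ^+ 2)%R]
  <= (sigma ^+ 2)%:E)%E.
Hypothesis hM : enorm (grad f x) <= M.
Hypothesis hLip : {ae Pxi, forall z,
  (forall y, differentiable (F^~ z) y) /\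
  (forall y y', enorm (grad (F^~ z) y - grad (F^~ z) y') <= Lf * enorm (y - y'))}.

(** Bounds the second moment of one gradient estimate about 0, hence also its variance: 4 (n + 2)
    M^2 from the exact gradient, 2 (n + 2) sigma^2 from the oracle noise, and four times
    [zo_bias_bound] from the Taylor remainder. *)
Definition zo_variance_bound : R :=
  (n%:R + 2) * (4 * M ^+ 2 + 2 * sigma ^+ 2) + Lf ^+ 2 * mu ^+ 2 * n.+4%:R ^+ 3.

(** The remainder is at most Lf mu |u|^3 / 2, and the sixth moment of |u| is n (n + 2) (n + 4) <= (n
    + 4)^3. By Jensen this also bounds the squared bias. *)
Definition zo_bias_bound : R := Lf ^+ 2 * mu ^+ 2 / 4 * n.+4%:R ^+ 3.

Section OneSample.
Context (dO : measure_display) (Omega : measurableType dO).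
Context (P : probability Omega R).
Context (u : {RV P >-> borel R n}) (xi : {RV P >-> Xi}).
Hypothesis gu : standard_gaussian u.
Hypothesis lxi : has_law xi Pxi.
Hypothesis ind : independent_systems P (sigma_of xi) (sigma_of u).

Local Notation vec w := (u w : 'cV[R]_n).
Let dF w := grad (F^~ (xi w)) x.
Let G w := zo_gradient F mu x (xi w) (u w).
(** The first-order Taylor remainder of the sampled function in the direction [mu *: u], divided by
    [mu] and multiplied by [u]. *)
Let rem w := G w - dot (dF w) (vec w) *: vec w.

Let measurable_dFz :
  @measurable_fun _ _ Xi (borel R n) setT (fun z => grad (F^~ z) x).
Proof.
by apply: measurable_to_borel => i; exact: has_expectation_measurable (hgrad i).
Qed.

Let mxi : measurable_fun setT xi. Proof. exact: measurable_funPT. Qed.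
Let mu_ : measurable_fun setT u. Proof. exact: measurable_funPT. Qed.

Let mdF : @measurable_fun _ _ Omega (borel R n) setT dF.
Proof. exact: (measurableT_comp measurable_dFz mxi). Qed.

Let mG : @measurable_fun _ _ Omega (borel R n) setT G.
Proof.
by apply: (measurable_zo_gradient mu mF (x := cst x)).
Qed.

Let mrem : @measurable_fun _ _ Omega (borel R n) setT rem.
Proof.
apply: measurable_vecB => //; apply: measurable_vecZ => //.
exact: measurable_dot.
Qed.

Lemma ae_law (Q : Xi -> Prop) : {ae Pxi, forall z, Q z} -> {ae P, forall w, Q (xi w)}.
Proof.
move=> [A [mA A0 QA]]; exists (xi @^-1` A); split.
- by rewrite -[X in measurable X]setTI; exact: mxi.
- by have := lxi mA; rewrite A0.
- by move=> w /= Qw; apply: QA.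
Qed.

Lemma integral_law (g : Xi -> \bar R) : measurable_fun setT g ->
  (forall z, (0 <= g z)%E) -> (\int[P]_w g (xi w) = \int[Pxi]_z g z)%E.
Proof.
move=> mg g0.
transitivity (\int[distribution P xi]_z g z)%E.
  by rewrite ge0_integral_distribution.
by apply: eq_measure_integral => A mA _; exact: lxi.
Qed.

Lemma has_expectation_law (X : Xi -> R) c : has_expectation Pxi X c ->
  has_expectation P (fun w => X (xi w)) c.
Proof.
move=> hX; have mX := has_expectation_measurable hX.
have [iX _] := hX.
have EX := has_expectation_integral hX.
have iX' : (distribution P xi).-integrable setT (EFin \o X).
  apply/integrableP; split; first exact/measurable_EFinP.
  move/integrableP: iX => [_].
  rewrite (_ : \int[Pxi]_z _ = \int[distribution P xi]_z `|(EFin \o X) z|)%E//.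
  by apply: eq_measure_integral => A mA _; symmetry; exact: lxi.
have iXP : P.-integrable setT (fun w => (X (xi w))%:E).
  apply/integrableP; split.
    by apply/measurable_EFinP; exact: (measurableT_comp mX mxi).
  have := integrableP _ _ _ iX' => -[_].
  rewrite ge0_integral_distribution//.
  by apply: measurableT_comp => //; exact/measurable_EFinP.
split => //; rewrite expectationE -EX.
transitivity (\int[distribution P xi]_z (X z)%:E)%E.
  by rewrite integral_distribution//; exact/measurable_EFinP.
by apply: eq_measure_integral => A mA _; exact: lxi.
Qed.

(** Sample and direction are decoupled: with the sample frozen the Gaussian integral gives (n + 2)
    times the squared noise, which is then averaged over the sample. *)
Lemma noise_second_moment : (\int[P]_w
   (dot (dF w - grad f x) (vec w) ^+ 2 * enorm (vec w) ^+ 2)%:E <=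
   ((n%:R + 2) * sigma ^+ 2)%:E)%E.
Proof.
have [Sx Su] := (@sigma_of_sigma_algebra _ Omega _ _ xi, @sigma_of_sigma_algebra _ Omega _ _ u).
pose T1 := g_sigma_algebraType (sigma_of xi).
pose T2 := g_sigma_algebraType (sigma_of u).
have mxi1 : @measurable_fun _ _ T1 Xi setT xi.
  by apply: sigma_of_measurable; exact: sub_sigma_algebra.
have mu2 : @measurable_fun _ _ T2 (borel R n) setT u.
  by apply: sigma_of_measurable; exact: sub_sigma_algebra.
pose h (q : T1 * T2) : \bar R := (dot (grad (F^~ (xi q.1)) x - grad f x) (vec q.2) ^+ 2
  * enorm (vec q.2) ^+ 2)%:E.
have mh : measurable_fun [set: T1 * T2] h.
  apply/measurable_EFinP.
  have mA : @measurable_fun _ _ (T1 * T2)%type (borel R n) setT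
      (fun q => grad (F^~ (xi q.1)) x - grad f x).
    apply: (measurable_vecB (Y := cst (grad f x))); last exact: measurable_cst.
    apply: (measurableT_comp measurable_dFz).
    exact: (measurableT_comp mxi1).
  have mV : @measurable_fun _ _ (T1 * T2)%type (borel R n) setT (fun q => u q.2).
    exact: (measurableT_comp mu2).
  apply: measurable_funM; apply: measurable_funX.
    exact: measurable_dot.
  exact: measurable_enorm.
rewrite (decoupling (S1 := sigma_of xi) (S2 := sigma_of u) _ _ _ mh).
- have inner w : (\int[P]_w' h (w, w') = ((n%:R + 2) *
      enorm (grad (F^~ (xi w)) x - grad f x) ^+ 2)%:E)%E.
    rewrite -(has_expectation_integral
      (gaussian_dot_sqr_enorm gu (grad (F^~ (xi w)) x - grad f x))).
    by apply: eq_integral => w' _.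
  under eq_integral => w _ do rewrite inner.
  have mg : measurable_fun [set: Xi] (fun z => enorm (grad (F^~ z) x - grad f x) ^+ 2).
    apply: measurable_funX; apply: measurable_enorm.
    by apply: (measurable_vecB (Y := cst (grad f x))) => //; exact: measurable_cst.
  rewrite (integral_law (g := fun z => ((n%:R + 2) *
    enorm (grad (F^~ z) x - grad f x) ^+ 2)%:E)).
  + under eq_integral => z _ do rewrite EFinM.
    rewrite ge0_integralZl_EFin//.
    * rewrite EFinM lee_wpmul2l ?lee_fin ?addr_ge0//.
      by rewrite -expectationE.
    * by move=> z _; rewrite lee_fin sqr_ge0.
    * exact/measurable_EFinP.
  + by apply/measurable_EFinP; apply: measurable_funM => //; exact: measurable_cst.
  + by move=> z; rewrite lee_fin mulr_ge0 ?sqr_ge0// addr_ge0.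
- by rewrite (sigma_algebra_id Sx); exact: sigma_of_sub.
- by rewrite (sigma_algebra_id Su); exact: sigma_of_sub.
- by rewrite (sigma_algebra_id Sx) (sigma_algebra_id Su).
- by move=> q; rewrite lee_fin mulr_ge0// sqr_ge0.
Qed.

Let sqr_rem w :
  (forall y, differentiable (F^~ (xi w)) y) /\
  (forall y y', enorm (grad (F^~ (xi w)) y - grad (F^~ (xi w)) y') <= Lf * enorm (y - y')) ->
  enorm (rem w) ^+ 2 <= Lf ^+ 2 * mu ^+ 2 / 4 * enorm (vec w) ^+ 6.
Proof.
move=> [dz Lz].
have H := lipschitz_gradient_remainder x (mu *: vec w) (ltW Lf0) dz Lz.
rewrite enormZ (gtr0_norm mu0) dotZr -/(dF w) in H.
have -> : rem w = ((F (x + mu *: vec w) (xi w) - F x (xi w)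
    - mu * dot (dF w) (vec w)) / mu) *: vec w.
  apply/matrixP => i j; rewrite /rem /G /zo_gradient !mxE.
  by field; rewrite gt_eqF.
move: H; set D := _ - _ * _; set e := enorm (vec w) => H.
rewrite enormZ -/e exprMn real_normK ?num_real// expr_div_n.
have -> : Lf ^+ 2 * mu ^+ 2 / 4 * e ^+ 6 =
    (Lf / 2 * (mu * e) ^+ 2) ^+ 2 / mu ^+ 2 * e ^+ 2.
  by field; rewrite gt_eqF.
rewrite ler_wpM2r ?sqr_ge0// ler_wpM2r ?invr_ge0 ?sqr_ge0//.
rewrite -[leLHS]real_normK ?num_real// ler_pXn2r ?nnegrE//.
by rewrite mulr_ge0 ?sqr_ge0// divr_ge0// ltW.
Qed.

Lemma remainder_second_moment :
  (\int[P]_w (enorm (rem w) ^+ 2)%:E <= (zo_bias_bound)%:E)%E.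
Proof.
have c0 : 0 <= Lf ^+ 2 * mu ^+ 2 / 4 by rewrite divr_ge0// mulr_ge0// sqr_ge0.
have h6 := has_expectationZ (Lf ^+ 2 * mu ^+ 2 / 4) (gaussian_enorm6 gu).
apply: (@le_trans _ _ (\int[P]_w (Lf ^+ 2 * mu ^+ 2 / 4 * enorm (vec w) ^+ 6)%:E)%E).
  apply: ae_ge0_le_integral => //.
  - by move=> w _; rewrite lee_fin sqr_ge0.
  - by apply/measurable_EFinP; apply: measurable_funX; exact: measurable_enorm.
  - by move=> w _; rewrite lee_fin mulr_ge0// exprn_even_ge0.
  - by apply/measurable_EFinP; exact: has_expectation_measurable h6.
  - apply: filterS (ae_law hLip) => w Hw _; rewrite lee_fin; exact: sqr_rem.
rewrite (has_expectation_integral h6) lee_fin /zo_bias_bound ler_wpM2l//.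
have -> : n.+4%:R = n%:R + 4 :> R by rewrite -addn4 natrD.
have n0 : 0 <= n%:R :> R by [].
set a := n%:R; nra.
Qed.

(* The gradient is <grad f, u> u + <grad F - grad f, u> u + rem, and the three
   terms are weighted by 4, 2, 4. *)
Lemma zo_gradient_second_moment :
  exists2 v, has_expectation P (fun w => enorm (G w) ^+ 2) v &
    v <= zo_variance_bound.
Proof.
have h1 := gaussian_dot_sqr_enorm gu (grad f x).
have m2 : measurable_fun setT
    (fun w => dot (dF w - grad f x) (vec w) ^+ 2 * enorm (vec w) ^+ 2).
  apply: measurable_funM; apply: measurable_funX; last exact: measurable_enorm.
  apply: measurable_dot => //.
  by apply: (measurable_vecB (Y := cst (grad f x))) => //; exact: measurable_cst.
have p2 w : 0 <= dot (dF w - grad f x) (vec w) ^+ 2 * enorm (vec w) ^+ 2.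
  by rewrite mulr_ge0// sqr_ge0.
have [v2 h2 v2le] := has_expectation_ge0_le m2 p2 noise_second_moment.
have m3 : measurable_fun setT (fun w => enorm (rem w) ^+ 2).
  by apply: measurable_funX; exact: measurable_enorm.
have [v3 h3 v3le] := has_expectation_ge0_le m3
  (fun w => sqr_ge0 (enorm (rem w))) remainder_second_moment.
have h := has_expectationD (has_expectationD (has_expectationZ 4 h1)
  (has_expectationZ 2 h2)) (has_expectationZ 4 h3).
have GE w : G w = dot (grad f x) (vec w) *: vec w
    + dot (dF w - grad f x) (vec w) *: vec w + rem w.
  by apply/matrixP => i j; rewrite /rem dotDl dotNl !mxE; ring.
have normZ (c : R) (y : 'cV[R]_n) : enorm (c *: y) ^+ 2 = c ^+ 2 * enorm y ^+ 2.
  by rewrite enormZ exprMn real_normK ?num_real.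
have Gle w : enorm (G w) ^+ 2 <= 4 * (dot (grad f x) (vec w) ^+ 2 * enorm (vec w) ^+ 2)
    + 2 * (dot (dF w - grad f x) (vec w) ^+ 2 * enorm (vec w) ^+ 2)
    + 4 * enorm (rem w) ^+ 2.
  rewrite {1}GE -!normZ; exact: enorm_sqr_weighted3.
have Gle' w : `|enorm (G w) ^+ 2| <= 4 * (dot (grad f x) (vec w) ^+ 2 * enorm (vec w) ^+ 2)
    + 2 * (dot (dF w - grad f x) (vec w) ^+ 2 * enorm (vec w) ^+ 2)
    + 4 * enorm (rem w) ^+ 2.
  by rewrite ger0_norm ?sqr_ge0.
have [v hv] := has_expectation_dominated
  (measurable_funX 2 (measurable_enorm mG)) h Gle'.
exists v => //; apply: le_trans (has_expectation_le hv h Gle) _.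
have h1' : 4 * ((n%:R + 2) * enorm (grad f x) ^+ 2) <= 4 * ((n%:R + 2) * M ^+ 2).
  rewrite ler_wpM2l// ler_wpM2l ?addr_ge0// ler_pXn2r ?nnegrE ?enorm_ge0//.
  exact: le_trans (enorm_ge0 _) hM.
move: v3le; rewrite /zo_bias_bound /zo_variance_bound; lra.
Qed.

(** The mean of <grad F, u> u is grad f, because sample and direction are independent and u has
    identity covariance. The bias is thus the mean of [rem], and Jensen is applied coordinate by
    coordinate. *)
Lemma zo_gradient_mean : exists2 m : 'cV[R]_n,
  (forall j, has_expectation P (fun w => G w j 0) (m j 0)) &
  enorm (m - grad f x) ^+ 2 <= zo_bias_bound.
Proof.
have [v hv _] := zo_gradient_second_moment.
have mGj j : measurable_fun setT (fun w => G w j 0).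
  by have /measurable_borelP := mG.
have coord_le (y : 'cV[R]_n) j : `|y j 0 ^+ 2| <= enorm y ^+ 2.
  rewrite ger0_norm ?sqr_ge0// enorm_sqrE (bigD1 j)//= lerDl.
  by rewrite sumr_ge0// => k _; exact: sqr_ge0.
have hG j : exists c, has_expectation P (fun w => G w j 0) c.
  have [q hq] := has_expectation_dominated (measurable_funX 2 (mGj j)) hv
    (fun w => coord_le (G w) j).
  exact: has_expectation_sqr_first (mGj j) hq.
have [m hm] : exists m : 'cV[R]_n,
    forall j, has_expectation P (fun w => G w j 0) (m j 0).
  have [c hc] := choice hG.
  by exists (\col_j c j) => j; rewrite mxE.
exists m => //.
have hlin j : has_expectation P (fun w => dot (dF w) (vec w) * vec w j 0) (grad f x j 0).
  have hij i : has_expectation P (fun w => dF w i 0 * (vec w i 0 * vec w j 0))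
      (grad f x i 0 * (i == j)%:R).
    have [Sx Su] := (@sigma_of_sigma_algebra _ Omega _ _ xi,
      @sigma_of_sigma_algebra _ Omega _ _ u).
    have mu2 : @measurable_fun _ _ (g_sigma_algebraType (sigma_of u)) (borel R n) setT u.
      by apply: sigma_of_measurable; exact: sub_sigma_algebra.
    have mxi1 : @measurable_fun _ _ (g_sigma_algebraType (sigma_of xi)) Xi setT xi.
      by apply: sigma_of_measurable; exact: sub_sigma_algebra.
    apply: (@has_expectationM R _ Omega P (sigma_of xi) (sigma_of u)).
    - by rewrite (sigma_algebra_id Sx); exact: sigma_of_sub.
    - by rewrite (sigma_algebra_id Su); exact: sigma_of_sub.
    - by rewrite (sigma_algebra_id Sx) (sigma_algebra_id Su).
    - apply: (measurableT_comp (f := fun z => grad (F^~ z) x i 0)) => //.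
      exact: has_expectation_measurable (hgrad i).
    - by move/measurable_borelP: mu2 => mu2; apply: measurable_funM; exact: mu2.
    - exact: has_expectation_law (hgrad i).
    - exact: gaussian_coordM.
  have := has_expectation_sum (index_enum _) hij.
  apply: has_expectation_ext => [w|].
    by rewrite dotE mulr_suml; apply: eq_bigr => i _; rewrite mulrA.
  rewrite (bigD1 j)//= eqxx mulr1 [X in _ + X]big1 ?addr0// => i /negbTE ->.
  by rewrite mulr0.
have m3 : measurable_fun setT (fun w => enorm (rem w) ^+ 2).
  by apply: measurable_funX; exact: measurable_enorm.
have [v3 h3 v3le] := has_expectation_ge0_le m3
  (fun w => sqr_ge0 (enorm (rem w))) remainder_second_moment.
apply: le_trans v3le.
have mremj j : measurable_fun setT (fun w => rem w j 0).
  by have /measurable_borelP := mrem.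
have hrem j : has_expectation P (fun w => rem w j 0) (m j 0 - grad f x j 0).
  have := has_expectationB (hm j) (hlin j).
  by apply: has_expectation_ext => [w|//]; rewrite /rem !mxE.
have /choice[q hq] j : exists q, has_expectation P (fun w => rem w j 0 ^+ 2) q.
  exact: (has_expectation_dominated (measurable_funX 2 (mremj j)) h3
    (fun w => coord_le (rem w) j)).
have hsum := has_expectation_sum (index_enum _) hq.
have -> : v3 = \sum_j q j.
  apply: has_expectation_unique h3 _.
  by apply: has_expectation_ext hsum => // w; rewrite enorm_sqrE.
rewrite enorm_sqrE; apply: ler_sum => j _.
have -> : (m - grad f x) j 0 = m j 0 - grad f x j 0 by rewrite !mxE.
exact: sqr_expectation_le (hrem j) (hq j).
Qed.

End OneSample.
End FixedPoint.

Lemma enorm_sqrD_le (R : realType) (m : nat) (x y : 'cV[R]_m) :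
  enorm (x + y) ^+ 2 <= 2 * enorm x ^+ 2 + 2 * enorm y ^+ 2.
Proof.
by have := sqr_ge0 (enorm (x - y)); rewrite !enorm_sqrD dotNr enormN; lra.
Qed.

(** * Batch averages at a fixed point *)

Section Averages.
Context (R : realType) (b : nat) (ds : 'I_b -> nat).
Local Notation n := (\sum_(s < b) ds s)%N.
Context (dXi : measure_display) (Xi : measurableType dXi).
Context (Pxi : probability Xi R) (F : 'cV[R]_n -> Xi -> R) (f : 'cV[R]_n -> R).
Context (mu Lf sigma M : R) (x : 'cV[R]_n).
Hypothesis mF : measurable_fun setT (fun q : borel R n * Xi => F q.1 q.2).
Hypothesis mu0 : 0 < mu.
Hypothesis Lf0 : 0 < Lf.
Hypothesis hgrad : forall i,
  has_expectation Pxi (fun z => grad (F^~ z) x i 0) (grad f x i 0).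
Hypothesis hvar : ('E_Pxi[fun z => (enorm (grad (F^~ z) x - grad f x) ^+ 2)%R]
  <= (sigma ^+ 2)%:E)%E.
Hypothesis hM : enorm (grad f x) <= M.
Hypothesis hLip : {ae Pxi, forall z,
  (forall y, differentiable (F^~ z) y) /\
  (forall y y', enorm (grad (F^~ z) y - grad (F^~ z) y') <= Lf * enorm (y - y'))}.

Local Notation V0 := (zo_variance_bound ds mu Lf sigma M).
Local Notation B0 := (zo_bias_bound ds mu Lf).

Context (dO : measure_display) (Omega : measurableType dO).
Context (P : probability Omega R) (N : nat).
Context (u : nat -> {RV P >-> borel R n}) (xi : nat -> {RV P >-> Xi}).
Hypothesis N0 : (0 < N)%N.
Hypothesis gu : forall t, (t < N)%N -> standard_gaussian (u t).
Hypothesis lxi : forall t, (t < N)%N -> has_law (xi t) Pxi.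
Hypothesis ind : forall t, (t < N)%N ->
  independent_systems P (sigma_of (xi t)) (sigma_of (u t)).
Local Notation sample t := (sigma_of (xi t) `|` sigma_of (u t)).
Hypothesis ind2 : forall s t, (s < N)%N -> (t < N)%N -> s != t ->
  independent_systems P <<s sample s >> <<s sample t >>.

Let G (t : 'I_N) w := zo_gradient F mu x (xi t w) (u t w).
Let avg w := zo_average F mu N x (xi^~ w) (u^~ w).

Let sample_measurable t : <<s sample t >> `<=` measurable.
Proof.
apply: smallest_sub; first exact: sigma_algebra_measurable.
by rewrite subUset; split; apply: sigma_of_sub; exact: measurable_funPT.
Qed.

Let mGs (t : 'I_N) :
  @measurable_fun _ _ (g_sigma_algebraType (sample t)) (borel R n) setT (G t).
Proof.
apply: (measurable_zo_gradient mu mF (x := cst x)).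
- exact: measurable_cst.
- by apply: sigma_of_measurable => A HA; apply: sub_sigma_algebra; left.
- by apply: sigma_of_measurable => A HA; apply: sub_sigma_algebra; right.
Qed.

Let mG (t : 'I_N) : @measurable_fun _ _ Omega (borel R n) setT (G t).
Proof.
by move=> _ B mB; rewrite setTI; apply: (@sample_measurable t);
  have := @mGs t measurableT _ mB; rewrite setTI.
Qed.

Lemma zo_variance_bound_gt0 : 0 < V0.
Proof.
rewrite /zo_variance_bound ltr_wpDl//; last first.
  by apply: mulr_gt0; rewrite ?exprn_gt0//; apply: mulr_gt0; rewrite exprn_gt0.
by rewrite mulr_ge0// addr_ge0// mulr_ge0// sqr_ge0.
Qed.

(** Centring at the mean [m] instead of the gradient separates the fluctuation, which improves with
    the batch size by pairwise independence, from the bias, which does not. *)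
Lemma zo_average_centered : exists2 m : 'cV[R]_n,
  enorm (m - grad f x) ^+ 2 <= B0 &
  (\int[P]_w (enorm (avg w - m) ^+ 2)%:E <= (V0 / N%:R)%:E)%E.
Proof.
have mean (t : 'I_N) := zo_gradient_mean mF mu0 Lf0 hgrad hvar hM hLip (gu (ltn_ord t))
  (lxi (ltn_ord t)) (ind (ltn_ord t)).
have second (t : 'I_N) := zo_gradient_second_moment mF mu0 Lf0 hgrad hvar hM hLip
  (gu (ltn_ord t)) (lxi (ltn_ord t)) (ind (ltn_ord t)).
have /choice[m hm] (t : 'I_N) : exists m : 'cV[R]_n,
    (forall j, has_expectation P (fun w => G t w j 0) (m j 0)) /\
    enorm (m - grad f x) ^+ 2 <= B0.
  by have [m h1 h2] := mean t; exists m.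
have /choice[v hv] (t : 'I_N) : exists v,
    has_expectation P (fun w => enorm (G t w) ^+ 2) v /\ v <= V0.
  by have [v h1 h2] := second t; exists v.
have coord_le (y : 'cV[R]_n) j : `|y j 0 ^+ 2| <= enorm y ^+ 2.
  rewrite ger0_norm ?sqr_ge0// enorm_sqrE (bigD1 j)//= lerDl.
  by rewrite sumr_ge0// => k _; exact: sqr_ge0.
have mGj (t : 'I_N) j : measurable_fun setT (fun w => G t w j 0).
  by have /measurable_borelP := @mG t.
have /choice[q hq] (tj : 'I_N * 'I_n) : exists q,
    has_expectation P (fun w => G tj.1 w tj.2 0 ^+ 2) q.
  exact: (has_expectation_dominated (measurable_funX 2 (mGj tj.1 tj.2))
    (hv tj.1).1 (fun w => coord_le (G tj.1 w) tj.2)).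
have vE t : v t = \sum_j q (t, j).
  apply: has_expectation_unique (hv t).1 _.
  have := has_expectation_sum (index_enum _) (fun j => hq (t, j)).
  by apply: has_expectation_ext => // w; rewrite enorm_sqrE.
have cross (j : 'I_n) (s t : 'I_N) : s != t ->
    has_expectation P (fun w => G s w j 0 * G t w j 0) (m s j 0 * m t j 0).
  move=> st; apply: (@has_expectationM R _ Omega P (sample s) (sample t)) => //.
  - exact: ind2.
  - by have /measurable_borelP := @mGs s.
  - by have /measurable_borelP := @mGs t.
  - exact: (hm s).1.
  - exact: (hm t).1.
have hcoord j := expectation_sqr_sum (fun t => (hm t).1 j) (fun t => hq (t, j)) (cross j).
have hS := has_expectationZ (N%:R ^- 2) (has_expectation_sum (index_enum _) hcoord).
have NR0 : 0 < N%:R :> R by rewrite ltr0n.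
(* The means are chosen separately for each sample, hence their average; the triangle inequality
   keeps its bias below [B0]. *)
pose mbar := N%:R^-1 *: \sum_t m t.
exists mbar.
  have B0ge : 0 <= B0 by apply: le_trans (hm (Ordinal N0)).2; exact: sqr_ge0.
  rewrite -(sqr_sqrtr B0ge) ler_pXn2r ?nnegrE ?enorm_ge0 ?sqrtr_ge0//.
  have -> : mbar - grad f x = N%:R^-1 *: \sum_t (m t - grad f x).
    rewrite sumrB sumr_const card_ord scalerBr -[grad f x *+ N]scaler_nat scalerA mulVf ?scale1r//.
    by rewrite gt_eqF.
  rewrite enormZ ger0_norm ?invr_ge0// ler_pdivrMl//.
  have triangle (I : Type) (s : seq I) (y : I -> 'cV[R]_n) :
      enorm (\sum_(i <- s) y i) <= \sum_(i <- s) enorm (y i).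
    elim: s => [|i s IH]; first by rewrite !big_nil enorm0.
    by rewrite !big_cons (le_trans (enorm_triangle _ _))// lerD2l.
  apply: le_trans (triangle _ _ _) _.
  apply: (@le_trans _ _ (\sum_(t < N) Num.sqrt B0)).
    apply: ler_sum => t _.
    rewrite -(@ler_pXn2r _ 2) ?nnegrE ?enorm_ge0 ?sqrtr_ge0//.
    by rewrite (sqr_sqrtr B0ge); exact: (hm t).2.
  by rewrite sumr_const card_ord mulr_natl.
have avgE w : N%:R ^- 2 * (\sum_j (\sum_t (G t w j 0 - m t j 0)) ^+ 2) =
    enorm (avg w - mbar) ^+ 2.
  have -> : avg w - mbar = N%:R^-1 *: \sum_t (G t w - m t).
    by rewrite /avg /zo_average /mbar -scalerBr sumrB.
  rewrite enormZ exprMn real_normK ?num_real// exprVn enorm_sqrE; congr (_ * _).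
  apply: eq_bigr => j _; rewrite summxE; congr (_ ^+ 2).
  by apply: eq_bigr => t _; rewrite !mxE.
under eq_integral => w _ do rewrite -avgE.
rewrite (has_expectation_integral hS) lee_fin.
apply: (@le_trans _ _ (N%:R ^- 2 * \sum_(t < N) V0)).
  rewrite ler_wpM2l ?invr_ge0 ?sqr_ge0// exchange_big; apply: ler_sum => t _ /=.
  apply: le_trans (hv t).2; rewrite vE; apply: ler_sum => j _.
  by rewrite gerBl sqr_ge0.
rewrite sumr_const card_ord -mulr_natr le_eqVlt; apply/orP; left.
by apply/eqP; field; rewrite gt_eqF.
Qed.

Let measurable_avg_deviation m :
  measurable_fun setT (fun w => enorm (avg w - m) ^+ 2).
Proof.
apply: measurable_funX; apply: measurable_enorm.
apply: (measurable_vecB (Y := cst m)); last exact: measurable_cst.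
by apply: (measurable_zo_average mu mF (x := cst x)) => // t _;
  exact: measurable_funPT.
Qed.

Let avg_triangle m w : enorm (m - grad f x) ^+ 2 <= B0 ->
  enorm (avg w - grad f x) ^+ 2 <= 2 * enorm (avg w - m) ^+ 2 + 2 * B0.
Proof.
move=> mle; rewrite -[avg w - grad f x](subrKA m).
apply: le_trans (enorm_sqrD_le _ _) _; lra.
Qed.

Lemma zo_average_second_moment :
  (\int[P]_w (enorm (avg w - grad f x) ^+ 2)%:E <=
   (2 * (V0 / N%:R) + 2 * B0)%:E)%E.
Proof.
have [m mle hm] := zo_average_centered.
have mm := measurable_avg_deviation m.
have [c hc cle] := has_expectation_ge0_le mm (fun w => sqr_ge0 _) hm.
have h := has_expectationD (has_expectationZ 2 hc) (has_expectation_cst P (2 * B0)).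
apply: (@le_trans _ _ (\int[P]_w (2 * enorm (avg w - m) ^+ 2 + 2 * B0)%:E)%E).
  apply: ge0_le_integral => //.
  - by move=> w _; rewrite lee_fin sqr_ge0.
  - by apply/measurable_EFinP; exact: measurable_avg_deviation.
  - by apply/measurable_EFinP; exact: has_expectation_measurable h.
  - move=> w _; rewrite lee_fin; exact: avg_triangle.
by rewrite (has_expectation_integral h) lee_fin lerD2r ler_wpM2l.
Qed.

(** Outside the Markov event for the centred part the bias adds only the deterministic 12 B0, with
    no factor [l]. The factor 6 anticipates the comparison of two runs, in which each squared error
    has weight 3 and may use half of the threshold. *)
Lemma zo_average_deviation (l : R) : 0 < l ->
  (P [set w | (12 * B0 + 12 * l * V0 / N%:R <=
     6 * enorm (avg w - grad f x) ^+ 2)%R] <= (l^-1)%:E)%E.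
Proof.
move=> l0.
have [m mle hm] := zo_average_centered.
have NR0 : 0 < N%:R :> R by rewrite ltr0n.
have mm := measurable_avg_deviation m.
have c0 : 0 < l * V0 / N%:R by rewrite divr_gt0// mulr_gt0// zo_variance_bound_gt0.
have := markov_ge mm (fun w => sqr_ge0 _) c0 hm.
rewrite (_ : V0 / N%:R / _ = l^-1); last first.
  by field; rewrite !gt_eqF// zo_variance_bound_gt0.
apply: le_trans; apply: le_measure; rewrite ?inE.
- rewrite (_ : [set w | _] = (fun w => enorm (avg w - grad f x) ^+ 2) @^-1`
      `[(12 * B0 + 12 * l * V0 / N%:R) / 6, +oo[).
    by rewrite -[X in measurable X]setTI; exact: measurable_avg_deviation.
  by apply/seteqP; split => w /=; rewrite in_itv/= andbT ler_pdivrMr// [X in (_ <= X)%R]mulrC.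
- rewrite (_ : [set w | _] = (fun w => enorm (avg w - m) ^+ 2) @^-1`
      `[l * V0 / N%:R, +oo[).
    by rewrite -[X in measurable X]setTI; exact: measurable_avg_deviation.
  by apply/seteqP; split => w /=; rewrite in_itv/= andbT.
- move=> w /=; have := avg_triangle w mle; lra.
Qed.

End Averages.

(** * One step of the method *)

Section BlockStep.
Context (R : realType) (b : nat) (d : 'I_b -> nat).
Local Notation n := (\sum_(s < b) d s)%N.
Context (X : forall s, set 'cV[R]_(d s)).
Context (chi phi : forall s, 'cV[R]_(d s) -> R).
Hypothesis hX : forall s, closed (@X s) /\ convex_set (@X s).
Hypothesis hchi : forall s, closed_convex_function (@chi s).
Hypothesis hphi : forall s, (forall y, differentiable (@phi s) y) /\
  strongly_convex1 (@phi s).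
Hypothesis X0 : forall s, @X s !=set0.
Context (alpha : R).
Hypothesis alpha0 : 0 < alpha.

Lemma block_prox_lipschitz s (x g g' : 'cV[R]_n) :
  enorm (block_prox X chi phi s x g alpha - block_prox X chi phi s x g' alpha)
    <= alpha * enorm (block s (g - g')).
Proof.
rewrite blockB; apply: prox_lipschitz => //; [exact: (hX s).1|exact: (hX s).2|
  exact: (hphi s).1|exact: (hphi s).2].
Qed.

Lemma gradient_mapping_lipschitz (x g g' : 'cV[R]_n) :
  enorm (gradient_mapping X chi phi x g alpha
         - gradient_mapping X chi phi x g' alpha) <= enorm (g - g').
Proof.
rewrite -(@ler_pXn2r _ 2) ?nnegrE ?enorm_ge0// !(enorm_block (_ - _)).
apply: ler_sum => s _; rewrite ler_pXn2r ?nnegrE ?enorm_ge0//.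
rewrite blockB !block_mxcol -scalerBr enormZ (gtr0_norm (_ : 0 < alpha^-1)) ?invr_gt0//.
rewrite ler_pdivrMl// -enormN opprB [X in enorm X]addrC opprB addrA subrK.
exact: block_prox_lipschitz.
Qed.

Lemma bmd_step_in s (x g : 'cV[R]_n) : product_set X x ->
  product_set X (bmd_step X chi phi s x g alpha).
Proof.
move=> Xx r; rewrite block_mxcol; case: ifP => // _.
apply: prox_in => //; [exact: (hX r).1|exact: (hX r).2|
  exact: (hphi r).1|exact: (hphi r).2].
Qed.

Lemma bmd_stepE s (x g : 'cV[R]_n) : bmd_step X chi phi s x g alpha =
  x + Ublock R d s *m (block_prox X chi phi s x g alpha - block s x).
Proof.
set y := bmd_step _ _ _ _ _ _ _.
have -> : block_prox X chi phi s x g alpha - block s x = block s (y - x).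
  by rewrite blockB block_mxcol eqxx.
rewrite Ublock_block ; first by rewrite [RHS]addrC subrK.
move=> r /negbTE rs.
by rewrite blockB block_mxcol rs subrr.
Qed.

Context (f : 'cV[R]_n -> R) (L : 'I_b -> R).
Hypothesis hf : forall s (x : 'cV[R]_n) (h : 'cV[R]_(d s)),
  f (x + Ublock R d s *m h) <=
    f x + dot (block s (grad f x)) h + L s / 2 * enorm h ^+ 2.
Hypothesis hL : forall s, L s <= alpha^-1.
Let Phi x := f x + block_sum chi x.

(** With D the error of [g] on block [s] and p the computed proximal point, [prox_descent],
    smoothness of [f] and Young's inequality give |x_s - p|^2 / (4 alpha) <= Phi x - Phi y + alpha
    |D|^2. Passing to the exact proximal point, at distance at most alpha |D| from p, adds alpha
    |D|^2 / 4; hence the 5 / 4. *)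
Lemma bmd_step_descent s (x g : 'cV[R]_n) : product_set X x ->
  alpha / 8 * enorm (block s
      (gradient_mapping X chi phi x (grad f x) alpha)) ^+ 2 <=
  Phi x - Phi (bmd_step X chi phi s x g alpha)
    + 5 / 4 * alpha * enorm (block s (g - grad f x)) ^+ 2.
Proof.
move=> Xx; set y := bmd_step _ _ _ _ _ _ _.
set p := block_prox X chi phi s x g alpha.
set q := block_prox X chi phi s x (grad f x) alpha.
have prox_le := prox_descent (hX s).1 (hX s).2 (hchi s) (hphi s).1 (hphi s).2
  alpha0 (X0 s) (g := block s g) (Xx s) (erefl p).
have chiE : block_sum chi y - block_sum chi x = chi p - chi (block s x).
  rewrite /block_sum (bigD1 s)//= [in X in _ - X](bigD1 s)//=.
  rewrite block_mxcol eqxx.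
  rewrite (eq_bigr (fun r => chi (block r x))); last first.
    by move=> r /negbTE rs; rewrite block_mxcol rs.
  by rewrite -/p; ring.
have fle := hf x (p - block s x).
rewrite -bmd_stepE -/y in fle.
have lip : enorm (p - q) <= alpha * enorm (block s (g - grad f x)).
  exact: block_prox_lipschitz.
rewrite block_mxcol -/q enormZ gtr0_norm ?invr_gt0//.
set D := block s (g - grad f x) in lip *.
have tri := enorm_sqrD_le (block s x - p) (p - q).
rewrite addrA subrK in tri.
have lip2 : enorm (p - q) ^+ 2 <= alpha ^+ 2 * enorm D ^+ 2.
  by rewrite -exprMn ler_pXn2r ?nnegrE ?enorm_ge0// mulr_ge0 ?enorm_ge0 ?ltW.
have young : dot D (block s x - p) <=
    alpha * enorm D ^+ 2 + (4 * alpha)^-1 * enorm (block s x - p) ^+ 2.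
  exact: dot_le_sqr.
have DE : dot D (block s x - p) =
    dot (block s g) (block s x - p) + dot (block s (grad f x)) (p - block s x).
  by rewrite /D blockB dotDl dotNl -dotNr opprB.
have hh : L s / 2 * enorm (p - block s x) ^+ 2 <=
    alpha^-1 / 2 * enorm (block s x - p) ^+ 2.
  by rewrite -opprB enormN ler_wpM2r ?sqr_ge0// ler_wpM2r.
set e := enorm (block s x - p) ^+ 2 in prox_le tri young hh.
set eq2 := enorm (block s x - q) in tri *.
set eD := enorm D ^+ 2 in lip2 young *.
rewrite exprMn.
have -> : alpha / 8 * (alpha^-1 ^+ 2 * eq2 ^+ 2) = alpha^-1 / 8 * eq2 ^+ 2.
  by field; rewrite gt_eqF.
have ai : 0 < alpha^-1 / 8 by rewrite divr_gt0 ?invr_gt0.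
have {}tri : alpha^-1 / 8 * eq2 ^+ 2 <= alpha^-1 / 8 * (2 * e + 2 * (alpha ^+ 2 * eD)).
  rewrite (ler_wpM2l (ltW ai))//; lra.
apply: le_trans tri _.
rewrite (_ : alpha^-1 / 8 * (2 * e + 2 * (alpha ^+ 2 * eD)) =
  alpha^-1 / 4 * e + alpha / 4 * eD); last by field; rewrite gt_eqF.
rewrite (_ : (4 * alpha)^-1 = alpha^-1 / 4) in young; last by field; rewrite gt_eqF.
rewrite /Phi; lra.
Qed.

Context (dXi : measure_display) (Xi : measurableType dXi).
Context (F : 'cV[R]_n -> Xi -> R) (mu : R) (N : nat) (x1 : 'cV[R]_n).
Context (i : nat -> 'I_b) (z : nat -> nat -> Xi) (u : nat -> nat -> 'cV[R]_n).
Hypothesis Xx1 : product_set X x1.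

Local Notation iter := (zs_bmd_iterate X chi phi F mu (fun=> alpha) (fun=> N) x1 i z u).

Lemma zs_bmd_iterate_in k : product_set X (iter k).
Proof. by elim: k => //= k IH; exact: bmd_step_in. Qed.

Lemma zs_bmd_telescope T :
  \sum_(k < T) alpha / 8 * enorm (block (i k)
      (gradient_mapping X chi phi (iter k) (grad f (iter k)) alpha)) ^+ 2 <=
  Phi x1 - Phi (iter T) + \sum_(k < T) 5 / 4 * alpha * enorm (block (i k)
      (zo_average F mu N (iter k) (z k) (u k) - grad f (iter k))) ^+ 2.
Proof.
elim: T => [|T IH]; first by rewrite !big_ord0 subrr addr0.
rewrite !big_ord_recr /=.
have := bmd_step_descent (i T) (zo_average F mu N (iter T) (z T) (u T))
  (zs_bmd_iterate_in T).
move: IH; rewrite /=; lra.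
Qed.

End BlockStep.

Section StochasticOracle.
Context (R : realType) (b : nat) (d : 'I_b -> nat).
Local Notation n := (\sum_(s < b) d s)%N.
Context (X : forall s, set 'cV[R]_(d s)).
Context (dXi : measure_display) (Xi : measurableType dXi).
Context (Pxi : probability Xi R) (F : 'cV[R]_n -> Xi -> R) (f : 'cV[R]_n -> R).
Context (sigma Lf : R) (L : 'I_b -> R).
Hypothesis h1 : assumption1 X F Pxi f sigma.
Hypothesis h2 : assumption2 F Pxi Lf L.

(** The descent inequality is proved for almost every sample and then averaged, [assumption1] giving
    the mean of the linear term; no Lipschitz estimate for [grad f] has to be derived. *)
Lemma expected_block_descent s x (h : 'cV[R]_(d s)) :
  f (x + Ublock R d s *m h) <=
    f x + dot (block s (grad f x)) h + L s / 2 * enorm h ^+ 2.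
Proof.
have [hF _ hG _] := h1; set v := Ublock R d s *m h.
have hdot : has_expectation Pxi (fun z => dot (grad (F^~ z) x) v) (dot (grad f x) v).
  have := has_expectation_sum (index_enum _) (fun i => has_expectationZ (v i 0) (hG x i)).
  apply: has_expectation_ext => [z|]; rewrite dotE; apply: eq_bigr => i _;
    by rewrite mulrC.
have := has_expectation_ae_le (has_expectationB (has_expectationB (hF (x + v)) (hF x)) hdot).
move=> /(_ (L s / 2 * enorm h ^+ 2)) H.
suff : f (x + v) - f x - dot (grad f x) v <= L s / 2 * enorm h ^+ 2.
  rewrite dot_Ublock; lra.
apply: H; apply: filterS h2 => z [dF _ lF].
rewrite [leRHS](_ : _ = (L s * enorm h ^+ 2) / 2); last by ring.
apply: descent => // t /andP[t0 t1].
rewrite dot_Ublock blockB.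
apply: le_trans (cauchy_schwarz _ _) _.
have := lF s x (t *: h); rewrite -scalemxAr -/v enormZ ger0_norm// => H.
rewrite [leRHS](_ : _ = L s * (t * enorm h) * enorm h); last by ring.
by rewrite ler_wpM2r// enorm_ge0.
Qed.

End StochasticOracle.

(** * Runs and post-optimization *)

Section DecouplingBounds.
Context (R : realType) (dO : measure_display) (Omega : measurableType dO).
Context (P : probability Omega R) (S1 S2 : set (set Omega)).
Hypotheses (mS1 : <<s S1 >> `<=` measurable) (mS2 : <<s S2 >> `<=` measurable).
Hypothesis indS : independent_systems P <<s S1 >> <<s S2 >>.

Local Notation T1 := (g_sigma_algebraType S1).
Local Notation T2 := (g_sigma_algebraType S2).

Lemma measurable_g_sigma (S : set (set Omega)) d (T : measurableType d)
    (X : Omega -> T) : <<s S >> `<=` measurable ->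
  @measurable_fun _ _ (g_sigma_algebraType S) T setT X -> measurable_fun setT X.
Proof.
by move=> mS mX _ B mB; rewrite setTI; apply: mS;
  have := mX measurableT _ mB; rewrite setTI.
Qed.

(** The substitute for conditioning: a bound valid for every frozen first argument holds on the
    diagonal. *)
Lemma decoupling_le (h : T1 * T2 -> \bar R) (c : \bar R) :
  measurable_fun [set: T1 * T2] h -> (forall z, (0 <= h z)%E) ->
  (0 <= c)%E -> (forall w, (\int[P]_w' h (w, w') <= c)%E) ->
  (\int[P]_w h (w, w) <= c)%E.
Proof.
move=> mh h0 c0 hc; rewrite (decoupling mS1 mS2 indS mh h0).
have mI : measurable_fun [set: Omega] (fun w => \int[P]_w' h (w, w'))%E.
  have mid2 : @measurable_fun _ _ Omega T2 setT idfun.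
    by move=> _ A mA; rewrite setTI; exact: mS2.
  pose id2 : {mfun Omega >-> T2} := mfun_Sub (mem_set mid2).
  have E w : (\int[P]_w' h (w, w') = \int[distribution P id2]_w' h (w, w'))%E.
    rewrite ge0_integral_distribution//.
    exact: (measurableT_comp mh (measurable_pair1 w)).
  under eq_fun do rewrite E.
  apply: (measurable_g_sigma mS1).
  exact: (measurable_fun_fubini_tonelli_F (m2 := distribution P id2)).
apply: (@le_trans _ _ (\int[P]_w c)%E).
  by apply: ge0_le_integral => // w _; exact: integral_ge0.
by rewrite integral_cst//= probability_setT mule1.
Qed.

Lemma decoupling_prob (A : set (T1 * T2)) (c : \bar R) : measurable A ->
  (0 <= c)%E -> (forall w, P [set w' : Omega | A (w, w')] <= c)%E ->
  (P [set w : Omega | A (w, w)] <= c)%E.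
Proof.
move=> mA c0 hc.
have mX : @measurable_fun _ _ Omega (T1 * T2)%type setT (fun w => (w, w)).
  by apply/measurable_fun_pair => _ B mB; rewrite setTI;
    [exact: mS1|exact: mS2].
have mD : measurable [set w : Omega | A (w, w)].
  by rewrite -[X in measurable X]setTI; exact: mX.
have mI w : measurable [set w' : Omega | A (w, w')].
  apply: mS2; rewrite -[X in <<s S2 >> X]setTI.
  exact: (measurable_pair1 (T1 := T1) (T2 := T2) w measurableT mA).
pose h (q : T1 * T2) : \bar R := (\1_A q)%:E.
have -> : P [set w : Omega | A (w, w)] = (\int[P]_w h (w, w))%E.
  by rewrite -(setIT [set w | _]) -integral_indic//; apply: eq_integral.
apply: decoupling_le => //.
- by apply/measurable_EFinP; exact: measurable_indic.
- by move=> z; rewrite lee_fin.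
- move=> w; apply: le_trans (hc w).
  by rewrite -(setIT [set w' | _]) -integral_indic//; apply: eq_integral.
Qed.

End DecouplingBounds.

(** Used to substitute the random block index into a step and the random output index into the
    sequence of iterates. *)
Lemma measurable_fun_select (I : countType) (d d' : measure_display)
    (T : measurableType d) (U : measurableType d') (idx : T -> I)
    (g : I -> T -> U) :
  (forall s, measurable (idx @^-1` [set s])) ->
  (forall s, measurable_fun setT (g s)) ->
  measurable_fun setT (fun w => g (idx w) w).
Proof.
move=> midx mg _ B mB; rewrite setTI.
rewrite (_ : _ @^-1` B = \bigcup_s (idx @^-1` [set s] `&` g s @^-1` B)).
  apply: countable_bigcupT_measurable => // s.
  by apply: measurableI => //; rewrite -[X in measurable X]setTI; exact: mg.
by apply/seteqP; split => [w Bw|w [s _ [<-]]//]; exists (idx w).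
Qed.

Section MeasurableSteps.
Context (R : realType) (b : nat) (ds : 'I_b -> nat).
Local Notation n := (\sum_(s < b) ds s)%N.
Context (X : forall s, set 'cV[R]_(ds s)).
Context (chi phi : forall s, 'cV[R]_(ds s) -> R).
Hypothesis hX : forall s, closed (@X s) /\ convex_set (@X s).
Hypothesis hchi : forall s, closed_convex_function (@chi s).
Hypothesis hphi : forall s, (forall y, differentiable (@phi s) y) /\
  strongly_convex1 (@phi s).
Hypothesis X0 : forall s, @X s !=set0.
Context (alpha : R).
Hypothesis alpha0 : 0 < alpha.
Context (d : measure_display) (T : measurableType d) (x g : T -> borel R n).
Hypotheses (mx : measurable_fun setT x) (mg : measurable_fun setT g).

Lemma measurable_mxcol (B : forall s, T -> borel R (ds s)) :
  (forall s, measurable_fun setT (B s)) ->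
  @measurable_fun _ _ T (borel R n) setT
    (fun t => \mxcol_s (B s t : 'cV[R]_(ds s))).
Proof.
move=> mB; apply: measurable_to_borel => i.
under eq_fun do rewrite mxE.
by have /measurable_borelP mBi := mB (tagnat.sig1 i); exact: mBi.
Qed.

Let measurable_block s (y : T -> borel R n) : measurable_fun setT y ->
  @measurable_fun _ _ T (borel R (ds s)) setT (fun t => block s (y t : 'cV[R]_n)).
Proof. by move=> my; exact: (measurable_vec_mulmx (Ublock R ds s)^T my). Qed.

Lemma measurable_block_prox s : @measurable_fun _ _ T (borel R (ds s)) setT
  (fun t => block_prox X chi phi s (x t) (g t) alpha).
Proof.
apply: (measurable_prox (hX s).1 (hX s).2 (hchi s) (hphi s).1 (hphi s).2
  alpha0 (X0 s)); exact: measurable_block.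
Qed.

Lemma measurable_bmd_step s : @measurable_fun _ _ T (borel R n) setT
  (fun t => bmd_step X chi phi s (x t) (g t) alpha).
Proof.
apply: (measurable_mxcol (B := fun r t => if r == s
  then block_prox X chi phi r (x t) (g t) alpha else block r (x t))) => r.
by case: (r == s); [exact: measurable_block_prox|exact: measurable_block].
Qed.

Lemma measurable_gradient_mapping : @measurable_fun _ _ T (borel R n) setT
  (fun t => gradient_mapping X chi phi (x t) (g t) alpha).
Proof.
apply: (measurable_mxcol (B := fun s t =>
  alpha^-1 *: (block s (x t) - block_prox X chi phi s (x t) (g t) alpha))) => s.
apply: (measurable_vecZ (a := cst alpha^-1)); first exact: measurable_cst.
by apply: measurable_vecB; [exact: measurable_block|exact: measurable_block_prox].
Qed.

End MeasurableSteps.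

Section DrawFinite.
Context (S T T' N : nat).

(** Exhibits the draws as a finite type, so that their independence becomes one product rule over
    all draws, which can be regrouped by labels. *)
Definition draw_code (e : draw S T T' N) :=
  match e with
  | BlockIndex j k => inl (inl (inl (inl (inl (j, k)))))
  | OutputIndex j => inl (inl (inl (inl (inr j))))
  | Direction j k t => inl (inl (inl (inr (j, k, t))))
  | Sample j k t => inl (inl (inr (j, k, t)))
  | PostDirection k => inl (inr k)
  | PostSample k => inr k
  end.

Definition draw_decode c : draw S T T' N :=
  match c with
  | inl (inl (inl (inl (inl (j, k))))) => BlockIndex T' N j k
  | inl (inl (inl (inl (inr j)))) => OutputIndex T T' N j
  | inl (inl (inl (inr (j, k, t)))) => Direction N j k t
  | inl (inl (inr (j, k, t))) => Sample N j k t
  | inl (inr k) => PostDirection S T T' k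
  | inr k => PostSample S T T' k
  end.

Lemma draw_codeK : cancel draw_code draw_decode. Proof. by case. Qed.

HB.instance Definition _ := Finite.copy (draw S T T' N) (can_type draw_codeK).

End DrawFinite.

Lemma independent_systemsS (R : realType) (dO : measure_display)
    (Omega : measurableType dO) (P : probability Omega R)
    (A A' B B' : set (set Omega)) :
  A' `<=` A -> B' `<=` B -> independent_systems P A B ->
  independent_systems P A' B'.
Proof. by move=> AA BB AB a c /AA Aa /BB Bc; exact: AB. Qed.

Lemma sigma_of_discrete_sigma_algebra (Omega T : Type) (X : Omega -> T) :
  sigma_algebra setT (sigma_of_discrete X).
Proof.
apply: sigma_algebra_preimage; split => //.
Qed.

Section Draws.
Context (R : realType) (b n : nat).
Context (dXi : measure_display) (Xi : measurableType dXi).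
Context (Pxi : probability Xi R) (p : 'I_b -> R) (pR : nat -> R).
Context (dO : measure_display) (Omega : measurableType dO).
Context (P : probability Omega R) (S T T' N : nat).
Context (i : 'I_S -> nat -> Omega -> 'I_b) (r : 'I_S -> Omega -> nat).
Context (u : 'I_S -> nat -> nat -> {RV P >-> borel R n}).
Context (xi : 'I_S -> nat -> nat -> {RV P >-> Xi}).
Context (v : nat -> {RV P >-> borel R n}) (zeta : nat -> {RV P >-> Xi}).
Hypothesis draws : two_phase_draws Pxi p pR T T' N i r u xi v zeta.

Definition draw_sigma (e : draw S T T' N) : set (set Omega) :=
  match e with
  | BlockIndex j k => sigma_of_discrete (i j k)
  | OutputIndex j => sigma_of_discrete (r j)
  | Direction j k t => sigma_of (u j k t)
  | Sample j k t => sigma_of (xi j k t)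
  | PostDirection k => sigma_of (v k)
  | PostSample k => sigma_of (zeta k)
  end.

Definition draws_sigma (J : set (draw S T T' N)) : set (set Omega) :=
  \bigcup_(e in J) draw_sigma e.

Lemma draw_sigma_algebra e : sigma_algebra setT (draw_sigma e).
Proof.
by case: e => *; first [exact: sigma_of_discrete_sigma_algebra
                       |exact: sigma_of_sigma_algebra].
Qed.

Lemma has_pmf_measurable (I : countType) (Y : Omega -> I) (q : I -> R) :
  has_pmf P Y q -> sigma_of_discrete Y `<=` measurable.
Proof.
move=> hY _ [B _ <-]; rewrite setTI.
rewrite (_ : Y @^-1` B = \bigcup_(s in B) (Y @^-1` [set s])).
  rewrite bigcup_mkcond; apply: countable_bigcupT_measurable => // s.
  by case: ifP => // _; have [] := hY s.
by apply/seteqP; split => [w Bw|w [s Bs Ys]]; [by exists (Y w)|by rewrite /= Ys].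
Qed.

Lemma draw_sigma_measurable e : draw_sigma e `<=` measurable.
Proof.
case: e => [j k|j|j k t|j k t|k|k] /=; try by apply: sigma_of_sub; exact: measurable_funPT.
- exact: has_pmf_measurable (draw_block draws j (ltn_ord k)).
- exact: has_pmf_measurable (draw_output draws j).
Qed.

Lemma draw_sigma_sub e (J : set (draw S T T' N)) :
  J e -> draw_sigma e `<=` <<s draws_sigma J >>.
Proof. by move=> Je A HA; apply: sub_sigma_algebra; exists e. Qed.

Lemma draws_sigmaS (J J' : set (draw S T T' N)) :
  J `<=` J' -> <<s draws_sigma J >> `<=` <<s draws_sigma J' >>.
Proof.
move=> JJ; apply: smallest_sub; first exact: smallest_sigma_algebra.
by move=> A [e /JJ Je Ae]; exact: (draw_sigma_sub Je).
Qed.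

Lemma draws_sigma_measurable J : <<s draws_sigma J >> `<=` measurable.
Proof. exact: (group_sigma_measurable (G := draw_sigma) draw_sigma_measurable). Qed.

Lemma draws_family : independent_family P draw_sigma.
Proof.
exact: (mutually_independent_family (g := idfun) _ (draw_independent draws)).
Qed.

Lemma draws_independent (J1 J2 : set (draw S T T' N)) : J1 `&` J2 = set0 ->
  independent_systems P <<s draws_sigma J1 >> <<s draws_sigma J2 >>.
Proof.
exact: (independent_groups draw_sigma_algebra draw_sigma_measurable draws_family).
Qed.

End Draws.

Lemma measurable_g_sigmaS (Omega : pointedType) (d : measure_display)
    (T : measurableType d) (S S' : set (set Omega)) (X : Omega -> T) :
  <<s S >> `<=` <<s S' >> ->
  @measurable_fun _ _ (g_sigma_algebraType S) T setT X ->
  @measurable_fun _ _ (g_sigma_algebraType S') T setT X.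
Proof.
move=> SS mX _ B mB; rewrite setTI; apply: SS.
by have := mX measurableT _ mB; rewrite setTI.
Qed.

Lemma enorm_block_le (R : realType) (b : nat) (ds : 'I_b -> nat) s
    (x : 'cV[R]_(\sum_(s < b) ds s)) : enorm (block s x) ^+ 2 <= enorm x ^+ 2.
Proof.
by rewrite enorm_block [leRHS](bigD1 s)//= lerDl sumr_ge0// => r _; exact: sqr_ge0.
Qed.

Lemma perturbed_min_sqr (R : realFieldType) (a a' e e' g c t : R) :
  0 <= a -> 0 <= a' -> 0 <= e -> 0 <= e' -> a' <= g + e' -> g <= a + e ->
  a ^+ 2 < c -> 6 * e ^+ 2 < t -> 6 * e' ^+ 2 < t -> a' ^+ 2 < 4 * c + t.
Proof.
move=> a0 a'0 e0 e'0 h1 h2 hc he he'.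
have h : a' <= a + e + e' by lra.
have hsq : a' ^+ 2 <= (a + e + e') ^+ 2 by rewrite ler_pXn2r ?nnegrE ?addr_ge0.
have q1 : 0 <= (3 * a - e - e') ^+ 2 by exact: sqr_ge0.
have q2 : 0 <= (e - e') ^+ 2 by exact: sqr_ge0.
have q3 : 0 <= e ^+ 2 by exact: sqr_ge0.
have q4 : 0 <= e' ^+ 2 by exact: sqr_ge0.
have q5 : 0 <= a ^+ 2 by exact: sqr_ge0.
(* Cauchy-Schwarz with 1/4 + 1/3 + 1/3 <= 1. *)
have : (a + e + e') ^+ 2 <= 4 * a ^+ 2 + 3 * e ^+ 2 + 3 * e' ^+ 2 by nra.
lra.
Qed.

Section Runs.
Context (R : realType) (b : nat) (ds : 'I_b -> nat).
Local Notation n := (\sum_(s < b) ds s)%N.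
Context (X : forall s, set 'cV[R]_(ds s)).
Context (chi phi : forall s, 'cV[R]_(ds s) -> R).
Hypothesis hX : forall s, closed (@X s) /\ convex_set (@X s).
Hypothesis hchi : forall s, closed_convex_function (@chi s).
Hypothesis hphi : forall s, (forall y, differentiable (@phi s) y) /\
  strongly_convex1 (@phi s).
Context (dXi : measure_display) (Xi : measurableType dXi).
Context (Pxi : probability Xi R) (F : 'cV[R]_n -> Xi -> R) (f : 'cV[R]_n -> R).
Context (mu Lf sigma M : R) (L : 'I_b -> R) (x1 : 'cV[R]_n).
Hypothesis mF : measurable_fun setT (fun q : borel R n * Xi => F q.1 q.2).
Hypothesis mu0 : 0 < mu.
Hypothesis Lf0 : 0 < Lf.
Hypothesis h1 : assumption1 X F Pxi f sigma.
Hypothesis h2 : assumption2 F Pxi Lf L.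
Hypothesis h3 : assumption3 X f M.
Hypothesis Xx1 : product_set X x1.
Context (alpha : R).
Hypothesis alpha0 : 0 < alpha.
Hypothesis hL : forall s, L s <= alpha^-1.

Local Notation V0 := (zo_variance_bound ds mu Lf sigma M).
Local Notation B0 := (zo_bias_bound ds mu Lf).

Let X0 s : @X s !=set0. Proof. by exists (block s x1). Qed.

Let hLip : {ae Pxi, forall z,
  (forall y, differentiable (F^~ z) y) /\
  (forall y y', enorm (grad (F^~ z) y - grad (F^~ z) y') <= Lf * enorm (y - y'))}.
Proof. by apply: filterS h2 => z []. Qed.

Definition exact_mapping (x : 'cV[R]_n) : 'cV[R]_n :=
  gradient_mapping X chi phi x (grad f x) alpha.

Lemma measurable_exact_mapping :
  @measurable_fun _ _ (borel R n) (borel R n) setT exact_mapping.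
Proof.
have [_ df _ _] := h1.
apply: (measurable_gradient_mapping hX hchi hphi X0 alpha0 (T := borel R n)
  (x := idfun) (g := grad f)) => //.
- exact: measurable_id.
- exact: measurable_grad df.
Qed.

Context (p : 'I_b -> R) (pR : nat -> R).
Context (dO : measure_display) (Omega : measurableType dO).
Context (P : probability Omega R) (S T T' N : nat).
Context (i : 'I_S -> nat -> Omega -> 'I_b) (r : 'I_S -> Omega -> nat).
Context (u : 'I_S -> nat -> nat -> {RV P >-> borel R n}).
Context (xi : 'I_S -> nat -> nat -> {RV P >-> Xi}).
Context (v : nat -> {RV P >-> borel R n}) (zeta : nat -> {RV P >-> Xi}).
Hypothesis draws : two_phase_draws Pxi p pR T T' N i r u xi v zeta.
Hypothesis T'0 : (0 < T')%N.

Local Notation Draw := (draw S T T' N).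
Local Notation dsigma := (draws_sigma (T := T) (T' := T') (N := N) i r u xi v zeta).
Let dsub (e : Draw) (J : set Draw) :=
  @draw_sigma_sub _ _ _ _ _ _ _ P S T T' N i r u xi v zeta e J.

Definition iterate (j : 'I_S) (k : nat) (w : Omega) : 'cV[R]_n :=
  zs_bmd_iterate X chi phi F mu (fun=> alpha) (fun=> T') x1
    (fun k => i j k w) (fun k t => xi j k t w) (fun k t => u j k t w) k.

Definition step_average (j : 'I_S) (k : nat) (x : 'cV[R]_n) (w : Omega) :=
  zo_average F mu T' x (fun t => xi j k t w) (fun t => u j k t w).

Definition past (j : 'I_S) (k : nat) : set Draw := [set e |
  match e with
  | BlockIndex j' k' | Direction j' k' _ | Sample j' k' _ =>
      j' = j /\ (k' < k)%N
  | _ => False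
  end].

(** The block index of the step is in neither [past j k] nor this set: the error is estimated on all
    blocks at once, and averaging over the index is a separate argument. *)
Definition fresh (j : 'I_S) (k : nat) : set Draw := [set e |
  match e with
  | Direction j' k' _ | Sample j' k' _ => j' = j /\ k' = k :> nat
  | _ => False
  end].

Lemma iterate_in j k w : product_set X (iterate j k w).
Proof. exact: zs_bmd_iterate_in. Qed.

Lemma measurable_sample j k t (J : set Draw) (kT : (k < T)%N) (tT : (t < T')%N) :
  J (Sample N j (Ordinal kT) (Ordinal tT)) ->
  @measurable_fun _ _ (g_sigma_algebraType (dsigma J)) Xi setT (xi j k t).
Proof.
move=> Je; apply: sigma_of_measurable.
exact: (@dsub (Sample N j (Ordinal kT) (Ordinal tT)) J Je).
Qed.

Lemma measurable_direction j k t (J : set Draw) (kT : (k < T)%N) (tT : (t < T')%N) :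
  J (Direction N j (Ordinal kT) (Ordinal tT)) ->
  @measurable_fun _ _ (g_sigma_algebraType (dsigma J)) (borel R n) setT (u j k t).
Proof.
move=> Je; apply: sigma_of_measurable.
exact: (@dsub (Direction N j (Ordinal kT) (Ordinal tT)) J Je).
Qed.

Lemma measurable_iterate j k : (k <= T)%N ->
  @measurable_fun _ _ (g_sigma_algebraType (dsigma (past j k))) (borel R n) setT
    (iterate j k).
Proof.
elim: k => [_|k IH kT]; first exact: measurable_cst.
have pastS : past j k `<=` past j k.+1.
  by case=> //= [j' k'|j' k' t|j' k' t] [-> /ltnW kk].
have mx : @measurable_fun _ _ (g_sigma_algebraType (dsigma (past j k.+1)))
    (borel R n) setT (iterate j k).
  by apply: measurable_g_sigmaS (IH (ltnW kT)); exact: draws_sigmaS.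
pose step s w : borel R n := bmd_step X chi phi s (iterate j k w)
  (step_average j k (iterate j k w) w) alpha.
apply: (@measurable_fun_select 'I_b _ _ (g_sigma_algebraType (dsigma (past j k.+1)))
  (borel R n) (i j k) step) => s.
  apply: (dsub (e := BlockIndex T' N j (Ordinal kT))) => //=.
  by exists [set s]; rewrite // setTI.
apply: measurable_bmd_step => //.
apply: measurable_zo_average => // t tT.
- by apply: (@measurable_sample j k t (past j k.+1) kT tT).
- by apply: (@measurable_direction j k t (past j k.+1) kT tT).
Qed.

Lemma dsigma_measurable (J : set Draw) : <<s dsigma J >> `<=` measurable.
Proof. exact: (draws_sigma_measurable draws). Qed.

Lemma samples_independent (J1 J2 : set Draw) : J1 `&` J2 = set0 ->
  independent_systems P <<s dsigma J1 >> <<s dsigma J2 >>.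
Proof. exact: (draws_independent draws). Qed.

(** The fixed-point bound is uniform over the feasible set, so freezing the iterate, a function of
    [past j k], loses nothing. *)
Lemma step_error_second_moment j k : (k < T)%N ->
  (\int[P]_w (enorm (step_average j k (iterate j k w) w
       - grad f (iterate j k w)) ^+ 2)%:E <= (2 * (V0 / T'%:R) + 2 * B0)%:E)%E.
Proof.
move=> kT; have [_ df hgrad hvar] := h1.
pose T1 := g_sigma_algebraType (dsigma (past j k)).
pose T2 := g_sigma_algebraType (dsigma (fresh j k)).
pose h (q : T1 * T2) : \bar R := (enorm (step_average j k (iterate j k q.1) q.2
       - grad f (iterate j k q.1)) ^+ 2)%:E.
have hx w := iterate_in j k w.
have indJ : independent_systems P <<s dsigma (past j k) >> <<s dsigma (fresh j k) >>.
  apply: samples_independent; rewrite -subset0 => -[j' k'|j'|j' k' t|j' k' t|k'|k'] [] //=;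
    by move=> [_ kk] [_ E]; rewrite E ltnn in kk.
have second w : (\int[P]_w' h (w, w') <= (2 * (V0 / T'%:R) + 2 * B0)%:E)%E.
  apply: (zo_average_second_moment mF mu0 Lf0 (hgrad (iterate j k w))
    (hvar _ (hx w)) (h3 (hx w)) hLip T'0 (u := u j k) (xi := xi j k)).
  - by move=> t tT; exact: (draw_direction draws).
  - by move=> t tT; exact: (draw_sample draws).
  - move=> t tT.
    apply: independent_systemsS (samples_independent
      (J1 := [set Sample N j (Ordinal kT) (Ordinal tT)])
      (J2 := [set Direction N j (Ordinal kT) (Ordinal tT)]) _).
    + exact: (@dsub (Sample N j (Ordinal kT) (Ordinal tT))).
    + exact: (@dsub (Direction N j (Ordinal kT) (Ordinal tT))).
    + by rewrite -subset0 => e [-> //].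
  - move=> s t sT tT st.
    pose both t (tT : (t < T')%N) := [set Sample N j (Ordinal kT) (Ordinal tT);
      Direction N j (Ordinal kT) (Ordinal tT)].
    have bothP t' (tT' : (t' < T')%N) :
        <<s sigma_of (xi j k t') `|` sigma_of (u j k t') >> `<=` <<s dsigma (both t' tT') >>.
      apply: smallest_sub; first exact: smallest_sigma_algebra.
      rewrite subUset; split.
        by apply: (@dsub (Sample N j (Ordinal kT) (Ordinal tT'))); left.
      by apply: (@dsub (Direction N j (Ordinal kT) (Ordinal tT'))); right.
    apply: independent_systemsS (bothP s sT) (bothP t tT) (samples_independent _).
    by rewrite -subset0 => e [[] -> []] // [] ts; rewrite ts eqxx in st.
have V1 : 0 <= 2 * (V0 / T'%:R) + 2 * B0.
  apply: addr_ge0; apply: mulr_ge0 => //.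
    by rewrite divr_ge0// ltW// zo_variance_bound_gt0.
  apply: mulr_ge0; last by rewrite exprn_ge0.
  by rewrite divr_ge0// mulr_ge0// sqr_ge0.
apply: (decoupling_le (S1 := dsigma (past j k)) (S2 := dsigma (fresh j k))
  (@dsigma_measurable _) (@dsigma_measurable _) indJ (h := h)) => //; last first.
  by move=> q; rewrite lee_fin sqr_ge0.
have mx : @measurable_fun _ _ (T1 * T2)%type (borel R n) setT (fun q => iterate j k q.1).
  exact: (measurableT_comp (@measurable_iterate j k (ltnW kT))).
apply/measurable_EFinP; apply: measurable_funX; apply: measurable_enorm.
apply: measurable_vecB; last exact: (measurableT_comp (measurable_grad df)).
apply: measurable_zo_average => // t tT.
- apply: (measurableT_comp (@measurable_sample j k t (fresh j k) kT tT _)) => //.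
- apply: (measurableT_comp (@measurable_direction j k t (fresh j k) kT tT _)) => //.
Qed.

Hypothesis b0 : (0 < b)%N.
Hypothesis hp : forall s, p s = b%:R^-1.

Lemma measurable_block_mapping s : @measurable_fun _ _ (borel R n) R setT
  (fun x => enorm (block s (exact_mapping x)) ^+ 2).
Proof.
apply: measurable_funX; apply: measurable_enorm.
exact: (measurable_vec_mulmx (Ublock R ds s)^T measurable_exact_mapping).
Qed.

(** The integrand is split by the value [s] of the block index. Each event has probability 1 / b and
    is independent of the iterate, and the blocks add up to the full squared norm. *)
Lemma selected_block_moment j k : (k < T)%N ->
  (\int[P]_w (enorm (block (i j k w) (exact_mapping (iterate j k w))) ^+ 2)%:E =
   (b%:R^-1)%:E * \int[P]_w (enorm (exact_mapping (iterate j k w)) ^+ 2)%:E)%E.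
Proof.
move=> kT.
pose chosen : set Draw := [set BlockIndex T' N j (Ordinal kT)].
pose T1 := g_sigma_algebraType (dsigma (past j k)).
pose T2 := g_sigma_algebraType (dsigma chosen).
pose g s x := enorm (block s (exact_mapping x)) ^+ 2.
have g0 s x : 0 <= g s x by exact: sqr_ge0.
have mg s : @measurable_fun _ _ T1 R setT (fun w => g s (iterate j k w)).
  exact: (measurableT_comp (measurable_block_mapping s) (@measurable_iterate j k (ltnW kT))).
have mgO s : measurable_fun [set: Omega] (fun w => g s (iterate j k w)).
  exact: (measurable_g_sigma (@dsigma_measurable _) (mg s)).
pose A s := i j k @^-1` [set s].
have mA2 s : <<s dsigma chosen >> (A s).
  apply: (@dsub (BlockIndex T' N j (Ordinal kT)) chosen) => //=.
  by exists [set s]; rewrite // setTI.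
have mA s : measurable (A s) by exact: dsigma_measurable (mA2 s).
have indJ : independent_systems P <<s dsigma (past j k) >> <<s dsigma chosen >>.
  apply: samples_independent; rewrite -subset0 => e [pe ec].
  by move: pe; rewrite ec => -[_ /=]; rewrite ltnn.
have one s : (\int[P]_w (g s (iterate j k w) * \1_(A s) w)%:E =
    (b%:R^-1)%:E * \int[P]_w (g s (iterate j k w))%:E)%E.
  pose h (q : T1 * T2) : \bar R := (g s (iterate j k q.1) * \1_(A s) q.2)%:E.
  rewrite (decoupling (S1 := dsigma (past j k)) (S2 := dsigma chosen)
    (@dsigma_measurable _) (@dsigma_measurable _) indJ (h := h)); first last.
  - by move=> q; rewrite lee_fin mulr_ge0.
  - apply/measurable_EFinP; apply: measurable_funM.
      exact: (measurableT_comp (mg s)).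
    have m2 : @measurable_fun _ _ T2 R setT \1_(A s).
      by apply: measurable_indic; exact: mA2.
    exact: (measurableT_comp m2 measurable_snd).
  rewrite -ge0_integralZl_EFin//; last 2 first.
  - by move=> w _; rewrite lee_fin.
  - exact/measurable_EFinP.
  apply: eq_integral => w _; rewrite /h /=.
  under eq_integral => w' _ do rewrite EFinM.
  rewrite ge0_integralZl_EFin//; last first.
    by apply/measurable_EFinP; exact: measurable_indic.
  rewrite integral_indic// setIT muleC; congr (_ * _)%E.
  by have [_] := draw_block draws j kT s; rewrite hp.
transitivity (\int[P]_w \sum_(s <- index_enum 'I_b) (g s (iterate j k w) * \1_(A s) w)%:E)%E.
  apply: eq_integral => w _; rewrite sumEFin (bigD1 (i j k w))//=.
  rewrite indicE mem_set// mulr1 big1 ?addr0// => s sk.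
  rewrite indicE memNset ?mulr0// => E.
  by rewrite /A /= in E; rewrite E eqxx in sk.
rewrite ge0_integral_sum//; last 2 first.
- by move=> s; apply/measurable_EFinP; apply: measurable_funM => //; exact: measurable_indic.
- by move=> s w _; rewrite lee_fin mulr_ge0.
under eq_bigr => s _ do rewrite one.
rewrite -ge0_sume_distrr; last by move=> s _; apply: integral_ge0 => w _; rewrite lee_fin.
rewrite -ge0_integral_sum//; last 2 first.
- by move=> s; exact/measurable_EFinP.
- by move=> s w _; rewrite lee_fin.
congr (_ * _)%E; apply: eq_integral => w _.
by rewrite sumEFin enorm_block.
Qed.

Context (Phistar : R).
Local Notation Phi x := (f x + block_sum chi x).
Hypothesis Phi_ge : forall x, product_set X x -> Phistar <= Phi x.

(** Multiplying the telescoped inequality by 8 / alpha turns the error weight 5 / 4 * alpha into 10,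
    and the factor [b] undoes the probability of selecting a block. *)
Lemma mean_square_bound j : exists2 m : nat -> R,
  (forall k, (k < T)%N ->
    \int[P]_w (enorm (exact_mapping (iterate j k w)) ^+ 2)%:E = (m k)%:E)%E &
  \sum_(k < T) m k <= b%:R * (8 / alpha * (Phi x1 - Phistar)
    + 10 * T%:R * (2 * (V0 / T'%:R) + 2 * B0)).
Proof.
have [_ df _ _] := h1.
set D := 2 * (V0 / T'%:R) + 2 * B0.
pose e k w := enorm (step_average j k (iterate j k w) w - grad f (iterate j k w)) ^+ 2.
pose q k w := enorm (block (i j k w) (exact_mapping (iterate j k w))) ^+ 2.
have mit k : (k < T)%N -> @measurable_fun _ _ Omega (borel R n) setT (iterate j k).
  move=> kT; exact: (measurable_g_sigma (@dsigma_measurable _) (@measurable_iterate j k (ltnW kT))).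
have mi k s : (k < T)%N -> measurable (i j k @^-1` [set s]).
  by move=> kT; have [] := draw_block draws j kT s.
have me k : (k < T)%N -> measurable_fun setT (e k).
  move=> kT; apply: measurable_funX; apply: measurable_enorm; apply: measurable_vecB.
    by apply: measurable_zo_average => //; exact: mit.
  exact: (measurableT_comp (measurable_grad df) (mit k kT)).
have mq k : (k < T)%N -> measurable_fun setT (q k).
  move=> kT; apply: (@measurable_fun_select 'I_b _ _ Omega R (i j k)
    (fun s w => enorm (block s (exact_mapping (iterate j k w))) ^+ 2)) => s.
    exact: mi.
  exact: (measurableT_comp (measurable_block_mapping s) (mit k kT)).
have /choice[be hbe] (k : 'I_T) : exists c, has_expectation P (e k) c /\ c <= D.
  have [c hc cD] := has_expectation_ge0_le (me k (ltn_ord k)) (fun w => sqr_ge0 _)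
    (step_error_second_moment j (ltn_ord k)).
  by exists c.
have hE := has_expectation_sum (index_enum _) (fun k => has_expectationZ (5 / 4 * alpha) (hbe k).1).
have hC := has_expectationD (has_expectation_cst P (Phi x1 - Phistar)) hE.
have a54 : 0 <= 5 / 4 * alpha by rewrite mulr_ge0// ltW.
have tele w : \sum_(k < T) alpha / 8 * q k w <=
    (Phi x1 - Phistar) + \sum_(k < T) 5 / 4 * alpha * e k w.
  have := zs_bmd_telescope hX hchi hphi X0 alpha0 (expected_block_descent h1 h2) hL F mu T'
    (fun k => i j k w) (fun k t => xi j k t w) (fun k t => u j k t w) Xx1 T.
  rewrite -/(iterate j T w) => H; apply: (le_trans H); apply: lerD.
    by rewrite lerD2l lerN2; exact: (Phi_ge (iterate_in j T w)).
  apply: ler_sum => k _; rewrite (ler_wpM2l a54)//.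
  exact: enorm_block_le.
have a8 : 0 < alpha / 8 by rewrite divr_gt0.
(* Integrability comes from the telescoped inequality itself: its integrable right side dominates
   each nonnegative term on the left. *)
have /choice[bq hbq] (k : 'I_T) : exists c, has_expectation P (q k) c.
  apply: (has_expectation_dominated (mq k (ltn_ord k)) (has_expectationZ (alpha / 8)^-1 hC)).
  move=> w; rewrite ger0_norm ?sqr_ge0// ler_pdivlMl//.
  apply: le_trans (tele w).
  rewrite (bigD1 k)//= lerDl sumr_ge0// => l _.
  by rewrite mulr_ge0 ?sqr_ge0// ltW.
have hQ := has_expectation_sum (index_enum _) (fun k => has_expectationZ (alpha / 8) (hbq k)).
have le1 := has_expectation_le hQ hC tele.
have bR : 0 < b%:R :> R by rewrite ltr0n.
(* The default 0 is never reached, since only indices below [T] occur. *)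
exists (fun k => b%:R * (if insub k is Some k' then bq k' else 0)).
  move=> k kT; rewrite insubT/=.
  have := selected_block_moment j kT.
  have := has_expectation_integral (hbq (Ordinal kT)); rewrite /q /= => -> E.
  by rewrite EFinM E muleA -EFinM divff ?mul1e// gt_eqF.
under eq_bigr => k _ do rewrite valK.
rewrite -mulr_sumr ler_wpM2l//.
have le2 : \sum_(k < T) 5 / 4 * alpha * be k <= 5 / 4 * alpha * (T%:R * D).
  rewrite -mulr_sumr (ler_wpM2l a54)//.
  apply: (@le_trans _ _ (\sum_(k < T) D)); first by apply: ler_sum => k _; exact: (hbe k).2.
  by rewrite sumr_const card_ord mulr_natl.
rewrite -mulr_sumr in le1.
have : alpha / 8 * \sum_(k < T) bq k <= Phi x1 - Phistar + 5 / 4 * alpha * (T%:R * D).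
  by apply: le_trans le1 _; rewrite lerD2l.
rewrite -ler_pdivlMl// => /le_trans; apply.
rewrite le_eqVlt; apply/orP; left; apply/eqP.
by field; rewrite gt_eqF.
Qed.

Hypothesis T0 : (0 < T)%N.
Hypothesis hpR : forall k, pR k = if (k < T)%N then T%:R^-1 else 0.

(* Draws with index at least T are unconstrained: on the null event T <= r the
   output is redirected to x1, which keeps it a function of the run's draws. *)
Definition run_output j w : 'cV[R]_n :=
  if (r j w < T)%N then iterate j (r j w) w else x1.

Definition run_draws (j : 'I_S) : set Draw := [set e |
  match e with
  | BlockIndex j' _ | OutputIndex j' | Direction j' _ _ | Sample j' _ _ => j' = j
  | _ => False
  end].

Lemma run_output_in j w : product_set X (run_output j w).
Proof. by rewrite /run_output; case: ifP => // _; exact: iterate_in. Qed.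

Let output_event j k : measurable (r j @^-1` [set k]).
Proof. by have [] := draw_output draws j k. Qed.

Lemma measurable_run_output j :
  @measurable_fun _ _ (g_sigma_algebraType (dsigma (run_draws j))) (borel R n) setT
    (run_output j).
Proof.
pose g k w : borel R n := if (k < T)%N then iterate j k w else x1.
apply: (@measurable_fun_select nat _ _ (g_sigma_algebraType (dsigma (run_draws j)))
  (borel R n) (r j) g) => k.
  apply: (@dsub (OutputIndex T T' N j) (run_draws j)) => //=.
  by exists [set k]; rewrite // setTI.
rewrite /g; case kT : (k < T)%N; last exact: measurable_cst.
apply: measurable_g_sigmaS (@measurable_iterate j k (ltnW kT)).
apply: draws_sigmaS => -[j' k'|j'|j' k' t|j' k' t|k'|k'] //= []//.
Qed.

Lemma output_late_negligible j : P.-negligible [set w | (T <= r j w)%N].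
Proof.
rewrite (_ : [set w | _] = \bigcup_k (if (T <= k)%N then r j @^-1` [set k] else set0)).
  apply: negligible_bigcup => k; case: ifP => [Tk|_]; last exact: negligible_set0.
  apply/negligibleP; first exact: output_event.
  by have [_] := draw_output draws j k; rewrite hpR ltnNge Tk.
apply/seteqP; split => [w /= Tw|w [k _]]; first by exists (r j w) => //=; rewrite Tw.
by case: ifP => //= Tk ->.
Qed.

Lemma output_late_measurable j : measurable [set w | (T <= r j w)%N].
Proof.
rewrite (_ : [set w | _] = \bigcup_(k in [set k | (T <= k)%N]) (r j @^-1` [set k])).
  by apply: bigcup_measurable => k _; exact: output_event.
by apply/seteqP; split => [w Tw|w [l Tl Aw]]; [exists (r j w)|rewrite /= Aw].
Qed.

Lemma output_late0 j : P [set w | (T <= r j w)%N] = 0%E.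
Proof.
apply: measure_negligible; first exact: output_late_measurable.
exact: output_late_negligible.
Qed.

Lemma measurable_tail (dT : measure_display) (W : measurableType dT)
    (x : W -> borel R n) c : measurable_fun setT x ->
  measurable [set w | c <= enorm (exact_mapping (x w)) ^+ 2].
Proof.
move=> mx.
have mem2 : measurable_fun setT (fun w => enorm (exact_mapping (x w)) ^+ 2).
  apply: measurable_funX; apply: measurable_enorm.
  exact: (measurableT_comp measurable_exact_mapping mx).
rewrite (_ : [set w | _] =
    (fun w => enorm (exact_mapping (x w)) ^+ 2) @^-1` `[c, +oo[).
  by rewrite -[X in measurable X]setTI; exact: mem2.
by apply/seteqP; split => w /=; rewrite in_itv/= andbT.
Qed.

(** The event is split by the value [k] of the output index, which is independent of the iterates:
    each piece has probability at most 1 / T times a Markov bound, and the sum is the average of the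
    means [m k] over [c]. *)
Lemma run_output_tail j c : 0 < c ->
  (P [set w | (c <= enorm (exact_mapping (run_output j w)) ^+ 2)%R] <=
   (b%:R * (8 / alpha * (Phi x1 - Phistar) / T%:R
      + 10 * (2 * (V0 / T'%:R) + 2 * B0)) / c)%:E)%E.
Proof.
move=> c0; have [m hm msum] := mean_square_bound j.
have TR : 0 < T%:R :> R by rewrite ltr0n.
have T'R : 0 < T'%:R :> R by rewrite ltr0n.
pose A k := r j @^-1` [set k].
pose E k := [set w | c <= enorm (exact_mapping (iterate j k w)) ^+ 2].
pose late := [set w | (T <= r j w)%N].
have mE1 k : (k < T)%N -> <<s dsigma (past j k) >> (E k).
  by move=> kT; exact: (measurable_tail c (@measurable_iterate j k (ltnW kT))).
have mE k : (k < T)%N -> measurable (E k) by move=> kT; exact: dsigma_measurable (mE1 k kT).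
have PE k : (k < T)%N -> (P (A k `&` E k) <= (T%:R^-1 * (m k / c))%:E)%E.
  move=> kT; pose out : set Draw := [set OutputIndex T T' N j].
  have mA : <<s dsigma out >> (A k).
    apply: (@dsub (OutputIndex T T' N j) out) => //=.
    by exists [set k]; rewrite // setTI.
  have indJ : independent_systems P <<s dsigma out >> <<s dsigma (past j k) >>.
    by apply: samples_independent; rewrite -subset0 => e [/= ->].
  rewrite (indJ _ _ mA (mE1 k kT)) EFinM.
  have [_ ->] := draw_output draws j k; rewrite hpR kT.
  apply: lee_wpmul2l; first by rewrite lee_fin invr_ge0.
  apply: markov_ge => //; [|by move=> w; exact: sqr_ge0|by rewrite hm].
  apply: measurable_funX; apply: measurable_enorm.
  apply: (measurableT_comp measurable_exact_mapping).
  exact: (measurable_g_sigma (@dsigma_measurable _)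
    (@measurable_iterate j k (ltnW kT))).
have mlate := output_late_measurable j.
apply: (@le_trans _ _ (P (\big[setU/set0]_(k < T) (A k `&` E k) `|` late))).
  apply: le_measure; rewrite ?inE.
  - apply: measurable_tail; apply: (measurable_g_sigma (@dsigma_measurable _)).
    exact: measurable_run_output.
  - apply: measurableU => //; apply: bigsetU_measurable => k _.
    by apply: measurableI; [exact: output_event|exact: mE].
  - move=> w /=; rewrite /run_output; case: ltnP => [rT ge_c|]; last by right.
    left; rewrite -(bigcup_mkord T (fun k => A k `&` E k)); exists (r j w) => //.
have late0 : P late = 0%E by exact: output_late0.
apply: (@le_trans _ _ (P (\big[setU/set0]_(k < T) (A k `&` E k)) + P late)%E).
  apply: measureU2 => //; apply: bigsetU_measurable => k _.
  by apply: measurableI; [exact: output_event|exact: mE].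
rewrite late0 adde0.
apply: le_trans (Boole_inequality P (A := fun k => A k `&` E k) (n := T) _) _.
  by move=> k kT; apply: measurableI; [exact: output_event|exact: mE].
apply: (@le_trans _ _ (\sum_(k < T) (T%:R^-1 * (m k / c))%:E)%E).
  by apply: lee_sum => k _; exact: PE.
rewrite sumEFin lee_fin -mulr_sumr -mulr_suml mulrA ler_wpM2r ?invr_ge0 ?(ltW c0)//.
rewrite ler_pdivrMl//; apply: le_trans msum _.
rewrite le_eqVlt; apply/orP; left; apply/eqP.
by field; rewrite !gt_eqF.
Qed.

Hypothesis N0 : (0 < N)%N.

Definition post_average (x : 'cV[R]_n) (w : Omega) :=
  zo_average F mu N x (fun k => zeta k w) (fun k => v k w).

(** Stated for a fixed run [j], whose output depends on [run_draws j] alone and can be frozen; the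
    selected run depends on the post-optimization draws and cannot. *)
Lemma post_deviation j l : 0 < l ->
  (P [set w | (12 * B0 + 12 * l * V0 / N%:R <=
     6 * enorm (post_average (run_output j w) w - grad f (run_output j w)) ^+ 2)%R]
   <= (l^-1)%:E)%E.
Proof.
move=> l0; have [_ df hgrad hvar] := h1.
pose post : set Draw := [set e |
  match e with PostDirection _ | PostSample _ => True | _ => False end].
pose T1 := g_sigma_algebraType (dsigma (run_draws j)).
pose T2 := g_sigma_algebraType (dsigma post).
pose err (q : T1 * T2) := 6 * enorm (post_average (run_output j q.1) q.2
  - grad f (run_output j q.1)) ^+ 2.
have hx w := run_output_in j w.
have indJ : independent_systems P <<s dsigma (run_draws j) >> <<s dsigma post >>.
  by apply: samples_independent; rewrite -subset0; case=> [j' k'|j'|j' k' t|j' k' t|k'|k'] [].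
pose A : set (T1 * T2) := [set q | 12 * B0 + 12 * l * V0 / N%:R <= err q].
have mz k (kN : (k < N)%N) : @measurable_fun _ _ T2 Xi setT (zeta k).
  by apply: sigma_of_measurable; exact: (@dsub (PostSample S T T' (Ordinal kN)) post).
have mv k (kN : (k < N)%N) : @measurable_fun _ _ T2 (borel R n) setT (v k).
  by apply: sigma_of_measurable; exact: (@dsub (PostDirection S T T' (Ordinal kN)) post).
have mA : measurable A.
  have mx : @measurable_fun _ _ (T1 * T2)%type (borel R n) setT (fun q => run_output j q.1).
    exact: (measurableT_comp (@measurable_run_output j)).
  have merr : measurable_fun [set: T1 * T2] err.
    apply: measurable_funM; first exact: measurable_cst.
    apply: measurable_funX; apply: measurable_enorm; apply: measurable_vecB.
      apply: measurable_zo_average => // k kN.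
        exact: (measurableT_comp (mz k kN)).
      exact: (measurableT_comp (mv k kN)).
    exact: (measurableT_comp (measurable_grad df)).
  rewrite (_ : A = err @^-1` `[12 * B0 + 12 * l * V0 / N%:R, +oo[).
    by rewrite -[X in measurable X]setTI; exact: merr.
  by apply/seteqP; split => q; rewrite /A /= in_itv/= andbT.
apply: (decoupling_prob (S1 := dsigma (run_draws j)) (S2 := dsigma post)
  (@dsigma_measurable _) (@dsigma_measurable _) indJ (A := A)) => //.
  by rewrite lee_fin invr_ge0 ltW.
move=> w.
apply: (zo_average_deviation mF mu0 Lf0 (hgrad (run_output j w))
    (hvar _ (hx w)) (h3 (hx w)) hLip N0 (u := v) (xi := zeta)) => //.
- by move=> k kN; exact: (draw_post_direction draws).
- by move=> k kN; exact: (draw_post_sample draws).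
- move=> k kN.
  apply: independent_systemsS (samples_independent
    (J1 := [set PostSample S T T' (Ordinal kN)])
    (J2 := [set PostDirection S T T' (Ordinal kN)]) _).
  + exact: (@dsub (PostSample S T T' (Ordinal kN))).
  + exact: (@dsub (PostDirection S T T' (Ordinal kN))).
  + by rewrite -subset0 => e [-> //].
- move=> s t sN tN st.
  pose both t (tN : (t < N)%N) := [set PostSample S T T' (Ordinal tN);
    PostDirection S T T' (Ordinal tN)].
  have bothP t' (tN' : (t' < N)%N) :
      <<s sigma_of (zeta t') `|` sigma_of (v t') >> `<=` <<s dsigma (both t' tN') >>.
    apply: smallest_sub; first exact: smallest_sigma_algebra.
    rewrite subUset; split.
      by apply: (@dsub (PostSample S T T' (Ordinal tN'))); left.
    by apply: (@dsub (PostDirection S T T' (Ordinal tN'))); right.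
  apply: independent_systemsS (bothP s sN) (bothP t tN) (samples_independent _).
  by rewrite -subset0 => e [[] -> []] // [] ts; rewrite ts eqxx in st.
Qed.

Hypothesis S0 : (0 < S)%N.

Lemma all_runs_tail c q :
  (forall j, P [set w | (c <= enorm (exact_mapping (run_output j w)) ^+ 2)%R]
     <= q%:E)%E ->
  (P (\bigcap_j [set w | (c <= enorm (exact_mapping (run_output j w)) ^+ 2)%R])
     <= (q ^+ S)%:E)%E.
Proof.
move=> hq.
pose E j := [set w | c <= enorm (exact_mapping (run_output j w)) ^+ 2].
(* The labels must cover all draws; the post-optimization ones are put with run 0, which only
   enlarges the sigma-algebra of that run. *)
pose lab (e : Draw) : 'I_S := match e with
  | BlockIndex j _ | OutputIndex j | Direction j _ _ | Sample j _ _ => j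
  | PostDirection _ | PostSample _ => Ordinal S0
  end.
have mE1 j : <<s dsigma [set e | lab e = j] >> (E j).
  apply: (@draws_sigmaS _ _ _ _ _ _ _ _ _ _ _ _ _ _ _ _ _ _ (run_draws j)).
    by case=> [j' k'|j'|j' k' t|j' k' t|k'|k'].
  exact: (measurable_tail c (@measurable_run_output j)).
have mE j : measurable (E j) by exact: dsigma_measurable (mE1 j).
have indE := independent_family_group (lab := lab)
  (draw_sigma_algebra i r u xi v zeta) (draw_sigma_measurable draws) (draws_family draws).
rewrite (indE E mE1).
under eq_bigr => j _ do rewrite -(fineK (fin_num_measure P _ (mE j))).
rewrite prodEFin lee_fin -[S in leRHS]card_ord -prodr_const.
apply: ler_prod => j _; rewrite fine_ge0//=.
by rewrite -lee_fin fineK ?fin_num_measure//; exact: hq.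
Qed.

(** A union bound over [E] and, for each of the [S] runs, a large error or a late output index; the
    latter is a null event off which [run_output] is the actual output. Their sum S / l + 2^-S is
    below the stated bound. *)
Lemma two_phase_bound (xstar : {RV P >-> borel R n}) c t l : 0 < l ->
  (forall j, P [set w | (c <= enorm (exact_mapping (run_output j w)) ^+ 2)%R]
     <= (2^-1)%:E)%E ->
  12 * B0 + 12 * l * V0 / N%:R <= t ->
  (forall w, exists2 j, xstar w = iterate j (r j w) w &
     is_argmin setT (fun j' => enorm (gradient_mapping X chi phi
       (iterate j' (r j' w) w) (post_average (iterate j' (r j' w) w) w) alpha)) j) ->
  (P [set w | (4 * c + t <= enorm (exact_mapping (xstar w)) ^+ 2)%R] <=
     (S.+1%:R / l + 2 ^- S)%:E)%E.
Proof.
move=> l0 hc ht hstar; have [_ df _ _] := h1.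
pose E := \bigcap_j [set w | c <= enorm (exact_mapping (run_output j w)) ^+ 2].
pose thr := 12 * B0 + 12 * l * V0 / N%:R.
pose err j w := 6 * enorm (post_average (run_output j w) w - grad f (run_output j w)) ^+ 2.
pose G (j : 'I_S) := [set w | thr <= err j w].
pose late j := [set w | (T <= r j w)%N].
have mrun j : @measurable_fun _ _ Omega (borel R n) setT (run_output j).
  exact: (measurable_g_sigma (@dsigma_measurable _) (@measurable_run_output j)).
have mE : measurable E by apply: fin_bigcap_measurable => // j _; exact: measurable_tail.
have mG j : measurable (G j).
  have merr : measurable_fun setT (err j).
    apply: measurable_funM; first exact: measurable_cst.
    apply: measurable_funX; apply: measurable_enorm; apply: measurable_vecB.
      by apply: measurable_zo_average => // k kN.
    exact: (measurableT_comp (measurable_grad df)).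
  rewrite (_ : G j = err j @^-1` `[thr, +oo[).
    by rewrite -[X in measurable X]setTI; exact: merr.
  by apply/seteqP; split => w; rewrite /G /= in_itv/= andbT.
(* Indexing by natural numbers, with [set0] beyond [S], fits the finite union and Boole's
   inequality. *)
pose H k := if insub k is Some j then G j `|` late j else set0.
have mH k : measurable (H k).
  rewrite /H; case: insub => // j; apply: measurableU => //.
  exact: output_late_measurable.
have PH (j : 'I_S) : (P (H j) <= (l^-1)%:E)%E.
  rewrite /H valK; apply: le_trans (measureU2 P (mG j) (output_late_measurable j)) _.
  rewrite [X in (_ + X)%E](_ : _ = 0)%E ?adde0; first exact: post_deviation.
  exact: output_late0.
apply: (@le_trans _ _ (P (\big[setU/set0]_(j < S) H j `|` E))).
  apply: le_measure; rewrite ?inE.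
  - by apply: measurable_tail; exact: measurable_funPT.
  - by apply: measurableU => //; apply: bigsetU_measurable.
  move=> w /= hw; rewrite -(bigcup_mkord S H).
  have [[j Hj]|nH] := pselect (exists j : 'I_S, H j w).
    by left; exists (j : nat) => //=; exact: ltn_ord.
  right => j _ /=; rewrite leNgt; apply/negP => lt_c.
  have ok j' : run_output j' w = iterate j' (r j' w) w /\ err j' w < thr.
    have := contra_not (fun h => ex_intro _ j' h) nH; rewrite /H valK => /not_orP[nG nl].
    split; last by rewrite ltNge; apply/negP.
    by rewrite /run_output ltnNge; case: leqP nl => // ? [].
  have [j' xj' [_ minj]] := hstar w.
  have := minj j Logic.I; rewrite -!(ok _).1 => le_g.
  have [[ok1 ej] [ok1' ej']] := (ok j, ok j').
  move: hw; rewrite xj' -ok1'; apply/negP; rewrite -ltNge.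
  set y := run_output j w in le_g lt_c ej *.
  set y' := run_output j' w in le_g ej' *.
  have lip (x : 'cV[R]_n) : enorm (exact_mapping x
      - gradient_mapping X chi phi x (post_average x w) alpha) <=
      enorm (post_average x w - grad f x).
    rewrite -[leRHS]enormN opprB.
    exact: (gradient_mapping_lipschitz hX hchi hphi X0 alpha0).
  have tri (a e : 'cV[R]_n) : enorm a <= enorm e + enorm (a - e).
    by rewrite -{1}[a](subrKC e) enorm_triangle.
  have d1 := tri (exact_mapping y') (gradient_mapping X chi phi y' (post_average y' w) alpha).
  have d2 := tri (gradient_mapping X chi phi y (post_average y w) alpha) (exact_mapping y).
  rewrite -[enorm (_ - exact_mapping y)]enormN opprB in d2.
  have d3 := lip y; have d4 := lip y'.
  (* Here [a] and [a'] are the norms of the exact mapping at the run [y] below [c] and at the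
     selected [y'], and [g] is the estimated norm at [y], which by minimality is at least the one at
     [y']. *)
  apply: (lt_le_trans (perturbed_min_sqr (enorm_ge0 _) (enorm_ge0 _) (enorm_ge0 _)
    (enorm_ge0 _) (le_trans d1 (lerD le_g d4)) (le_trans d2 (lerD (lexx _) d3)) lt_c ej ej')).
  by rewrite lerD2l.
apply: (@le_trans _ _ (P (\big[setU/set0]_(j < S) H j) + P E)%E).
  by apply: measureU2 => //; exact: bigsetU_measurable.
rewrite EFinD; apply: leeD; last by rewrite -exprVn; exact: all_runs_tail.
apply: le_trans (Boole_inequality P (A := H) (fun k _ => mH k)) _.
apply: (@le_trans _ _ (\sum_(j < S) (l^-1)%:E)%E).
  by apply: lee_sum => j _; exact: PH.
rewrite sumEFin lee_fin sumr_const card_ord -[leLHS]mulr_natl.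
rewrite ler_wpM2r ?invr_ge0 ?(ltW l0)//.
by rewrite ler_nat.
Qed.

End Runs.

(** * Batch sizes and constants *)

Section Constants.
Context (R : realType) (n : nat) (M sigma Lt Dt D : R) (Tt : nat).
Hypotheses (Lt0 : 0 < Lt) (Dt0 : 0 < Dt) (Tt0 : (0 < Tt)%N).

Local Notation n4 := (n.+4%:R : R).
Local Notation Q := (n4 * (2 * M ^+ 2 + sigma ^+ 2)).
Local Notation T' := (batch_size n M sigma Lt Dt Tt).
Local Notation A := (Num.sqrt (Q * Tt%:R) / (Lt * Dt)).

Let n4_0 : 0 < n4. Proof. by rewrite ltr0n. Qed.
Let TtR : 0 < Tt%:R :> R. Proof. by rewrite ltr0n. Qed.
Let LD0 : 0 < Lt * Dt. Proof. exact: mulr_gt0. Qed.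
Let Q0 : 0 <= Q.
Proof. by rewrite mulr_ge0// addr_ge0 ?sqr_ge0// mulr_ge0 ?sqr_ge0. Qed.
Let A0 : 0 <= A.
Proof. by rewrite divr_ge0 ?sqrtr_ge0// ltW. Qed.

Let size0 : 0 < Num.min (Num.max A n4) Tt%:R.
Proof. by rewrite lt_min TtR andbT lt_max n4_0 orbT. Qed.

Let batchE : T'%:R = (Num.ceil (Num.min (Num.max A n4) Tt%:R))%:~R :> R.
Proof.
rewrite /batch_size natr_absz ger0_norm// -(ler_int R); apply/ltW.
exact: lt_le_trans size0 (ceil_ge _).
Qed.

Lemma batch_size_ge : Num.min (Num.max A n4) Tt%:R <= T'%:R.
Proof. by rewrite batchE ceil_ge. Qed.

Lemma batch_size_gt0 : (0 < T')%N.
Proof. by rewrite -(ltr0n R); exact: lt_le_trans size0 batch_size_ge. Qed.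

Lemma batch_size_le : (T' <= Tt)%N.
Proof.
rewrite -(ler_nat R) batchE [leRHS]pmulrn ler_int ceil_le_int ge_min.
by rewrite -pmulrn lexx orbT.
Qed.

Lemma batch_size_le_max : T'%:R <= A + n4 + 1.
Proof.
rewrite batchE -lerBlDr -[X in _ - X]/(1%:~R) -intrB.
apply: (le_trans (ltW (ceilB1_lt _))); rewrite ge_min; apply/orP; left; rewrite ge_max.
by rewrite lerDl (ltW n4_0) lerDr A0.
Qed.

Local Notation T := (iteration_limit n M sigma Lt Dt Tt).

Lemma iteration_limit_gt0 : (0 < T)%N.
Proof. by rewrite divn_gt0 ?batch_size_gt0// batch_size_le. Qed.

(** Rounding down loses at most a factor 2: the remainder is below [T'], which is at most the
    product of [T] and [T']. *)
Lemma iteration_limit_ge : Tt%:R <= 2 * T%:R * T'%:R :> R.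
Proof.
rewrite -!natrM ler_nat {1}(divn_eq Tt T') -/T.
have r := ltn_pmod Tt batch_size_gt0; have T0 := iteration_limit_gt0.
rewrite -mulnA mul2n -addnn leq_add2l; apply: leq_trans (ltnW r) _.
by rewrite leq_pmull.
Qed.

Lemma smoothing_sqr (mu : R) : 0 < D -> 0 <= mu ->
  mu <= D / n4 * Num.sqrt Tt%:R^-1 -> mu ^+ 2 * n4 ^+ 2 <= D ^+ 2 / Tt%:R.
Proof.
move=> D0 mu0 muD; rewrite -exprMn.
have -> : D ^+ 2 / Tt%:R = (D * Num.sqrt Tt%:R^-1) ^+ 2.
  by rewrite exprMn sqr_sqrtr// invr_ge0 ltW.
rewrite ler_pXn2r ?nnegrE ?mulr_ge0 ?sqrtr_ge0 ?(ltW D0)//.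
by rewrite -ler_pdivlMr// mulrAC.
Qed.

(** Up to the factor [b], the left side bounds the mean square of a run with alpha = 1 / Lhat: the
    initial gap is Lhat D^2 with Lhat <= Lt, and 20 is the error weight 10 times the 2 in the second
    moment of a batch average. *)
Lemma Bbound_dominates (Lf mu V0 B0 : R) : 0 < D -> 0 <= Lf -> Lf <= Lt ->
  0 <= mu -> mu <= D / n4 * Num.sqrt Tt%:R^-1 ->
  V0 = (n%:R + 2) * (4 * M ^+ 2 + 2 * sigma ^+ 2) + Lf ^+ 2 * mu ^+ 2 * n4 ^+ 3 ->
  B0 = Lf ^+ 2 * mu ^+ 2 / 4 * n4 ^+ 3 ->
  8 * Lt ^+ 2 * D ^+ 2 / T%:R + 20 * (V0 / T'%:R) + 20 * B0 <=
    2 * Lt * Bbound n M sigma Lt Dt D Tt.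
Proof.
move=> D0 Lf0 LfLt mu0 muD -> ->.
have T0 : 0 < T%:R :> R by rewrite ltr0n iteration_limit_gt0.
have r0 : 0 < T'%:R :> R by rewrite ltr0n batch_size_gt0.
have r1 : 1 <= T'%:R :> R by rewrite ler1n batch_size_gt0.
have rge := batch_size_ge; have rle := batch_size_le_max.
have Tge := iteration_limit_ge.
have smooth := smoothing_sqr D0 mu0 muD.
have Lt00 := ltW Lt0; have D00 := ltW D0; have Dt00 := ltW Dt0.
rewrite /Bbound; set g1 := gamma1 _ _ _ _ _ _; set g2 := gamma2 _ _ _.
have g1_1 : 1 <= g1 by rewrite /g1 /gamma1 le_max lexx orbT.
have g2_1 : 1 <= g2 by rewrite /g2 /gamma2 le_max lexx orbT.
have g1_q : Num.sqrt Q / (Lt * Dt * Num.sqrt Tt%:R) <= g1.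
  by rewrite /g1 /gamma1 le_max lexx.
have n4E : n4 = n%:R + 4 by rewrite -addn4 natrD.
move: rge rle; rewrite sqrtrM//; set q := Num.sqrt Q; set w := Num.sqrt Tt%:R.
have q0 : 0 <= q by exact: sqrtr_ge0.
have w0 : 0 < w by rewrite sqrtr_gt0.
have qQ : q ^+ 2 = Q by rewrite sqr_sqrtr.
have wT : w ^+ 2 = Tt%:R by rewrite sqr_sqrtr.
rewrite -/q -/w in g1_q.
set r : R := T'%:R in r0 r1 Tge *; set t : R := T%:R in T0 Tge *.
rewrite -wT in smooth Tge *; move=> rge rle.
(* The unit for all terms of order n4 / Tt: they add up to at most 45 E, against the (128 g2 + 66) E
   available on the right. *)
pose E := Lt ^+ 2 * D ^+ 2 * n4 / w ^+ 2.
have w20 : 0 < w ^+ 2 by rewrite exprn_gt0.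
have E0 : 0 < E.
  by apply: divr_gt0 => //; apply: mulr_gt0 => //; apply: mulr_gt0; rewrite exprn_gt0.
have LfE : Lf ^+ 2 * mu ^+ 2 * n4 ^+ 3 <= E.
  rewrite (_ : Lf ^+ 2 * _ * _ = Lf ^+ 2 * n4 * (mu ^+ 2 * n4 ^+ 2)); last by ring.
  rewrite (_ : E = Lt ^+ 2 * n4 * (D ^+ 2 / w ^+ 2)); last by rewrite /E; ring.
  apply: ler_pM => //; first by rewrite mulr_ge0// sqr_ge0.
    by rewrite mulr_ge0 ?sqr_ge0.
  by rewrite ler_wpM2r// ler_pXn2r ?nnegrE// ltW.
(* Origin of [gamma1]: a batch of size at least [A] gives the bound with factor 1, while one
   truncated at [Tt] gives q^2 / w^2, the same bound times q / (Lt Dt w). *)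
have Qr : q ^+ 2 / r <= Lt * (q / w) * (Dt * g1).
  have k0 : 0 <= Lt * (q / w) * Dt.
    by rewrite !mulr_ge0 ?invr_ge0// ltW.
  move: rge; rewrite ge_min => /orP[].
    rewrite ge_max => /andP[rA _].
    apply: (@le_trans _ _ (Lt * (q / w) * Dt)); last first.
      by rewrite [leRHS]mulrA -[leLHS]mulr1; apply: ler_wpM2l.
    rewrite ler_pdivrMr//.
    rewrite ler_pdivrMr// in rA.
    rewrite (_ : q ^+ 2 = q / w * (q * w)); last by field; rewrite gt_eqF.
    rewrite (_ : Lt * _ * _ * r = q / w * (r * (Lt * Dt))); last by ring.
    by apply: ler_wpM2l => //; rewrite divr_ge0// ltW.
  move=> rT; apply: (@le_trans _ _ (Lt * (q / w) * Dt * (q / (Lt * Dt * w)))).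
    rewrite (_ : Lt * _ * _ * _ = q ^+ 2 / w ^+ 2); last by field; rewrite !gt_eqF.
    by apply: ler_wpM2l; rewrite ?sqr_ge0// lef_pV2 ?posrE.
  by rewrite [leRHS]mulrA; apply: ler_wpM2l.
have V0r : ((n%:R + 2) * (4 * M ^+ 2 + 2 * sigma ^+ 2)
    + Lf ^+ 2 * mu ^+ 2 * n4 ^+ 3) / r <= 2 * (q ^+ 2 / r) + E.
  rewrite mulrDl; apply: lerD.
    rewrite mulrA ler_wpM2r ?invr_ge0 ?(ltW r0)// qQ n4E.
    have := sqr_ge0 M; have := sqr_ge0 sigma; have : 0 <= n%:R :> R by [].
    nra.
  apply: le_trans LfE; rewrite ler_pdivrMr//.
  by rewrite ler_peMr// !mulr_ge0// ?exprn_ge0.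
(* First 1 / t <= 2 r / w^2, then r <= A + n4 + 1: the part [A] gives the term with D^2 / Dt, and n4
   + 1 <= 5 / 4 n4 turns 16 into 20. *)
have term3 : 8 * Lt ^+ 2 * D ^+ 2 / t <= 16 * (Lt * (q / w) * (D ^+ 2 / Dt)) + 20 * E.
  apply: (@le_trans _ _ (16 * (Lt ^+ 2 * D ^+ 2 / w ^+ 2) * r)).
    rewrite (_ : 16 * _ * r = 8 * Lt ^+ 2 * D ^+ 2 * (2 * r / w ^+ 2)); last by ring.
    apply: ler_wpM2l; first by rewrite !mulr_ge0.
    rewrite ler_pdivlMr// ler_pdivrMl//; move: Tge; lra.
  have c0 : 0 <= 16 * (Lt ^+ 2 * D ^+ 2 / w ^+ 2).
    by rewrite mulr_ge0// divr_ge0 ?(ltW w20)// !mulr_ge0.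
  apply: le_trans (ler_wpM2l c0 rle) _.
  rewrite (_ : 16 * _ * _ = 16 * (Lt * (q / w) * (D ^+ 2 / Dt)) +
    16 * (Lt ^+ 2 * D ^+ 2 / w ^+ 2) * (n4 + 1)); last by field; rewrite !gt_eqF.
  rewrite lerD2l (_ : 20 * E = 16 * (Lt ^+ 2 * D ^+ 2 / w ^+ 2) * (5 / 4 * n4)).
    by apply: ler_wpM2l => //; rewrite n4E; have : 0 <= n%:R :> R by []; lra.
  by rewrite /E; field; rewrite gt_eqF.
have K2 : 0 <= Lt * (q / w) * (D ^+ 2 / Dt).
  by rewrite !mulr_ge0 ?invr_ge0// ltW.
have K1 : 0 <= q ^+ 2 / r by rewrite divr_ge0 ?sqr_ge0// ltW.
rewrite (_ : 2 * Lt * _ = 128 * (Lt * (q / w) * (Dt * g1))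
  + 128 * (Lt * (q / w) * (D ^+ 2 / Dt)) + (128 * g2 + 66) * E); last first.
  by rewrite /E; field; rewrite !gt_eqF.
have gE : E <= g2 * E by rewrite ler_peMl// ltW.
lra.
Qed.

(** The bias term 12 B0 = 3 Lf^2 mu^2 n4^3 fits the term without [l]. As V0 <= 2 n4 (2 M^2 +
    sigma^2) + n4 E, the factor 12 gives coefficients 24 and 12, both within 32. The factor [b]
    enters through 1 <= b. *)
Lemma threshold_dominates (b N : nat) (Lf mu l V0 B0 : R) : 0 < D -> 0 <= Lf ->
  0 <= mu -> mu <= D / n4 * Num.sqrt Tt%:R^-1 -> (0 < b)%N -> (0 < N)%N -> 0 < l ->
  V0 = (n%:R + 2) * (4 * M ^+ 2 + 2 * sigma ^+ 2) + Lf ^+ 2 * mu ^+ 2 * n4 ^+ 3 ->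
  B0 = Lf ^+ 2 * mu ^+ 2 / 4 * n4 ^+ 3 ->
  12 * B0 + 12 * l * V0 / N%:R <=
    3 * D ^+ 2 * Lf ^+ 2 * b%:R * n4 / Tt%:R
    + 32 * n4 * l / N%:R
        * (2 * M ^+ 2 + sigma ^+ 2 + D ^+ 2 * Lf ^+ 2 * b%:R / Tt%:R).
Proof.
move=> D0 Lf0 mu0 muD b0 N0 l0 -> ->.
have smooth := smoothing_sqr D0 mu0 muD.
have b1 : 1 <= b%:R :> R by rewrite ler1n.
have NR : 0 < N%:R :> R by rewrite ltr0n.
pose E := D ^+ 2 * Lf ^+ 2 * b%:R / Tt%:R.
have LfE : Lf ^+ 2 * mu ^+ 2 * n4 ^+ 3 <= n4 * E.
  rewrite (_ : Lf ^+ 2 * _ * _ = n4 * Lf ^+ 2 * (mu ^+ 2 * n4 ^+ 2)); last by ring.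
  rewrite (_ : n4 * E = n4 * Lf ^+ 2 * (D ^+ 2 / Tt%:R * b%:R)); last by rewrite /E; ring.
  apply: ler_wpM2l; first by rewrite mulr_ge0// sqr_ge0.
  by apply: le_trans smooth _; rewrite ler_peMr// divr_ge0 ?sqr_ge0// ltW.
have D00 := ltW D0.
have E0 : 0 <= E by rewrite divr_ge0 ?(ltW TtR)// !mulr_ge0.
apply: lerD.
  rewrite (_ : 12 * _ = 3 * (Lf ^+ 2 * mu ^+ 2 * n4 ^+ 3)); last by field.
  rewrite (_ : 3 * D ^+ 2 * _ * _ * _ / _ = 3 * (n4 * E)); last by rewrite /E; ring.
  by rewrite ler_wpM2l.
rewrite -/E.
have c0 : 0 <= l / N%:R by rewrite divr_ge0// ltW.
rewrite (_ : 12 * l * _ / _ = l / N%:R * (12 * ((n%:R + 2) * (4 * M ^+ 2 + 2 * sigma ^+ 2)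
    + Lf ^+ 2 * mu ^+ 2 * n4 ^+ 3))); last by ring.
rewrite (_ : 32 * n4 * _ / _ * _ = l / N%:R *
  (32 * (n4 * (2 * M ^+ 2 + sigma ^+ 2)) + 32 * (n4 * E))); last by ring.
apply: ler_wpM2l => //.
have nE : 0 <= n4 * E by rewrite mulr_ge0.
have : (n%:R + 2) * (4 * M ^+ 2 + 2 * sigma ^+ 2) <= 2 * (n4 * (2 * M ^+ 2 + sigma ^+ 2)).
  have -> : n4 = n%:R + 4 by rewrite -addn4 natrD.
  have := sqr_ge0 M; have := sqr_ge0 sigma; have : 0 <= n%:R :> R by [].
  nra.
have := Q0; lra.
Qed.

End Constants.

(** Constant stepsizes and uniform block probabilities make all weights equal; it remains to see
    that the common weight is nonzero, so that it cancels. *)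
Lemma output_pmf_uniform (R : realType) (b T : nat) (L : 'I_b -> R) (Lhat : R) :
  (0 < b)%N -> 0 < Lhat -> (forall s, L s <= Lhat) ->
  forall k, output_pmf L (fun=> b%:R^-1) (fun=> Lhat^-1) T k =
    if (k < T)%N then T%:R^-1 else 0.
Proof.
move=> b0 Lhat0 LLhat k; rewrite /output_pmf; case: ifP => // kT.
set w := Lhat^-1 * inf _.
have w0 : 0 < w.
  rewrite mulr_gt0 ?invr_gt0//.
  have bR : 0 < b%:R^-1 :> R by rewrite invr_gt0 ltr0n.
  (* Since L s <= Lhat, each factor 1 - L s / (2 Lhat) is at least 1/2. *)
  apply: (@lt_le_trans _ _ (b%:R^-1 / 2)); first by rewrite divr_gt0.
  apply: lb_le_inf; first by exists (b%:R^-1 * (1 - L (Ordinal b0) / 2 * Lhat^-1)), (Ordinal b0).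
  move=> _ [s _ <-]; apply: ler_wpM2l; first exact: ltW.
  have : L s / 2 * Lhat^-1 <= 2^-1.
    rewrite ler_pdivrMr//; have := LLhat s; lra.
  lra.
rewrite sumr_const card_ord -[w *+ T]mulr_natr invfM mulrA divff ?mul1r//.
by rewrite gt_eqF.
Qed.

Theorem theorem4 (R : realType) (b : nat) (d : 'I_b -> nat)
  (X : forall s, set 'cV[R]_(d s))
  (chi phi : forall s, 'cV[R]_(d s) -> R)
  (dXi : measure_display) (Xi : measurableType dXi) (Pxi : probability Xi R)
  (F : 'cV[R]_(\sum_(s < b) d s) -> Xi -> R)
  (f : 'cV[R]_(\sum_(s < b) d s) -> R)
  (L : 'I_b -> R) (Lf sigma M Dt Phistar mu : R)
  (x1 : 'cV[R]_(\sum_(s < b) d s))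
  (S Tt N : nat)
  (dO : measure_display) (Omega : measurableType dO) (P : probability Omega R)
  (i : 'I_S -> nat -> Omega -> 'I_b)
  (r : 'I_S -> Omega -> nat)
  (u : 'I_S -> nat -> nat -> {RV P >-> borel R (\sum_(s < b) d s)})
  (xi : 'I_S -> nat -> nat -> {RV P >-> Xi})
  (v : nat -> {RV P >-> borel R (\sum_(s < b) d s)})
  (zeta : nat -> {RV P >-> Xi})
  (xstar : {RV P >-> borel R (\sum_(s < b) d s)}) :
  let n := (\sum_(s < b) d s)%N in
  let Phi x := f x + block_sum chi x in
  let Lhat : R := \big[Num.max/0]_(s < b) L s in
  let Lt : R := Num.max Lf Lhat in
  let Dphi : R := Num.sqrt ((Phi x1 - Phistar) / Lhat) in
  let T' := batch_size n M sigma Lt Dt Tt in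
  let T := iteration_limit n M sigma Lt Dt Tt in
  let p (s : 'I_b) : R := b%:R^-1 in
  let alpha (k : nat) : R := Lhat^-1 in
  let xbar (j : 'I_S) (w : Omega) :=
    zs_bmd_iterate X chi phi F mu alpha (fun=> T') x1
      (fun k => i j k w) (fun k t => xi j k t w) (fun k t => u j k t w)
      (r j w) in
  let Gpost (w : Omega) x :=
    zo_average F mu N x (fun k => zeta k w) (fun k => v k w) in
  (0 < b)%N -> (0 < S)%N -> (0 < Tt)%N -> (0 < N)%N ->
  (forall s, closed (X s) /\ convex_set (X s)) ->
  (forall s, closed_convex_function (chi s)) ->
  (forall s, (forall y, differentiable (phi s) y) /\
             strongly_convex1 (phi s)) ->
  measurable_fun setT (fun q : borel R n * Xi => F q.1 q.2) ->
  0 < Lf -> (forall s, 0 < L s) ->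
  assumption1 X F Pxi f sigma ->
  assumption2 F Pxi Lf L ->
  assumption3 X f M ->
  (exists2 x, is_argmin (product_set X) Phi x & Phistar = Phi x) ->
  product_set X x1 ->
  0 < Dt ->
  0 < mu -> mu <= Dphi / n.+4%:R * Num.sqrt Tt%:R^-1 ->
  two_phase_draws Pxi p (output_pmf L p alpha T) T T' N i r u xi v zeta ->
  (forall w, exists2 j, xstar w = xbar j w &
     is_argmin setT (fun j' => enorm (gradient_mapping X chi phi (xbar j' w)
                                        (Gpost w (xbar j' w)) Lhat^-1)) j) ->
  forall lambda : R, 0 < lambda ->
  (P [set w | (
       16 * b%:R * Lt * Bbound n M sigma Lt Dt Dphi Tt
       + 3 * Dphi ^+ 2 * Lf ^+ 2 * b%:R * n.+4%:R / Tt%:R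
       + 32 * n.+4%:R * lambda / N%:R
           * (2 * M ^+ 2 + sigma ^+ 2
              + Dphi ^+ 2 * Lf ^+ 2 * b%:R / Tt%:R)
       <= enorm (gradient_mapping X chi phi (xstar w)
                   (grad f (xstar w)) Lhat^-1) ^+ 2)%R]
   <= (S.+1%:R / lambda + 2 ^- S)%:E)%E.

Proof.
move=> n Phi Lhat Lt Dphi T' T p alpha xbar Gpost b0 S0 Tt0 N0 hX hchi hphi mF
  Lf0 L0 h1 h2 h3 [xmin [_ Phi_min] PhistarE] Xx1 Dt0 mu0 muD draws hmin lambda l0.
have LLhat s : L s <= Lhat by exact: le_bigmax.
have Lhat0 : 0 < Lhat by apply: lt_le_trans (L0 (Ordinal b0)) (LLhat _).
have Lt0 : 0 < Lt by rewrite lt_max Lf0.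
have LhatLt : Lhat <= Lt by rewrite le_max lexx orbT.
have LfLt : Lf <= Lt by rewrite le_max lexx.
(* A positive [mu] bounded by a multiple of [Dphi] rules out Dphi = 0, so the initial gap is
   positive as well. *)
have Dphi0 : 0 < Dphi.
  rewrite lt_neqAle sqrtr_ge0 andbT; apply/eqP => D0.
  by move: (lt_le_trans mu0 muD); rewrite -D0 !mul0r ltxx.
have gapE : Phi x1 - Phistar = Lhat * Dphi ^+ 2.
  rewrite sqr_sqrtr; last by rewrite ltW// -sqrtr_gt0.
  by rewrite mulrCA divff ?mulr1// gt_eqF.
have T'0 : (0 < T')%N by exact: batch_size_gt0.
have T0 : (0 < T)%N by exact: iteration_limit_gt0.
have alpha0 : 0 < Lhat^-1 by rewrite invr_gt0.
have hL s : L s <= Lhat^-1^-1 by rewrite invrK.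
have hpR := output_pmf_uniform T b0 Lhat0 LLhat.
have Phi_ge x : product_set X x -> Phistar <= f x + block_sum chi x.
  by move=> Xx; rewrite PhistarE; exact: Phi_min.
have [bR bR1] : 0 < b%:R :> R /\ 1 <= b%:R :> R by rewrite ltr0n ler1n.
set B := Bbound n M sigma Lt Dt Dphi Tt.
have budget := Bbound_dominates (M := M) (sigma := sigma) Lt0 Dt0 Tt0 Dphi0
  (ltW Lf0) LfLt (ltW mu0) muD erefl erefl.
rewrite -/T -/T' -/B in budget.
have thr := threshold_dominates (M := M) (sigma := sigma) Tt0 Dphi0
  (ltW Lf0) (ltW mu0) muD b0 N0 l0 erefl erefl.
(* Markov's inequality needs a positive level; positivity is read off the left side of [budget],
   whose first term is positive. *)
have B0 : 0 < 2 * Lt * B.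
  apply: lt_le_trans budget.
  have t1 : 0 < 8 * Lt ^+ 2 * Dphi ^+ 2 / T%:R.
    by rewrite divr_gt0 ?ltr0n// !mulr_gt0.
  have t2 := zo_variance_bound_gt0 d sigma M mu0 Lf0.
  have t3 : 0 <= zo_bias_bound d mu Lf.
    by rewrite mulr_ge0 ?exprn_ge0// divr_ge0// mulr_ge0// sqr_ge0.
  have t4 : 0 <= zo_variance_bound d mu Lf sigma M / T'%:R.
    by rewrite divr_ge0// ltW.
  rewrite -/(zo_variance_bound d mu Lf sigma M) -/(zo_bias_bound d mu Lf); lra.
(* Twice the bound b (2 Lt B) of the mean square at the output of a run, so that each tail is at
   most 1/2. *)
pose c := 4 * b%:R * Lt * B.
have c0 : 0 < c.
  rewrite (_ : c = 2 * b%:R * (2 * Lt * B)); last by rewrite /c; ring.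
  by rewrite mulr_gt0// mulr_gt0.
have tail j := run_output_tail hX hchi hphi mF mu0 Lf0 h1 h2 h3 Xx1 alpha0 hL draws
  T'0 b0 (fun=> erefl) Phi_ge T0 hpR j c0.
have half j : (P [set w | (c <= enorm (exact_mapping X chi phi f Lhat^-1
    (run_output X chi phi F mu x1 Lhat^-1 T T' i r u xi j w)) ^+ 2)%R] <= (2^-1)%:E)%E.
  apply: le_trans (tail j) _; rewrite lee_fin ler_pdivrMr// -/(Phi x1) gapE invrK.
  rewrite (_ : 2^-1 * c = b%:R * (2 * Lt * B)); last by rewrite /c; field.
  apply: ler_wpM2l; first exact: ltW.
  apply: le_trans budget.
  have : 8 * Lhat * (Lhat * Dphi ^+ 2) / T%:R <= 8 * Lt ^+ 2 * Dphi ^+ 2 / T%:R.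
    apply: ler_wpM2r; first by rewrite invr_ge0.
    rewrite (_ : 8 * Lhat * _ = 8 * Dphi ^+ 2 * Lhat ^+ 2); last by ring.
    rewrite (_ : 8 * Lt ^+ 2 * _ = 8 * Dphi ^+ 2 * Lt ^+ 2); last by ring.
    apply: ler_wpM2l; first by rewrite mulr_ge0// sqr_ge0.
    by rewrite ler_pXn2r ?nnegrE ?(ltW Lhat0) ?(ltW Lt0).
  rewrite -/(zo_variance_bound d mu Lf sigma M) -/(zo_bias_bound d mu Lf); lra.
have := two_phase_bound hX hchi hphi mF mu0 Lf0 h1 h2 h3 Xx1 alpha0 draws
  hpR N0 S0 l0 half thr hmin.
rewrite (_ : 4 * c = 16 * b%:R * Lt * B); last by rewrite /c; ring.
by rewrite addrA.
Qed.
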